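(* Let $n\ge1$, $X\in\{\mathbb{R}^n,\mathbb{R}^n_+\}$ and $\mu\ge0$. Let $\phi:[0,\infty)^2\to\mathbb{R}$ and $k,g:[0,\infty)\to\mathbb{R}$ be continuous functions such that $g(0)=0$, $g>0$ on $(0,\infty)$, and for each $M>0$ there is a constant $c_M>0$ with $\phi(u,v)\ge c_M$ for all $u,v\in[0,M]$. Set $\varphi:=kg$ if $\mu>0$ and $\varphi:=g$ if $\mu=0$, and assume that $\varphi$ is $C^1$ on $(0,\infty)$ and $\varphi'(t)>0$ for $t>0$. Fix $\varepsilon=0$ if $\mu>0$, and fix some $\varepsilon>0$ if $\mu=0$; set $\tilde k:=k-\varepsilon$ and assume that $\tilde k(0)\ge0$ and that $\tilde k/g$ is nonincreasing on $(0,\infty)$. Let $(u,v)$ be a nonnegative bounded strong solution of $$\left.\begin{aligned}u_t-\Delta u&=\phi(u,v)\,k(u)\,[g(v)-\mu g(u)]\\ v_t-\Delta v&=\phi(u,v)\,k(v)\,[g(u)-\mu g(v)]\end{aligned}\ \right\}\quad\text{in } X\times\mathbb{R},$$ satisfying, in the case $X=\mathbb{R}^n_+$, the homogeneous Dirichlet boundary conditions $u=v=0$ on $\partial\mathbb{R}^n_+\times\mathbb{R}$. Then $u\equiv v$.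
   Context: $\mathbb{R}^n_+:=\{x=(x_1,\dots,x_n)\in\mathbb{R}^n: x_n>0\}$. The couple $(u,v)$ is a strong solution if $(u,v)\in W^{2,1;r}_{loc}$ for all $r\in(1,\infty)$ (i.e. $u,v$, their weak space derivatives up to order two and their first weak time derivative belong to $L^r_{loc}(X\times\mathbb{R})$) and the equations are satisfied a.e.; moreover, when boundary conditions are imposed, a strong solution is assumed to be continuous up to the boundary. *)

(* Defs.v *)
From HB Require Import structures.
From mathcomp Require Import all_boot all_order all_algebra.
From mathcomp Require Import all_classical all_reals all_analysis.

Set Implicit Arguments.
Unset Strict Implicit.
Unset Printing Implicit Defensive.

Import Order.TTheory GRing.Theory Num.Theory.
Import numFieldNormedType.Exports.

Local Open Scope classical_set_scope.
Local Open Scope ring_scope.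

Section measurable_rV.
Context {R : realType} {n : nat}.

Let coord (i : 'I_n) (x : 'rV[R]_n) : R := x ord0 i.

Let rV_set0 : g_sigma_preimage coord set0.
Proof. exact: sigma_algebra0. Qed.

Let rV_setC A : g_sigma_preimage coord A -> g_sigma_preimage coord (~` A).
Proof. exact: sigma_algebraC. Qed.

Let rV_bigcup (F : (set _)^nat) : (forall i, g_sigma_preimage coord (F i)) ->
  g_sigma_preimage coord (\bigcup_i (F i)).
Proof. exact: sigma_algebra_bigcup. Qed.

(* The Borel sigma-algebra of R^n, generated by the coordinates. *)
HB.instance Definition _ := @isMeasurable.Build default_measure_display
  'rV[R]_n (g_sigma_preimage coord) rV_set0 rV_setC rV_bigcup.

Lemma measurable_rV_coord (i : 'I_n) :
  measurable_fun [set: 'rV[R]_n] (fun x => x ord0 i).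
Proof.
move=> _ Y mY; rewrite setTI; apply: sub_sigma_algebra => /=.
rewrite -bigcup_seq/=; exists i => /=; first by rewrite mem_index_enum.
by exists Y => //; rewrite setTI.
Qed.

Lemma measurable_fun_rV d (T : measurableType d) (f : T -> 'rV[R]_n) :
  (forall i, measurable_fun [set: T] (fun t => f t ord0 i)) ->
  measurable_fun [set: T] f.
Proof.
move=> mf; apply: (@measurability _ _ _ _ _ _ (\big[setU/set0]_(i < n)
  preimage_set_system setT (coord i) measurable)) => //.
move=> _ [B + <-]; rewrite -bigcup_seq => -[i _ /= [A mA <-]].
by rewrite [X in _ `&` (_ @^-1` X)]setTI; exact: mf.
Qed.

End measurable_rV.

Section lebesgue_rV.
Context {R : realType}.

Definition rVcons n (p : measurableTypeR R * 'rV[R]_n) : 'rV[R]_n.+1 :=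
  row_mx (const_mx p.1 : 'rV_1) p.2.

Lemma measurable_rVcons n :
  measurable_fun [set: measurableTypeR R * 'rV[R]_n] (@rVcons n).
Proof.
apply: measurable_fun_rV => i; rewrite /rVcons.
rewrite -[i](@fintype.splitK 1 n); case: (@fintype.split 1 n i) => j /=.
  under eq_fun do rewrite (@row_mxEl _ 1 1 n) mxE.
  exact: measurable_fst.
under eq_fun do rewrite (@row_mxEr _ 1 1 n).
exact: (measurableT_comp (measurable_rV_coord j) measurable_snd).
Qed.

Section rVcons_measure.
Context n (m : {sigma_finite_measure set 'rV[R]_n -> \bar R}).

Definition rVcons_measure : set 'rV[R]_n.+1 -> \bar R :=
  pushforward (lebesgue_measure \x m)%E (@rVcons n).

Let mu0 : rVcons_measure set0 = 0%E.
Proof. by rewrite /rVcons_measure /pushforward preimage_set0 measure0. Qed.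

Let mu_ge0 A : (0 <= rVcons_measure A)%E.
Proof. exact: (measure_ge0 (lebesgue_measure \x m)%E). Qed.

Let mu_sigma_additive : semi_sigma_additive rVcons_measure.
Proof.
move=> F mF tF mUF; rewrite /rVcons_measure /pushforward preimage_bigcup.
apply: measure_semi_sigma_additive.
- by move=> i; rewrite -[X in measurable X]setTI; exact: measurable_rVcons.
- apply/trivIsetP => /= i j _ _ ij; rewrite -preimage_setI.
  by move/trivIsetP : tF => /(_ _ _ _ _ ij) ->//; rewrite preimage_set0.
- by rewrite -preimage_bigcup -[X in measurable X]setTI;
    exact: measurable_rVcons.
Qed.

HB.instance Definition _ := isMeasure.Build _ _ _
  rVcons_measure mu0 mu_ge0 mu_sigma_additive.

Let rVuncons (x : 'rV[R]_n.+1) : measurableTypeR R * 'rV[R]_n :=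
  (x ord0 ord0, @rsubmx R 1 1 n x).

Let rVconsK : cancel (@rVcons n) rVuncons.
Proof.
move=> [a x]; rewrite /rVuncons /rVcons /=; congr pair; last first.
  exact: (@row_mxKr _ 1 1 n).
have -> : ord0 = @lshift 1 n ord0 by apply/val_inj.
by rewrite (@row_mxEl _ 1 1 n) mxE.
Qed.

Let measurable_rVuncons : measurable_fun [set: 'rV[R]_n.+1] rVuncons.
Proof.
apply: measurable_fun_pair; first exact: measurable_rV_coord.
apply: measurable_fun_rV => i; rewrite /rsubmx.
under eq_fun do rewrite mxE.
exact: measurable_rV_coord.
Qed.

Let mu_sigma_finite : sigma_finite setT rVcons_measure.
Proof.
have /sigma_finiteP[F1 [F1T F1nd F1oo]] := sigma_finiteT (@lebesgue_measure R).
have /sigma_finiteP[F2 [F2T F2nd F2oo]] := sigma_finiteT m.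
exists (fun i => rVuncons @^-1` (F1 i `*` F2 i)).
  rewrite -preimage_bigcup -[LHS](@preimage_setT _ _ rVuncons).
  congr (_ @^-1` _); apply/esym; rewrite -subTset => -[x y] _.
  have : setT x by []; rewrite F1T => -[i _ F1x].
  have : setT y by []; rewrite F2T => -[j _ F2y].
  exists (maxn i j) => //; split => /=.
    by move: x F1x; exact/subsetPset/F1nd/leq_maxl.
  by move: y F2y; exact/subsetPset/F2nd/leq_maxr.
move=> i; have [mF1 F1i] := F1oo i; have [mF2 F2i] := F2oo i; split.
  rewrite -[X in measurable X]setTI; apply: measurable_rVuncons => //.
  exact: measurableX.
rewrite /rVcons_measure /pushforward -comp_preimage.
rewrite (_ : rVuncons \o _ = id); last by apply/funext => p; exact: rVconsK.
by rewrite preimage_id product_measure1E// lte_mul_pinfty// ge0_fin_numE.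
Qed.

HB.instance Definition _ := Measure_isSigmaFinite.Build _ _ _
  rVcons_measure mu_sigma_finite.

End rVcons_measure.

(* n-dimensional Lebesgue measure; R^0 is a point, of measure 1. *)
Fixpoint lebesgue_rV n : {sigma_finite_measure set 'rV[R]_n -> \bar R} :=
  if n is n'.+1 then rVcons_measure (lebesgue_rV n') else \d_(0 : 'rV[R]_0).

End lebesgue_rV.

Section strong_solutions.
Context {R : realType} {n : nat}.

(* Points z = (x, t) of R^(n+1) x R: the space dimension is n+1 >= 1, so that
   the last space coordinate is x ord0 ord_max. *)
Local Notation spacetime := ('rV[R]_n.+1 * R)%type.

Definition half_space : set 'rV[R]_n.+1 := [set x | 0 < x ord0 ord_max].

Definition cylinder (X : set 'rV[R]_n.+1) : set spacetime := X `*` setT.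

Definition spacetime_measure :
    {measure set ('rV[R]_n.+1 * measurableTypeR R) -> \bar R} :=
  (lebesgue_rV n.+1 \x lebesgue_measure)%E.
Local Notation mu := spacetime_measure.

Definition dx (i : 'I_n.+1) : spacetime := (delta_mx ord0 i, 0).
Definition dt : spacetime := (0, 1).

Definition iter_derive (vs : seq spacetime) (f : spacetime -> R) :
    spacetime -> R :=
  foldr (fun v g z => 'D_v g z) f vs.

Definition smooth (f : spacetime -> R) :=
  forall vs z, differentiable (iter_derive vs f) z.

Definition test_function (Q : set spacetime) (psi : spacetime -> R) :=
  smooth psi /\
  exists K : set spacetime,
    [/\ compact K, K `<=` Q & forall z, ~ K z -> psi z = 0].

Definition Lloc (r : R) (Q : set spacetime) (f : spacetime -> R) :=
  measurable_fun Q f /\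
  forall K : set spacetime, compact K -> K `<=` Q ->
    mu.-integrable K (fun z => (`|f z| `^ r)%:E).

Definition weak_derivative (Q : set spacetime) (vs : seq spacetime)
    (f w : spacetime -> R) :=
  [/\ Lloc 1 Q f, Lloc 1 Q w &
    forall psi, test_function Q psi ->
      \int[mu]_(z in Q) (f z * iter_derive vs psi z) =
      (-1) ^+ size vs * \int[mu]_(z in Q) (w z * psi z)].

Definition W21loc (r : R) (Q : set spacetime) (f : spacetime -> R) :=
  [/\ Lloc r Q f,
      forall i, exists2 w, weak_derivative Q [:: dx i] f w & Lloc r Q w,
      forall i j,
        exists2 w, weak_derivative Q [:: dx i; dx j] f w & Lloc r Q w &
      exists2 w, weak_derivative Q [:: dt] f w & Lloc r Q w].

(* f_t - Delta f = F a.e. in Q. *)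
Definition heat_eq (Q : set spacetime) (f F : spacetime -> R) :=
  exists ft : spacetime -> R, exists fxx : 'I_n.+1 -> spacetime -> R,
    [/\ weak_derivative Q [:: dt] f ft,
        forall i, weak_derivative Q [:: dx i; dx i] f (fxx i) &
        {ae mu, forall z, Q z -> ft z - \sum_i fxx i z = F z}].

(* m is the coefficient called mu in the system. Since u and v are nonnegative,
   only the values of Phi on the closed quadrant and of k, g on [0, +oo[
   matter. *)
Definition strong_solution (X : set 'rV[R]_n.+1) (m : R) (Phi : R * R -> R)
    (k g : R -> R) (u v : spacetime -> R) :=
  [/\ forall r : R, 1 < r ->
        W21loc r (cylinder X) u /\ W21loc r (cylinder X) v,
      heat_eq (cylinder X) u (fun z =>
        Phi (u z, v z) * k (u z) * (g (v z) - m * g (u z))) &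
      heat_eq (cylinder X) v (fun z =>
        Phi (u z, v z) * k (v z) * (g (u z) - m * g (v z)))].

(* Sobolev functions are represented by arbitrary Borel functions, hence the
   almost everywhere quantifiers. *)
Definition nonneg_bounded (X : set 'rV[R]_n.+1) (f : spacetime -> R) :=
  {ae mu, forall z, cylinder X z -> 0 <= f z} /\
  exists M : R, {ae mu, forall z, cylinder X z -> `|f z| <= M}.

Definition dirichlet0 (X : set 'rV[R]_n.+1) (f : spacetime -> R) :=
  {within cylinder (closure X), continuous f} /\
  forall z, cylinder (closure X `\` interior X) z -> f z = 0.

End strong_solutions.

(* Main.v *)
(* The difference w = u - v solves w_t - Delta w = G, where G <= - d(s) < 0
   wherever w >= s > 0, and symmetrically where w <= - s. Let S be the essential
   supremum of |w| and suppose S > 0. Then f = S - w is nonnegative and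
   C f + f_t - Delta f >= d > 0 in the sense of distributions. For a nonnegative
   test function psi, the function z |-> integral of f psi(. - z) is smooth and
   satisfies the same inequality, so that a minimum principle on R^(n+2), with
   penalization |z|^2, bounds it below by c times the integral of psi. Hence
   f >= c almost everywhere; the same holds for S + w, and |w| <= S - c
   contradicts the choice of S.

   Tensor products of functions of one variable suffice as test functions,
   because they approximate the indicator functions of boxes. In the half-space
   the same argument is applied to the odd reflection of w in the last variable.
   Test functions that are odd in that variable are not compactly supported in
   the open half-space; they are reached by a cutoff, since w tends to 0 at the
   boundary, uniformly on compact sets. *)

Require Import Defs.
From mathcomp Require Import all_boot all_order all_algebra.
From mathcomp Require Import all_classical all_reals all_analysis.
From mathcomp Require Import measurable_realfun ring lra.
Import Order.TTheory GRing.Theory Num.Theory.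
Import numFieldNormedType.Exports.
Local Open Scope classical_set_scope.
Local Open Scope ring_scope.

Set Implicit Arguments.
Unset Strict Implicit.
Unset Printing Implicit Defensive.

(** The supremum of [|w|] need not be attained and [w] has only weak derivatives, so there is no
    maximum point at which to read off signs. Testing removes both obstacles, provided that the
    factor [c] does not depend on [psi]: only then does the bound survive when [psi] tends to the
    indicator of a box. This shapes the minimum principle. The penalty weight is [W z0] itself, up
    to an arbitrarily small excess, so near-minimizers stay at bounded distance from [z0], and there
    the terms of [C W + W_t - Delta W] are bounded by numbers times [W z0]: [C], then 4 from the
    time derivative of the penalty and 2 per coordinate from its second derivatives. Derivatives of
    [psi] enter only through Taylor remainders, which carry an extra power of the step [h] and
    disappear with it.

    The strict sign [d(s) > 0] comes from compactness: [varphi (t + s) - varphi t] has a positive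
    minimum over the bounded range of the solutions. The term [C f] is there because [G <= - d] is
    known only where [w >= s]; elsewhere, with [s = S / 2], [f] exceeds [S / 2] and [C f] absorbs
    the bound on [G]. *)

Definition upd (I : eqType) T (c : I -> T) j r := fun i => if i == j then r else c i.

Lemma upd_same (I : eqType) T (c : I -> T) j r : upd c j r j = r.
Proof. by rewrite /upd eqxx. Qed.

Lemma upd_other (I : eqType) T (c : I -> T) j r i : i != j -> upd c j r i = c i.
Proof. by rewrite /upd => /negbTE->. Qed.

Lemma upd_upd (I : eqType) T (c : I -> T) j r s : upd (upd c j r) j s = upd c j s.
Proof. by apply/funext => i; rewrite /upd; case: eqP. Qed.

Lemma upd_id (I : eqType) T (c : I -> T) j : upd c j (c j) = c.
Proof. by apply/funext => i; rewrite /upd; case: eqP => // ->. Qed.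

Lemma updC (I : eqType) T (c : I -> T) i j r s : i != j ->
  upd (upd c i r) j s = upd (upd c j s) i r.
Proof.
move=> ij; apply/funext => l; rewrite /upd.
by case: eqVneq => // ->; rewrite eq_sym (negbTE ij).
Qed.

(** * The discrete minimum principle *)

Lemma sum_sqr_upd (R : comPzRingType) (I : finType) (z z0 : I -> R) j s :
  \sum_i (upd z j s i - z0 i) ^+ 2 =
  \sum_i (z i - z0 i) ^+ 2 + (s - z0 j) ^+ 2 - (z j - z0 j) ^+ 2.
Proof.
rewrite (bigD1 j)//= upd_same [X in _ = X + _ - _](bigD1 j)//=.
rewrite (eq_bigr (fun i => (z i - z0 i) ^+ 2)); last first.
  by move=> i ij; rewrite upd_other.
by ring.
Qed.

(* A discrete minimum principle: the near-minimizers of W plus a small multiple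
   of the squared distance to z0 satisfy approximate first- and second-order
   conditions. Difference quotients are used instead of derivatives of W, so
   that no minimizer is needed. *)
Lemma penalized_min (R : realType) (I : finType) (o : I)
  (W Wt : (I -> R) -> R) (Ws : I -> (I -> R) -> R) (A C d : R) :
  0 <= A -> 0 <= C -> (forall z, 0 <= W z) ->
  (forall z h, 0 < h < 1 ->
    W (upd z o (z o - h ^+ 2)) - W z <= h ^+ 2 * Wt z + A * h ^+ 3) ->
  (forall i z h, i != o -> 0 < h < 1 ->
    W (upd z i (z i + h)) + W (upd z i (z i - h)) - 2 * W z <=
    h ^+ 2 * Ws i z + A * h ^+ 3) ->
  (forall z, d <= C * W z - Wt z - \sum_(i | i != o) Ws i z) ->
  forall z0, d <= (C + 4 + 2 * #|I|%:R) * W z0.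
Proof.
move=> A0 C0 W0 HWt HWs Hd z0.
(* The penalty weight must be positive although [W z0] may vanish; it is taken as [W z0] plus an
   excess that contributes [e] to the bound. *)
suff H eta : 0 < eta -> W z0 <= eta -> d <= (C + 4 + 2 * #|I|%:R) * eta.
  apply/ler_addgt0Pr => e e0.
  have K0 : 0 < C + 4 + 2 * #|I|%:R.
    by rewrite ltr_wpDr ?mulr_ge0 ?ler0n// ltr_wpDl.
  apply: (le_trans (H (W z0 + e / (C + 4 + 2 * #|I|%:R)) _ _)).
  - by rewrite ltr_wpDl// divr_gt0.
  - by rewrite lerDl ltW// divr_gt0.
  - by rewrite mulrDr mulrCA divff ?mulr1// gt_eqF.
move=> eta0 Weta.
pose P z := W z + eta * \sum_i (z i - z0 i) ^+ 2.
have P0 z : 0 <= P z.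
  by rewrite addr_ge0// mulr_ge0 ?(ltW eta0)// sumr_ge0// => i _; exact: sqr_ge0.
have Pz0 : P z0 = W z0.
  by rewrite /P big1 ?mulr0 ?addr0// => i _; rewrite subrr expr0n.
pose m := inf (range P).
have hi : has_inf (range P).
  by split; [exists (P z0); exists z0|exists 0 => _ [z _ <-]].
have mP z : m <= P z by apply: ge_inf; [exact: hi.2|exists z].
(* [B] collects everything that tends to 0 with [h]; the remainder constant [A] enters the bound
   only through it. *)
pose B := C + 1 + A + eta + #|I|%:R * (2 + A).
suff H h : 0 < h < 1 -> h <= eta -> d <= (C + 4 + 2 * #|I|%:R) * eta + h * B.
  apply/ler_addgt0Pr => e e0.
  have B0 : 0 < B.
    by rewrite ltr_wpDr ?mulr_ge0 ?ler0n ?addr_ge0// ltr_wpDl// !addr_ge0.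
  pose h := Num.min (Num.min (1/2) eta) (e / B).
  have h0 : 0 < h by rewrite !lt_min eta0 divr_gt0// !andbT divr_gt0.
  have h1 : h <= 1/2 by rewrite !ge_min lexx.
  have h2 : h <= eta by rewrite !ge_min lexx orbT.
  have h3 : h <= e / B by rewrite !ge_min lexx !orbT.
  apply: (le_trans (H h _ h2)); first by rewrite h0/=; lra.
  by rewrite lerD2l -ler_pdivlMr.
move=> /andP[h0 h1] heta.
have h20 : 0 < h ^+ 2 by rewrite exprn_gt0.
have h30 : 0 < h ^+ 3 by rewrite exprn_gt0.
have h3h : h ^+ 3 <= h by rewrite exprS ger_pMr// exprn_ile1// ltW.
(* A tolerance [h ^+ 3] leaves an error [h] after division by [h ^+ 2], the order of the time
   difference and of the second space differences. *)
have [_ [z1 _ <-] Pz1] := inf_adherent h30 hi.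
rewrite -/m in Pz1.
pose s := z1 o - z0 o.
have S0 : s ^+ 2 <= \sum_i (z1 i - z0 i) ^+ 2.
  by rewrite (bigD1 o)//= lerDl sumr_ge0// => i _; exact: sqr_ge0.
(* [P z0 <= eta] and the tolerance is at most [eta], so the near-minimizer lies within squared
   distance 2 of [z0], whatever [eta] is. *)
have Pz1e : P z1 <= 2 * eta by have := mP z0; rewrite Pz0; lra.
have s2 : s ^+ 2 <= 2.
  rewrite -(ler_pM2l eta0); apply: le_trans (_ : P z1 <= _); last by lra.
  by rewrite /P ler_wpDl// ler_pM2l.
have sb : -2 <= s by nra.
have Wz1 : W z1 <= eta + h ^+ 3.
  have : W z1 <= P z1.
    by rewrite lerDl mulr_ge0 ?(ltW eta0)// sumr_ge0// => i _; exact: sqr_ge0.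
  by have := mP z0; rewrite Pz0; lra.
(* Comparison with the point one time step earlier: the penalty changes by
   [eta * (h ^+ 4 - 2 * s * h ^+ 2)], and [-2 <= s] yields the [4 * eta]. *)
have HT : - h - A * h - 4 * eta - eta * h <= Wt z1.
  have := mP (upd z1 o (z1 o - h ^+ 2)); rewrite /P sum_sqr_upd.
  have := HWt z1 h; rewrite h0 h1 => /(_ isT).
  move: Pz1; rewrite /P -/s; set T := \sum_i _ => Pz1 E1 E2.
  have E3 : (z1 o - h ^+ 2 - z0 o) = s - h ^+ 2 by rewrite /s; ring.
  rewrite E3 in E2.
  rewrite -(ler_pM2l h20).
  have E4 : eta * h ^+ 2 * (-2) <= eta * h ^+ 2 * s.
    by rewrite ler_pM2l// mulr_gt0.
  have E5 : eta * h ^+ 4 <= eta * h ^+ 3.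
    by rewrite ler_pM2l// ler_wiXn2l// ltW.
  nra.
(* Adding the comparisons with both neighbours in direction [i] cancels the first-order part of the
   penalty and leaves [2 * eta * h ^+ 2]. *)
have HS i : i != o -> - (2 + A) * h - 2 * eta <= Ws i z1.
  move=> io.
  have := mP (upd z1 i (z1 i + h)); rewrite /P sum_sqr_upd.
  have := mP (upd z1 i (z1 i - h)); rewrite /P sum_sqr_upd.
  have := HWs i z1 h io; rewrite h0 h1 => /(_ isT).
  move: Pz1; rewrite /P; set T := \sum_i _ => Pz1 E1 E2 E3.
  rewrite -(ler_pM2l h20); nra.
have HSS : - #|I|%:R * ((2 + A) * h + 2 * eta) <= \sum_(i | i != o) Ws i z1.
  apply: (@le_trans _ _ (\sum_(i | i != o) (- ((2 + A) * h + 2 * eta)))).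
    rewrite sumr_const -[leRHS]mulr_natl mulNr -mulrN ler_wnM2r//.
      by rewrite oppr_le0 !addr_ge0// ?mulr_ge0 ?addr_ge0// ltW.
    by rewrite ler_nat max_card.
  by apply: ler_sum => i io; have := HS _ io; lra.
have := Hd z1.
have : C * W z1 <= C * eta + C * h.
  by rewrite -mulrDr ler_wpM2l//; lra.
rewrite /B; move: HT HSS; set N := #|I|%:R; set SS := \sum_(i | _) _; nra.
Qed.

(** * Smooth functions of one variable *)

Section smooth1.
Context {R : realType}.
Implicit Types f g : R -> R.

Lemma is_derive_affine (a b x : R) :
  is_derive x (1 : R) (fun y : R => a * y + b) a.
Proof.
have := is_deriveD (is_deriveZ a (is_derive_id x (1 : R))) (is_derive_cst b x 1).
by move/is_derive_eq; apply; rewrite addr0 /GRing.scale/= mulr1.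
Qed.

(** The derivative is carried as a witness with its own regularity, so that closure under products,
    inverses and affine substitutions is an induction on [k]. *)
Fixpoint differentiable_upto (k : nat) f : Prop :=
  if k is k'.+1 then
    exists2 df, forall x, is_derive x (1 : R) f (df x) & differentiable_upto k' df
  else True.

Definition smooth1 f := forall k, differentiable_upto k f.

Lemma differentiable_uptoS k f :
  differentiable_upto k.+1 f -> differentiable_upto k f.
Proof. by elim: k f => [//|k IH] f [df fdf /IH cdf]; exists df. Qed.

Lemma differentiable_upto_cst k (r : R) : differentiable_upto k (cst r).
Proof.
elim: k r => [//|k IH] r /=; exists (cst 0); last exact: IH.
by move=> x; exact: is_derive_cst.
Qed.

Lemma differentiable_uptoD k f g : differentiable_upto k f ->
  differentiable_upto k g -> differentiable_upto k (fun x => f x + g x).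
Proof.
elim: k f g => [//|k IH] f g [df fdf cf] [dg gdg cg].
exists (fun x => df x + dg x); last exact: IH.
by move=> x; exact: is_deriveD.
Qed.

Lemma differentiable_uptoM k f g : differentiable_upto k f ->
  differentiable_upto k g -> differentiable_upto k (fun x => f x * g x).
Proof.
elim: k f g => [//|k IH] f g cf cg.
have [[df fdf cdf] [dg gdg cdg]] := (cf, cg).
exists (fun x => f x * dg x + g x * df x).
  by move=> x; exact: (@is_deriveM R R).
by apply: differentiable_uptoD; apply: IH => //; exact: differentiable_uptoS.
Qed.

Lemma differentiable_upto_affine k f (a b : R) : differentiable_upto k f ->
  differentiable_upto k (fun x => f (a * x + b)).
Proof.
elim: k f => [//|k IH] f [df fdf cdf].
exists (fun x => a * df (a * x + b)); last first.
  by apply: differentiable_uptoM; [exact: differentiable_upto_cst|exact: IH].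
move=> x; have h := is_derive_affine a b x.
have := @is_derive1_comp R f _ x (df (a * x + b)) a (fdf _) h.
by move/is_derive_eq; apply; rewrite mulrC.
Qed.

Lemma differentiable_uptoV k f : (forall x, f x != 0) ->
  differentiable_upto k f -> differentiable_upto k (fun x => (f x)^-1).
Proof.
elim: k f => [//|k IH] f f0 cf.
have [df fdf cdf] := cf.
exists (fun x => - 1 * (((f x)^-1 * (f x)^-1) * df x)).
  move=> x; have := @is_deriveV R f x (df x) 1 (f0 x) (fdf x).
  move/is_derive_eq; apply.
  by rewrite /GRing.scale/= expr2 mulN1r mulNr invfM.
have cV : differentiable_upto k (fun x => (f x)^-1).
  by apply: IH => //; exact: differentiable_uptoS.
apply: differentiable_uptoM; first exact: differentiable_upto_cst.
by apply: differentiable_uptoM => //; exact: differentiable_uptoM.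
Qed.

Lemma smooth1_is_derive f x : smooth1 f -> is_derive x (1 : R) f (derive1 f x).
Proof. by move=> /(_ 1%N)[df fdf _]; rewrite derive1E; split => //; have [] := fdf x. Qed.

Lemma smooth1_derive1 f : smooth1 f -> smooth1 (derive1 f).
Proof.
move=> cf k; have [df fdf cdf] := cf k.+1.
suff -> : derive1 f = df by [].
by apply/funext => x; rewrite derive1E; have := fdf x => -[].
Qed.

Lemma smooth1_continuous f : smooth1 f -> continuous f.
Proof.
move=> /(_ 1%N)[df fdf _] x.
by apply/differentiable_continuous/derivable1_diffP; case: (fdf x).
Qed.

Lemma smooth1_cst (r : R) : smooth1 (cst r).
Proof. by move=> k; exact: differentiable_upto_cst. Qed.

Lemma smooth1D f g : smooth1 f -> smooth1 g -> smooth1 (fun x => f x + g x).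
Proof. by move=> cf cg k; exact: differentiable_uptoD. Qed.

Lemma smooth1M f g : smooth1 f -> smooth1 g -> smooth1 (fun x => f x * g x).
Proof. by move=> cf cg k; exact: differentiable_uptoM. Qed.

Lemma smooth1Z f (a : R) : smooth1 f -> smooth1 (fun x => a * f x).
Proof. by apply: smooth1M; exact: smooth1_cst. Qed.

Lemma smooth1_affine f (a b : R) : smooth1 f -> smooth1 (fun x => f (a * x + b)).
Proof. by move=> cf k; exact: differentiable_upto_affine. Qed.

Lemma smooth1V f : (forall x, f x != 0) -> smooth1 f -> smooth1 (fun x => (f x)^-1).
Proof. by move=> f0 cf k; exact: differentiable_uptoV. Qed.

Lemma is_derive_derive1 f df x : is_derive x (1 : R) f df -> derive1 f x = df.
Proof. by move=> h; rewrite derive1E; have [] := h. Qed.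

Lemma derive1_affine f (a b x : R) : smooth1 f ->
  derive1 (fun y => f (a * y + b)) x = a * derive1 f (a * x + b).
Proof.
move=> sf; have h := is_derive_affine a b x.
apply: is_derive_derive1.
have := @is_derive1_comp R f _ x _ a (smooth1_is_derive _ sf) h.
by move/is_derive_eq; apply; rewrite mulrC.
Qed.

Lemma derive1_smoothM f g x : smooth1 f -> smooth1 g ->
  derive1 (fun y => f y * g y) x = f x * derive1 g x + g x * derive1 f x.
Proof.
move=> sf sg; apply: is_derive_derive1.
exact: (is_deriveM (smooth1_is_derive x sf) (smooth1_is_derive x sg)).
Qed.

Lemma derive1_smoothB f g x : smooth1 f -> smooth1 g ->
  derive1 (fun y => f y - g y) x = derive1 f x - derive1 g x.
Proof.
move=> sf sg; apply: is_derive_derive1.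
exact: (is_deriveB (smooth1_is_derive x sf) (smooth1_is_derive x sg)).
Qed.

(* The derivative of flat k is flat (k + 2) - k flat (k + 1), so all are smooth. *)
Definition flat (k : nat) (x : R) : R :=
  if 0 < x then x ^- k * expR (- x^-1) else 0.

Lemma flat_ge0 k x : 0 <= flat k x.
Proof.
rewrite /flat; case: ifP => // x0.
by rewrite mulr_ge0 ?expR_ge0// invr_ge0 exprn_ge0// ltW.
Qed.

(** With [y = 1 / x], the exponential series gives [y ^ (k + 2) <= (k + 2)! e ^ y]. One of the two
    extra powers absorbs the division in the difference quotient at 0, the other makes that quotient
    tend to 0. *)
Lemma flat_bound k x : 0 < x -> x^-1 * flat k x <= (k.+2)`!%:R * x.
Proof.
move=> x0; rewrite /flat x0 expRN.
have y0 : 0 < x^-1 by rewrite invr_gt0.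
have F0 : 0 < (k.+2)`!%:R :> R by rewrite ltr0n fact_gt0.
have h : x^-1 ^+ k.+2 <= (k.+2)`!%:R * expR x^-1.
  rewrite mulrC -ler_pdivrMr//; apply: le_trans (expR_ge1Dxn k.+1 (ltW y0)).
  by rewrite lerDr.
rewrite mulrA -exprVn -exprS ler_pdivrMr ?expR_gt0//.
rewrite mulrAC -ler_pdivrMr// -exprSr.
exact: h.
Qed.

Lemma is_derive_flat k x :
  is_derive x (1 : R) (flat k) (flat k.+2 x - k%:R * flat k.+1 x).
Proof.
have [x0|x0|->] := ltgtP x 0.
- rewrite {2 3}/flat ltNge (ltW x0)/= mulr0 subr0.
  apply: near_eq_is_derive (is_derive_cst (0 : R) x (1 : R)).
  near=> y; rewrite /flat ltNge ltW//.
  by near: y; exact: lt_nbhsl.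
- rewrite {2 3}/flat x0.
  have d1 : is_derive x (1:R) (fun y : R => y^-1) (- x ^- 2).
    have := @is_deriveV R id x 1 1 (lt0r_neq0 x0) (is_derive_id _ _).
    by move/is_derive_eq; apply; rewrite /GRing.scale/= mulr1.
  have d2 : is_derive x (1:R) (fun y : R => expR (- y^-1)) (x ^- 2 * expR (- x^-1)).
    have dN := is_deriveN d1.
    have := @is_derive1_comp R expR _ x _ _ (is_derive_expR _) dN.
    by move/is_derive_eq; apply; rewrite opprK mulrC.
  have d3 : is_derive x (1:R) (fun y : R => y^-1 ^+ k) (- k%:R * x ^- k.+1).
    rewrite (_ : (fun y => _) = (fun y => y^-1) ^+ k); last first.
      by apply/funext => y; rewrite fctE.
    have := is_deriveX k d1.
    move/is_derive_eq; apply; rewrite /GRing.scale/= mulrN mulNr -mulrA; congr (- _).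
    case: k => [|k]; first by rewrite !mul0r.
    by rewrite /= exprVn -invfM -exprD addn2.
  have h := is_deriveM d3 d2.
  apply: (@near_eq_is_derive _ _ _ ((fun y : R => y^-1 ^+ k) * (fun y : R => expR (- y^-1)))).
    near=> y; have y0 : 0 < y by near: y; exact: lt_nbhsr.
    by rewrite /flat y0 -exprVn.
  move/is_derive_eq : h; apply; rewrite /GRing.scale/=.
  have x0' : x != 0 by rewrite gt_eqF.
  by rewrite exprVn !exprS; field; rewrite expf_neq0.
- have kK : 0 < (k.+2)`!%:R :> R by rewrite ltr0n fact_gt0.
  rewrite {2 3}/flat ltxx mulr0 subr0.
  have h : (fun h : R => h^-1 *: ((flat k \o shift 0) (h *: (1 : R)) - flat k 0))
      @ 0^' --> (0 : R).
    apply/cvgr0Pnorm_le => e e0; near=> h.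
    rewrite /= addr0 /GRing.scale/= mulr1 [flat k 0]/flat ltxx subr0.
    have [h0|h0] := ltP 0 h; last by rewrite /flat ltNge h0/= mulr0 normr0 ltW.
    rewrite ger0_norm; last by rewrite mulr_ge0 ?flat_ge0// invr_ge0 ltW.
    apply: (le_trans (flat_bound k h0)).
    rewrite mulrC -ler_pdivlMr// -[leLHS]ger0_norm ?ltW//.
    by near: h; apply: dnbhs0_lt; rewrite divr_gt0.
  by split; [exact: cvgP h|exact: cvg_lim h].
Unshelve. all: by end_near. Qed.

Lemma smooth1_flat k : smooth1 (flat k).
Proof.
move=> m; elim: m k => [//|m IH] k.
exists (fun x => flat k.+2 x - k%:R * flat k.+1 x); first exact: is_derive_flat.
rewrite (_ : (fun _ => _) = fun x => flat k.+2 x + (- k%:R) * flat k.+1 x).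
  apply: differentiable_uptoD => //.
  by apply: differentiable_uptoM => //; exact: differentiable_upto_cst.
by apply/funext => x; rewrite mulNr.
Qed.

(** The usual smooth transition from 0 to 1; the denominator is positive because [x] and [1 - x]
    cannot both be nonpositive. *)
Definition step (x : R) : R := flat 0 x / (flat 0 x + flat 0 (1 - x)).

Let flat_gt0 x : 0 < x -> 0 < flat 0 x.
Proof. by move=> x0; rewrite /flat x0 expr0 invr1 mul1r expR_gt0. Qed.

Let flat_le0 k x : x <= 0 -> flat k x = 0.
Proof. by move=> x0; rewrite /flat ltNge x0. Qed.

Let step_den x : 0 < flat 0 x + flat 0 (1 - x).
Proof.
have [x0|x0] := ltP 0 x; first by rewrite ltr_wpDr ?flat_ge0// flat_gt0.
by rewrite ltr_wpDl ?flat_ge0// flat_gt0//; lra.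
Qed.

Lemma step_ge0 x : 0 <= step x.
Proof. by rewrite /step divr_ge0 ?flat_ge0// ltW. Qed.

Lemma step_le1 x : step x <= 1.
Proof. by rewrite /step ler_pdivrMr// mul1r lerDl flat_ge0. Qed.

Lemma step_le0 x : x <= 0 -> step x = 0.
Proof. by move=> x0; rewrite /step flat_le0 ?mul0r. Qed.

Lemma step_ge1 x : 1 <= x -> step x = 1.
Proof.
move=> x1; rewrite /step (@flat_le0 _ (1 - x)) ?subr_le0// addr0 divff//.
by rewrite gt_eqF// flat_gt0//; lra.
Qed.

Lemma smooth1_step : smooth1 step.
Proof.
apply: smooth1M; first exact: smooth1_flat.
apply: smooth1V; first by move=> x; rewrite gt_eqF.
apply: smooth1D; first exact: smooth1_flat.
rewrite (_ : (fun _ => _) = fun x => flat 0 (-1 * x + 1)).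
  by apply: smooth1_affine; exact: smooth1_flat.
by apply/funext => x; rewrite mulN1r addrC.
Qed.

End smooth1.

(** * Taylor estimates and compactly supported functions *)

Section compactly_supported.
Context {R : realType}.
Implicit Types f : R -> R.

(** Two applications of the mean value theorem, without the sharp factor 1/2; negative [s] are
    reduced to positive ones by reflecting [f]. *)
Lemma smooth1_taylor1 f (B x s : R) : smooth1 f ->
  (forall y, `|derive1 (derive1 f) y| <= B) ->
  `|f (x + s) - f x - s * derive1 f x| <= B * s ^+ 2.
Proof.
have mvt g (a b : R) : smooth1 g -> a <= b ->
    exists2 c, a <= c <= b & g b - g a = derive1 g c * (b - a).
  move=> sg ab.
  have [||c cab ->] := @MVT_segment R g (derive1 g) a b ab.
  - by move=> y _; exact: smooth1_is_derive.
  - by apply: continuous_subspaceT => y; exact: smooth1_continuous.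
  - by exists c.
move=> sf fB; have sdf := smooth1_derive1 sf.
have B0 : 0 <= B by exact: le_trans (fB 0).
wlog s0 : f s x sf fB sdf / 0 <= s.
  move=> H; have [|s0] := leP 0 s; first exact: H.
  pose g y := f (-1 * y + 0).
  have sg : smooth1 g by exact: smooth1_affine.
  have dg y : derive1 g y = - derive1 f (- y).
    by rewrite derive1_affine// mulN1r addr0 mulN1r.
  have dgE : derive1 g = fun y => - 1 * derive1 f (-1 * y + 0).
    by apply/funext => y; rewrite dg addr0 !mulN1r.
  have gB y : `|derive1 (derive1 g) y| <= B.
    rewrite dgE derive1_smoothM//; last 2 first.
    - exact: smooth1_cst.
    - exact: smooth1_affine.
    by rewrite derive1_cst mulr0 addr0 derive1_affine// !mulN1r opprK.
  have := H g (- s) (- x) sg gB (smooth1_derive1 sg) _.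
  by rewrite dg /g !mulN1r !addr0 !opprD !opprK mulrNN sqrrN oppr_ge0 => -> //; exact: ltW.
have [|c cab E] := mvt f x (x + s) sf; first by rewrite lerDl.
have [xc cs] := andP cab.
have [d _ E'] := mvt _ _ _ sdf xc.
rewrite E (_ : x + s - x = s); last by ring.
rewrite [s * _]mulrC -mulrBl E' normrM normrM expr2 mulrA.
rewrite (ger0_norm s0) ler_wpM2r//.
rewrite ler_pM// ger0_norm ?subr_ge0//; lra.
Qed.

(** The mean value theorem is applied to [g y = f (x + y) + f (x - y) - y ^+ 2 * D2], whose
    derivative at [c] is the difference of the first-order remainders of [derive1 f] for the
    increments [c] and [- c]. *)
Lemma smooth1_taylor2 f (B x h : R) : smooth1 f ->
  (forall y, `|derive1 (derive1 (derive1 f)) y| <= B) -> 0 <= h ->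
  `|f (x + h) + f (x - h) - 2 * f x - h ^+ 2 * derive1 (derive1 f) x|
    <= 2 * B * h ^+ 3.
Proof.
move=> sf fB h0; have sdf := smooth1_derive1 sf.
pose D2 := derive1 (derive1 f) x.
pose g y := f (x + y) + f (x - y) - y ^+ 2 * D2.
pose dg y := derive1 f (x + y) - derive1 f (x - y) - 2 * y * D2.
have gdg y : is_derive y (1 : R) g (dg y).
  have d1 : is_derive y (1:R) (fun y => f (x + y)) (derive1 f (x + y)).
    have := smooth1_is_derive y (smooth1_affine 1 x sf).
    rewrite derive1_affine// !mul1r [y + x]addrC.
    rewrite [X in is_derive _ _ X _ -> _](_ : _ = fun y => f (x + y))//.
    by apply/funext => z; rewrite mul1r addrC.
  have d2 : is_derive y (1:R) (fun y => f (x - y)) (- derive1 f (x - y)).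
    have := smooth1_is_derive y (smooth1_affine (-1) x sf).
    rewrite derive1_affine// !mulN1r [- y + x]addrC.
    rewrite [X in is_derive _ _ X _ -> _](_ : _ = fun y => f (x - y))//.
    by apply/funext => z; rewrite mulN1r addrC.
  have d3 : is_derive y (1:R) (fun y : R => y ^+ 2 * D2) (2 * y * D2).
    have := is_deriveZ D2 (is_deriveM (is_derive_id y (1 : R)) (is_derive_id y (1 : R))).
    rewrite (_ : D2 \*: _ = fun y => y ^+ 2 * D2); last first.
      by apply/funext => z; exact: mulrC.
    by move/is_derive_eq; apply; rewrite /GRing.scale/=; ring.
  exact: (is_deriveB (is_deriveD d1 d2) d3).
have [|c /[!in_itv]/= /andP[c0 ch] E] := @MVT_segment R g dg 0 h h0 (fun y _ => gdg y).
  apply: continuous_subspaceT => y.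
  by apply/differentiable_continuous/derivable1_diffP; case: (gdg y).
have -> : f (x + h) + f (x - h) - 2 * f x - h ^+ 2 * D2 = g h - g 0.
  by rewrite /g subr0 addr0 expr0n/=; ring.
have B0 : 0 <= B by exact: le_trans (fB 0).
have H1 := smooth1_taylor1 x c sdf fB.
have H2 := smooth1_taylor1 x (- c) sdf fB.
rewrite E subr0 normrM (ger0_norm h0) exprSr mulrA ler_wpM2r//.
have -> : dg c = (derive1 f (x + c) - derive1 f x - c * D2) -
   (derive1 f (x - c) - derive1 f x - (- c) * D2) by rewrite /dg; ring.
apply: le_trans (ler_normB _ _) _.
apply: (@le_trans _ _ (B * c ^+ 2 + B * (- c) ^+ 2)); first exact: lerD.
rewrite sqrrN -mulrDl; apply: (@le_trans _ _ ((B + B) * h ^+ 2)); last by lra.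
by rewrite ler_wpM2l ?addr_ge0// ler_pXn2r.
Qed.

Definition ccont f := continuous f /\ exists L, forall x, L < `|x| -> f x = 0.

Definition ccsmooth f := smooth1 f /\ exists L, forall x, L < `|x| -> f x = 0.

Lemma ccsmooth_ccont f : ccsmooth f -> ccont f.
Proof. by move=> [sf fL]; split => // x; exact: smooth1_continuous. Qed.

Lemma ccsmooth_derive1 f : ccsmooth f -> ccsmooth (derive1 f).
Proof.
move=> [sf [L fL]]; split; first exact: smooth1_derive1.
exists L => x Lx; apply: is_derive_derive1.
apply: near_eq_is_derive (is_derive_cst (0 : R) x (1 : R)).
near=> y; apply/esym/fL; near: y.
have : open [set y : R | L < `|y|].
  apply: (@open_comp _ _ (fun y : R => `|y|) [set t | L < t]).
    by move=> y _; exact: norm_continuous.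
  exact: open_gt.
by rewrite openE; exact.
Unshelve. all: by end_near. Qed.

Lemma ccont_bounded f : ccont f -> exists2 B, 0 <= B & forall x, `|f x| <= B.
Proof.
move=> [cf [L fL]].
have [||c _ cP] := @EVT_max R (fun y => `|f y|) (- `|L|) `|L|.
- by rewrite (le_trans (_ : _ <= 0))// oppr_le0.
- apply: continuous_subspaceT => y.
  by apply: continuous_comp; [exact: cf|exact: norm_continuous].
exists `|f c| => // x; have [xL|xL] := leP `|x| `|L|.
  by apply: cP; rewrite in_itv/= -ler_norml.
by rewrite (fL x) ?normr0// (le_lt_trans _ xL)// ler_norm.
Qed.

End compactly_supported.

(** * Integrals of tensor products *)

Section product_integral.
Context {d1 d2} {T1 : measurableType d1} {T2 : measurableType d2} {R : realType}.
Variables (m1 : {sigma_finite_measure set T1 -> \bar R})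
  (m2 : {sigma_finite_measure set T2 -> \bar R}).
Variables (f : T1 -> R) (g : T2 -> R).
Hypotheses (fi : m1.-integrable setT (EFin \o f))
  (gi : m2.-integrable setT (EFin \o g)).

Lemma integrable_prod :
  (m1 \x m2)%E.-integrable setT (EFin \o (fun z => f z.1 * g z.2)).
Proof.
have mf : measurable_fun setT f by apply/measurable_EFinP/measurable_int/fi.
have mg : measurable_fun setT g by apply/measurable_EFinP/measurable_int/gi.
apply/integrable12ltyP.
  apply/measurable_EFinP; apply: measurable_funM.
    exact: (measurableT_comp mf measurable_fst).
  exact: (measurableT_comp mg measurable_snd).
have /integrableP[_ fi'] := fi; have /integrableP[_ gi'] := gi.
rewrite (eq_integral (fun x => `|(f x)%:E| * \int[m2]_y `|(g y)%:E|)%E).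
  rewrite ge0_integralZr//.
  - rewrite lte_mul_pinfty//; first exact: integral_ge0.
    by rewrite ge0_fin_numE//; exact: integral_ge0.
  - by apply: measurableT_comp => //; exact/measurable_EFinP.
  - exact: integral_ge0.
move=> x _; rewrite -ge0_integralZl//.
- by apply: eq_integral => y _; rewrite /= normrM EFinM.
- by apply: measurableT_comp => //; exact/measurable_EFinP.
Qed.

Lemma Rintegral_prod :
  \int[(m1 \x m2)%E]_z (f z.1 * g z.2) = \int[m1]_x f x * \int[m2]_y g y.
Proof.
rewrite /Rintegral.
transitivity (fine (\int[m1]_x ((f x)%:E * \int[m2]_y (g y)%:E))%E).
  congr fine; rewrite -(integral12_prod_meas1 integrable_prod).
  apply: eq_integral => x _; rewrite /fubini_F /= -integralZl//.
have -> : (\int[m2]_y (g y)%:E)%E = (fine (\int[m2]_y (g y)%:E))%:E.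
  by rewrite fineK//; exact: integrable_fin_num gi.
rewrite integralZr// fineM//.
exact: integrable_fin_num fi.
Qed.

End product_integral.

Section tensor.
Context {R : realType}.
Local Notation leb := (@lebesgue_measure R).

Lemma measurable_tensor_rV n (c : 'I_n -> R -> R) :
  (forall i, measurable_fun setT (c i)) ->
  measurable_fun [set: 'rV[R]_n] (fun x => \prod_i c i (x ord0 i)).
Proof.
move=> mc; rewrite (_ : (fun _ => _) = fun x : 'rV[R]_n =>
  \prod_(i <- index_enum 'I_n) c i (x ord0 i))//.
elim: (index_enum _) => [|i s IH].
  by under eq_fun do rewrite big_nil; exact: measurable_cst.
under eq_fun do rewrite big_cons; apply: measurable_funM => //.
exact: (measurableT_comp (mc i) (measurable_rV_coord i)).
Qed.

Lemma rVcons0 n (p : measurableTypeR R * 'rV[R]_n) : rVcons p ord0 ord0 = p.1.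
Proof.
rewrite /rVcons (_ : ord0 = @lshift 1 n ord0); last exact: val_inj.
by rewrite (@row_mxEl _ 1 1 n) mxE.
Qed.

Lemma rVconsS n (p : measurableTypeR R * 'rV[R]_n) i :
  rVcons p ord0 (lift ord0 i) = p.2 ord0 i.
Proof.
rewrite /rVcons (_ : lift ord0 i = @rshift 1 n i); last exact: val_inj.
by rewrite (@row_mxEr _ 1 1 n).
Qed.

Lemma tensor_rV n (c : 'I_n -> R -> R) :
  (forall i, leb.-integrable setT (EFin \o c i)) ->
  (lebesgue_rV n).-integrable setT (EFin \o (fun x : 'rV[R]_n => \prod_i c i (x ord0 i))) /\
  \int[lebesgue_rV n]_x (\prod_i c i (x ord0 i)) = \prod_i \int[leb]_t c i t.
Proof.
have mi (f : R -> R) : leb.-integrable setT (EFin \o f) -> measurable_fun setT f.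
  by move=> fi; apply/measurable_EFinP; exact: measurable_int fi.
elim: n c => [|n IH] c ci.
  have -> : (fun x : 'rV[R]_0 => \prod_i c i (x ord0 i)) = cst 1.
    by apply/funext => x; rewrite big_ord0.
  rewrite big_ord0; split.
    apply/integrableP; split; first exact/measurable_EFinP.
    by rewrite /= integral_dirac// diracT mul1e normr1 ltry.
  by rewrite /Rintegral /= integral_dirac// diracT mul1e.
have [I1 I2] := IH (fun i => c (lift ord0 i)) (fun i => ci _).
have mc i := mi _ (ci i).
have E : (fun x : 'rV[R]_n.+1 => \prod_i c i (x ord0 i)) \o (@rVcons R n) =
  fun z => c ord0 z.1 * \prod_i c (lift ord0 i) (z.2 ord0 i).
  apply/funext => z /=; rewrite big_ord_recl rVcons0; congr (_ * _).
  by apply: eq_bigr => i _; rewrite rVconsS.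
have mE : measurable_fun [set: 'rV[R]_n.+1]
    (EFin \o (fun x : 'rV[R]_n.+1 => \prod_i c i (x ord0 i))).
  by apply/measurable_EFinP; exact: measurable_tensor_rV.
have I3 := integrable_prod (ci ord0) I1.
have I4 : (leb \x lebesgue_rV n)%E.-integrable (@rVcons R n @^-1` setT)
    ((EFin \o (fun x : 'rV[R]_n.+1 => \prod_i c i (x ord0 i))) \o @rVcons R n).
  by rewrite preimage_setT -compA E.
split.
  exact: (integrable_pushforward (@measurable_rVcons R n) mE I4).
rewrite big_ord_recl -I2 -(Rintegral_prod (ci ord0) I1) /Rintegral.
congr fine; rewrite [LHS](integral_pushforward (@measurable_rVcons R n) mE I4)//.
by rewrite preimage_setT -compA E.
Qed.

End tensor.

(** * Integration on the line: derivatives, translations, reflections *)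

Section line_integrals.
Context {R : realType}.
Local Notation leb := (@lebesgue_measure R).
Implicit Types f : R -> R.

Lemma integrable_supp f (B a b : R) : measurable_fun setT f -> a <= b -> 0 <= B ->
  (forall x, `|f x| <= B) -> (forall x, ~ (a <= x <= b) -> f x = 0) ->
  leb.-integrable setT (EFin \o f) /\ \int[leb]_x `|f x| <= B * (b - a).
Proof.
move=> mf ab B0 fB f0.
have i1 : leb.-integrable setT (EFin \o (\1_`[a, b] : R -> R)).
  by apply: integrable_indic_itv.
have i2 : leb.-integrable setT (EFin \o (fun x => B * (\1_`[a, b] : R -> R) x)).
  rewrite (_ : _ \o _ = (fun x => B%:E * (EFin \o (\1_`[a, b] : R -> R)) x)%E) //.
  exact: integrableZl.
have fle x : `|f x| <= B * (\1_`[a, b] : R -> R) x.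
  rewrite indicE; case: (boolP (x \in _)) => [_|/negP xab]; first by rewrite mulr1.
  rewrite f0 ?normr0 ?mulr0// => xab'; apply: xab.
  by rewrite inE /= in_itv.
have fi : leb.-integrable setT (EFin \o f).
  apply: (le_integrable _ _ _ i2) => //; first exact/measurable_EFinP.
  by move=> x _ /=; rewrite lee_fin (le_trans (fle x))// ler_norm.
split=> //.
apply: (@le_trans _ _ (\int[leb]_x (B * (\1_`[a, b] : R -> R) x))).
  apply: le_Rintegral => //; exact: (integrable_norm fi).
rewrite RintegralZl// ler_wpM2l// /Rintegral integral_indic//= setIT.
rewrite lebesgue_measure_itv/= lte_fin; case: ifP => //= _.
by rewrite subr_ge0.
Qed.

Lemma Rintegral_supp d (T : measurableType d) (m : {measure set T -> \bar R})
    (f : T -> R) (A : set T) :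
  (forall x, ~ A x -> f x = 0) -> \int[m]_x f x = \int[m]_(x in A) f x.
Proof.
move=> fA; rewrite [RHS]Rintegral_mkcond; apply: eq_Rintegral => x _.
by rewrite patchE; case: ifPn => // /negP xA; rewrite fA// => /mem_set.
Qed.

Lemma Rintegral_line_supp f (A : set R) :
  (forall x, ~ A x -> f x = 0) -> \int[leb]_x f x = \int[leb]_(x in A) f x.
Proof. exact: (@Rintegral_supp _ (measurableTypeR R) leb). Qed.

Lemma ccont_supp f : ccont f ->
  exists2 L, 0 < L & forall x, ~ (- L <= x <= L) -> f x = 0.
Proof.
move=> [_ [L fL]]; exists (`|L| + 1); first by rewrite ltr_wpDl.
move=> x /negP xL; apply: fL; rewrite ltNge; apply: contra xL => xL.
by rewrite -ler_norml (le_trans xL)// (le_trans (ler_norm _))// lerDl.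
Qed.

Lemma ccont_measurable f : ccont f -> measurable_fun setT f.
Proof. by move=> [cf _]; exact: continuous_measurable_fun. Qed.

Lemma ccont_integrable f : ccont f -> leb.-integrable setT (EFin \o f).
Proof.
move=> cf; have [L L0 fL] := ccont_supp cf.
have [B B0 fB] := ccont_bounded cf.
have LL : - L <= L by rewrite (le_trans (_ : _ <= 0)) ?oppr_le0 ?ltW.
by have [] := integrable_supp (ccont_measurable cf) LL B0 fB fL.
Qed.

Lemma smooth1_within f (A : set R) : smooth1 f -> {within A, continuous f}.
Proof. by move=> sf; apply: continuous_subspaceT => x; exact: smooth1_continuous. Qed.

Lemma smooth1_LR f a b : smooth1 f -> derivable_oo_LRcontinuous f a b.
Proof.
move=> sf; split.
- by move=> x _; have [] := smooth1_is_derive x sf.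
- by apply: cvg_at_right_filter; exact: smooth1_continuous.
- by apply: cvg_at_left_filter; exact: smooth1_continuous.
Qed.

Lemma ccsmooth_Rintegral_derive1 f : ccsmooth f -> \int[leb]_x derive1 f x = 0.
Proof.
move=> cf; have sf : smooth1 f by case: cf.
have [L L0 fL] := ccont_supp (ccsmooth_ccont (ccsmooth_derive1 cf)).
have [L' L'0 fL'] := ccont_supp (ccsmooth_ccont cf).
(* Beyond [K] both [f] and its derivative vanish, so the endpoint values of [f] are 0. *)
pose K := L + L'.
have K0 : - K < K by rewrite /K; lra.
rewrite (@Rintegral_line_supp _ `[- K, K]); last first.
  move=> x xK; apply: fL => xL; apply: xK; rewrite /= in_itv/=.
  by move: xL; rewrite /K; lra.
rewrite /Rintegral (continuous_FTC2 (F := f) K0).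
- by rewrite /= !fL' ?subrr//; rewrite /K; lra.
- by apply: smooth1_within; exact: smooth1_derive1.
- exact: smooth1_LR.
- by [].
Qed.

Lemma ccsmooth_Rintegral_shift f s : ccsmooth f ->
  \int[leb]_x f (x - s) = \int[leb]_x f x.
Proof.
move=> cf; have sf : smooth1 f by case: cf.
have [L L0 fL] := ccont_supp (ccsmooth_ccont cf).
rewrite [RHS](@Rintegral_line_supp _ `[- L, L]); last first.
  by move=> x xL; apply: fL => xL'; apply: xL; rewrite /= in_itv.
rewrite (@Rintegral_line_supp _ `[- L + s, L + s]); last first.
  by move=> x xL; apply: fL => xL'; apply: xL; rewrite /= in_itv/=; move: xL'; lra.
have sF : smooth1 (fun x : R => 1 * x + (- s)).
  move=> [//|k]; exists (cst 1); last exact: differentiable_upto_cst.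
  by move=> x; exact: is_derive_affine.
have dF : derive1 (fun x : R => 1 * x + (- s)) = cst 1.
  by apply/funext => x; apply: is_derive_derive1; exact: is_derive_affine.
rewrite /Rintegral; congr fine; apply/esym.
have := @integration_by_substitution_increasing R (fun x => 1 * x + (- s)) f (- L + s) (L + s).
rewrite !mul1r !addrK; move=> ->.
- apply: eq_integral => x _; rewrite dF; congr (EFin _).
  by change (f (1 * (x : R) - s) * 1 = f ((x : R) - s)); rewrite mulr1 mul1r.
- by lra.
- by move=> x y _ _; rewrite !mul1r ltrD2r.
- by rewrite dF => x _; exact: cvg_cst.
- by rewrite dF; exact: is_cvg_cst.
- by rewrite dF; exact: is_cvg_cst.
- exact: smooth1_LR.
- exact: smooth1_within.
Qed.

Lemma ccontN f : ccont f -> ccont (fun x => f (- x)).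
Proof.
move=> [cf [K fK]]; split.
  by move=> x; apply: continuous_comp; [exact: opp_continuous|exact: cf].
by exists K => x Kx; rewrite fK// normrN.
Qed.

Lemma ccont_norm f : ccont f -> ccont (fun x => `|f x|).
Proof.
move=> [cf [K fK]]; split.
  by move=> x; apply: continuous_comp; [exact: cf|exact: norm_continuous].
by exists K => x Kx; rewrite fK// normr0.
Qed.

(** The substitution of [- x] turns the second integral into the one over the negative half-line.
    This is what allows an integral over the half-space to stand for one over the whole space. *)
Lemma ccont_Rintegral_half f : ccont f ->
  \int[leb]_x (if 0 < x then f x else 0) + \int[leb]_x (if 0 < x then f (- x) else 0)
  = \int[leb]_x f x.
Proof.
move=> cf; have sf : continuous f by case: cf.
have [L L0 fL] := ccont_supp cf.
have fi := ccont_integrable cf.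
have fi' : leb.-integrable setT (EFin \o (fun x => f (- x))).
  by apply: ccont_integrable; exact: ccontN.
have mpos (g : R -> R) : measurable_fun setT g ->
    measurable_fun setT (fun x : R => if 0 < x then g x else 0).
  move=> mg; apply: measurable_fun_ifT => //.
  exact: measurable_fun_ltr.
have ipos (g h : R -> R) : leb.-integrable setT (EFin \o g) -> measurable_fun setT h ->
    (forall x, `|h x| <= `|g x|) -> leb.-integrable setT (EFin \o h).
  move=> gi mh hg; apply: (le_integrable _ _ _ gi) => //; first exact/measurable_EFinP.
  by move=> x _ /=; rewrite lee_fin.
have mf := ccont_measurable cf.
have mneg : measurable_fun setT (fun x : R => if 0 < x then 0 else f x).
  by apply: measurable_fun_ifT => //; exact: measurable_fun_ltr.
have -> : \int[leb]_x (if 0 < x then f (- x) else 0) =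
    \int[leb]_x (if 0 < x then 0 else f x).
  rewrite (@Rintegral_line_supp _ `]0, L]); last first.
    move=> x /= xL; case: ifP => // x0; apply: fL => xL'; apply: xL.
    by rewrite in_itv/=; lra.
  transitivity (\int[leb]_(x in `]0, L]) f (- x)).
    by apply: eq_Rintegral => x; rewrite inE/= in_itv/= => /andP[->].
  rewrite Rintegral_itv_obnd_cbnd; last exact: integrableS fi'.
  rewrite [RHS](@Rintegral_line_supp _ `[- L, 0]); last first.
    move=> x /= xL; case: ifPn => // x0; apply: fL => xL'; apply: xL.
    by rewrite in_itv/=; lra.
  transitivity (\int[leb]_(x in `[- L, 0]) f x).
    rewrite /Rintegral; congr fine.
    have := @integration_by_substitution_oppr R f 0 L (ltW L0).
    by rewrite oppr0 => <- //; exact: continuous_subspaceT.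
  by apply: eq_Rintegral => x; rewrite inE/= in_itv/= => /andP[_]; rewrite leNgt => /negbTE->.
rewrite -RintegralD//.
- by apply: eq_Rintegral => x _; case: ifP; rewrite ?addr0 ?add0r.
- by apply: (ipos _ _ fi) => [|x]; [exact: mpos|case: ifP => //; rewrite normr0].
- by apply: (ipos _ _ fi) => // x; case: ifP => //; rewrite normr0.
Qed.

Lemma ccont_RintegralN f : ccont f ->
  \int[leb]_x f (- x) = \int[leb]_x f x.
Proof.
move=> cf; rewrite -(ccont_Rintegral_half cf) -(ccont_Rintegral_half (ccontN cf)).
rewrite addrC; congr (_ + _); apply: eq_Rintegral => x _.
by rewrite opprK.
Qed.

End line_integrals.

(** * The minimum principle for functionals of tensor products *)

Section functional.
Context {R : realType} {I : finType}.
Local Notation leb := (@lebesgue_measure R).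
Implicit Types c : I -> R -> R.

Definition admissible c := forall j, ccsmooth (c j).

Definition nonneg_factors c := forall j x, 0 <= c j x.

Definition translate (z : I -> R) c : I -> R -> R := fun j x => c j (x - z j).

Lemma ccsmooth_shift f (s : R) : ccsmooth f -> ccsmooth (fun x => f (x - s)).
Proof.
move=> [sf [L fL]]; split.
  rewrite (_ : (fun _ => _) = fun x => f (1 * x - s)); first exact: smooth1_affine.
  by apply/funext => x; rewrite mul1r.
exists (L + `|s|) => x Lx; apply: fL.
by have := ler_normB x s; have := lerB_normD x (- s); rewrite normrN; lra.
Qed.

Lemma ccsmoothD (f g : R -> R) : ccsmooth f -> ccsmooth g ->
  ccsmooth (fun x => f x + g x).
Proof.
move=> [sf [L fL]] [sg [K gK]]; split; first exact: smooth1D.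
exists (Num.max L K) => x; rewrite gt_max => /andP[/fL -> /gK ->].
by rewrite addr0.
Qed.

Lemma ccsmoothM (f g : R -> R) : ccsmooth f -> smooth1 g ->
  ccsmooth (fun x => f x * g x).
Proof.
move=> [sf [L fL]] sg; split; first exact: smooth1M.
by exists L => x /fL ->; rewrite mul0r.
Qed.

Lemma ccsmoothZ (f : R -> R) a : ccsmooth f -> ccsmooth (fun x => a * f x).
Proof.
move=> [sf [L fL]]; split; first exact: smooth1Z.
by exists L => x /fL ->; rewrite mulr0.
Qed.

Lemma ccsmoothN (f : R -> R) : ccsmooth f -> ccsmooth (fun x => f (- x)).
Proof.
move=> [sf [L fL]]; split.
  rewrite (_ : (fun _ => _) = fun x => f (-1 * x + 0)); first exact: smooth1_affine.
  by apply/funext => x; rewrite mulN1r addr0.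
by exists L => x xL; rewrite fL// normrN.
Qed.

Lemma ccsmoothB (f g : R -> R) : ccsmooth f -> ccsmooth g ->
  ccsmooth (fun x => f x - g x).
Proof.
move=> cf cg; rewrite (_ : (fun _ => _) = fun x => f x + -1 * g x).
  by apply: ccsmoothD => //; exact: ccsmoothZ.
by apply/funext => x; rewrite mulN1r.
Qed.

Lemma admissible_upd c j f : admissible c -> ccsmooth f -> admissible (upd c j f).
Proof. by move=> ca cf i; rewrite /upd; case: eqP. Qed.

Lemma admissible_translate z c : admissible c -> admissible (translate z c).
Proof. by move=> ca j; exact: ccsmooth_shift. Qed.

Lemma derive1_shift (f : R -> R) s : smooth1 f ->
  derive1 (fun x => f (x - s)) = fun x => derive1 f (x - s).
Proof.
move=> sf; rewrite (_ : (fun x => f (x - s)) = fun x => f (1 * x - s)); last first.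
  by apply/funext => x; rewrite mul1r.
by apply/funext => x; rewrite derive1_affine// !mul1r.
Qed.

Variables (o : I) (Lam : (I -> R -> R) -> R) (M C d : R).
Hypotheses (M0 : 0 <= M) (C0 : 0 <= C).
Hypothesis Lam_linear : forall c j f g a b, admissible c -> ccsmooth f -> ccsmooth g ->
  Lam (upd c j (fun x => a * f x + b * g x)) = a * Lam (upd c j f) + b * Lam (upd c j g).
Hypothesis Lam_bounded : forall c, admissible c ->
  `|Lam c| <= M * \prod_j \int[leb]_x `|c j x|.
Hypothesis Lam_ge0 : forall c, admissible c -> nonneg_factors c -> 0 <= Lam c.
(** With [Lam c] read as a distribution [f] tested against the product of the [c j], this is
    [C f + f_t - Delta f >= d]: moving one derivative to the test function costs a sign, moving two
    does not. *)
Hypothesis Lam_ineq : forall c, admissible c -> nonneg_factors c ->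
  d * \prod_j \int[leb]_x c j x <=
  C * Lam c - Lam (upd c o (derive1 (c o))) -
    \sum_(i | i != o) Lam (upd c i (derive1 (derive1 (c i)))).

(** Only the factor [j] is replaced by a Taylor remainder; the other factors contribute their
    integrals, which translation leaves unchanged, so the estimate will be uniform in [z]. *)
Let Lam_remainder c j f r (B a b : R) : admissible c -> nonneg_factors c ->
  ccsmooth r -> a <= b -> 0 <= B -> (forall x, `|r x| <= B) ->
  (forall x, ~ (a <= x <= b) -> r x = 0) -> f = Lam (upd c j r) ->
  f <= M * (\prod_(i | i != j) \int[leb]_x c i x) * (B * (b - a)).
Proof.
move=> ca cp cr ab B0 rB r0 ->; apply: le_trans (ler_norm _) _.
apply: le_trans (Lam_bounded _) _; first exact: admissible_upd.
rewrite (bigD1 j)//= upd_same -mulrA ler_wpM2l// mulrC.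
have -> : \prod_(i | i != j) \int[leb]_x `|upd c j r i x| =
    \prod_(i | i != j) \int[leb]_x c i x.
  apply: eq_bigr => i ij; rewrite upd_other//.
  by apply: eq_Rintegral => x _; rewrite ger0_norm.
rewrite ler_wpM2l//.
  by apply: prodr_ge0 => i _; apply: Rintegral_ge0 => x _; exact: cp.
by have [_] := integrable_supp (ccont_measurable (ccsmooth_ccont cr)) ab B0 rB r0.
Qed.

(* Apply the minimum principle to W z := Lam (translate z c): difference
   quotients of W in z are, up to a Taylor remainder, values of Lam at the
   derivatives of the translated factors. *)
Theorem functional_lower_bound c : admissible c -> nonneg_factors c ->
  d * \prod_j \int[leb]_x c j x <= (C + 4 + 2 * #|I|%:R) * Lam c.
Proof.
move=> ca cp.
have tr z : admissible (translate z c) by exact: admissible_translate.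
have trp z : nonneg_factors (translate z c) by move=> j x; exact: cp.
have V z : \prod_j \int[leb]_x translate z c j x = \prod_j \int[leb]_x c j x.
  by apply: eq_bigr => j _; exact: ccsmooth_Rintegral_shift.
have V' z j : \prod_(i | i != j) \int[leb]_x translate z c i x =
    \prod_(i | i != j) \int[leb]_x c i x.
  by apply: eq_bigr => i _; exact: ccsmooth_Rintegral_shift.
have cd j : ccsmooth (derive1 (c j)) by exact: ccsmooth_derive1.
have cdd j : ccsmooth (derive1 (derive1 (c j))) by exact: ccsmooth_derive1.
have cddd j : ccsmooth (derive1 (derive1 (derive1 (c j)))) by exact: ccsmooth_derive1.
have sm j : smooth1 (c j) by case: (ca j).
have smd j : smooth1 (derive1 (c j)) by case: (cd j).
have /boolp.choice[L LP] : forall j, exists L : R, 0 < L /\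
    forall x, ~ (- L <= x <= L) -> [/\ c j x = 0, derive1 (c j) x = 0 &
      derive1 (derive1 (c j)) x = 0].
  move=> j.
  have [L1 L10 H1] := ccont_supp (ccsmooth_ccont (ca j)).
  have [L2 L20 H2] := ccont_supp (ccsmooth_ccont (cd j)).
  have [L3 L30 H3] := ccont_supp (ccsmooth_ccont (cdd j)).
  exists (L1 + L2 + L3); split; first by rewrite !addr_gt0.
  by move=> x Hx; rewrite H1 ?H2 ?H3//; lra.
have /boolp.choice[B BP] : forall j, exists B : R, [/\ 0 <= B,
    forall x, `|derive1 (derive1 (c j)) x| <= B &
    forall x, `|derive1 (derive1 (derive1 (c j))) x| <= B].
  move=> j.
  have [B1 B10 H1] := ccont_bounded (ccsmooth_ccont (cdd j)).
  have [B2 B20 H2] := ccont_bounded (ccsmooth_ccont (cddd j)).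
  exists (B1 + B2); split; first by rewrite addr_ge0.
    by move=> x; apply: le_trans (H1 x) _; rewrite lerDl.
  by move=> x; apply: le_trans (H2 x) _; rewrite lerDr.
(* [2 * B j] bounds the Taylor remainders up to powers of [h], and [2 * (L j + 1)] is the length of
   their support: the 1 allows for a shift by less than 1. *)
pose A j := M * (\prod_(i | i != j) \int[leb]_x c i x) * (2 * B j * (2 * (L j + 1))).
have A0 j : 0 <= A j.
  have [B0 _ _] := BP j; have [L0 _] := LP j.
  rewrite !mulr_ge0//; last by lra.
  by apply: prodr_ge0 => i _; apply: Rintegral_ge0 => x _; exact: cp.
have As j : A j <= \sum_i A i by rewrite (bigD1 j)//= lerDl sumr_ge0.
have updtr z j f : upd (translate z c) j (fun x => f (x - z j)) =
    translate z (upd c j f).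
  apply/funext => i; apply/funext => x; rewrite /translate /upd.
  by case: eqP => // ->.
have trupd z j s : translate (upd z j (z j - s)) c =
    upd (translate z c) j (fun x => c j (x - z j + s)).
  apply/funext => i; apply/funext => x; rewrite /translate /upd.
  by case: eqP => // ->; rewrite opprB addrA addrAC.
have lin z j s (f g : R -> R) : ccsmooth f -> ccsmooth g ->
    Lam (upd (translate z c) j (fun x => f x + s * g x)) =
    Lam (upd (translate z c) j f) + s * Lam (upd (translate z c) j g).
  move=> cf cg; have := Lam_linear j 1 s (tr z) cf cg.
  by rewrite mul1r => <-; congr (Lam (upd _ _ _)); apply/funext => x; rewrite mul1r.
have sh (z : I -> R) j (f : R -> R) : ccsmooth f -> ccsmooth (fun x => f (x - z j)).
  exact: (@ccsmooth_shift f (z j)).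
have sh' (z : I -> R) j (s : R) (f : R -> R) : ccsmooth f -> ccsmooth (fun x => f (x - z j + s)).
  move=> cf; have := ccsmooth_shift (z j - s) cf.
  rewrite (_ : (fun x => f (x - (z j - s))) = fun x => f (x - z j + s))//.
  by apply/funext => x; rewrite opprB addrA addrAC.
rewrite -(V (fun=> 0)).
have -> : Lam c = Lam (translate (fun=> 0) c).
  by congr Lam; apply/funext => j; apply/funext => x; rewrite /translate subr0.
rewrite (V (fun=> 0)).
apply: (@penalized_min R I o (fun z => Lam (translate z c))
  (fun z => Lam (upd (translate z c) o (fun x => derive1 (c o) (x - z o))))
  (fun i z => Lam (upd (translate z c) i (fun x => derive1 (derive1 (c i)) (x - z i))))
  (\sum_i A i)).
- by rewrite sumr_ge0.
- exact: C0.
- by move=> z; exact: Lam_ge0.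
- move=> z h /andP[h0 h1].
  have h20 : 0 < h ^+ 2 by rewrite exprn_gt0.
  have h21 : h ^+ 2 < 1 by rewrite expr_lt1// ltW.
  (* Moving [z o] back by [h ^+ 2] moves the argument of the factor forward; [r] is its first-order
     Taylor remainder, written as a linear combination to which [lin] applies. *)
  pose r x := c o (x - z o + h ^+ 2) + -1 * c o (x - z o) +
    - h ^+ 2 * derive1 (c o) (x - z o).
  have [B0 B1 _] := BP o; have [L0 LZ] := LP o.
  have cr : ccsmooth r.
    apply: ccsmoothD; last by apply: ccsmoothZ; exact: (sh z o).
    apply: ccsmoothD; first exact: (sh' z o).
    by apply: ccsmoothZ; exact: (sh z o).
  rewrite -lerBlDl; set f := (X in X <= _).
  apply: (@le_trans _ _ (M * (\prod_(i | i != o) \int[leb]_x translate z c i x) *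
      ((B o * h ^+ 4) * ((z o + L o + 1) - (z o - L o - 1))))).
    apply: (@Lam_remainder _ o f r) => //.
    + by lra.
    + by rewrite mulr_ge0// exprn_ge0// ltW.
    + move=> x; have := smooth1_taylor1 (x - z o) (h ^+ 2) (sm o) B1.
      by rewrite /r mulN1r mulNr -exprM.
    + move=> x Hx; rewrite /r.
      have [|-> _ _] := LZ (x - z o + h ^+ 2); first lra.
      have [|-> -> _] := LZ (x - z o); first lra.
      lra.
    + rewrite /f trupd /r lin//; last 2 first.
      * by apply: ccsmoothD; [exact: (sh' z o)|apply: ccsmoothZ; exact: (sh z o)].
      * exact: (sh z o).
      rewrite lin//; [|exact: (sh' z o)|exact: (sh z o)].
      by rewrite [upd _ _ (fun x => c o (x - z o))](upd_id (translate z c) o) mulN1r mulNr.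
  rewrite V'; apply: (@le_trans _ _ (A o * h ^+ 3)); last first.
    by rewrite ler_wpM2r// exprn_ge0// ltW.
  rewrite /A -[leRHS]mulrA ler_wpM2l//.
    by apply: mulr_ge0 => //; apply: prodr_ge0 => i _; apply: Rintegral_ge0 => x _; exact: cp.
  have h43 : h ^+ 4 <= h ^+ 3 by rewrite ler_wiXn2l// ltW.
  have : B o * h ^+ 4 <= B o * h ^+ 3 by rewrite ler_wpM2l.
  have : 0 <= B o * h ^+ 3 by rewrite mulr_ge0// exprn_ge0// ltW.
  rewrite (_ : z o + L o + 1 - (z o - L o - 1) = 2 * (L o + 1)); last by ring.
  move: L0; nra.
- move=> i z h io /andP[h0 h1].
  (* The remainder of the symmetric second difference, of order [h ^+ 3] by [smooth1_taylor2]. *)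
  pose r x := c i (x - z i + h) + 1 * c i (x - z i + - h) + -2 * c i (x - z i) +
    - h ^+ 2 * derive1 (derive1 (c i)) (x - z i).
  have [B0 _ B1] := BP i; have [L0 LZ] := LP i.
  have cr : ccsmooth r.
    apply: ccsmoothD; last by apply: ccsmoothZ; exact: (sh z i).
    apply: ccsmoothD; last by apply: ccsmoothZ; exact: (sh z i).
    apply: ccsmoothD; first exact: (sh' z i).
    by apply: ccsmoothZ; exact: (sh' z i).
  rewrite -lerBlDl; set f := (X in X <= _).
  apply: (@le_trans _ _ (M * (\prod_(j | j != i) \int[leb]_x translate z c j x) *
      ((2 * B i * h ^+ 3) * ((z i + L i + 1) - (z i - L i - 1))))).
    apply: (@Lam_remainder _ i f r) => //.
    + by lra.
    + by rewrite mulr_ge0 ?mulr_ge0 ?exprn_ge0 ?(ltW h0).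
    + move=> x; have := smooth1_taylor2 (x - z i) (sm i) B1 (ltW h0).
      by rewrite /r mul1r !mulNr.
    + move=> x Hx; rewrite /r.
      have [|-> _ _] := LZ (x - z i + h); first lra.
      have [|-> _ _] := LZ (x - z i - h); first lra.
      have [|-> _ ->] := LZ (x - z i); first lra.
      lra.
    + rewrite /f -[z i + h](_ : z i - (- h) = _); last by rewrite opprK.
      rewrite !trupd /r !lin//.
      * rewrite [upd _ _ (fun x => c i (x - z i))](upd_id (translate z c) i).
        by rewrite mul1r !mulNr [X in X - _ - _ = _]addrC.
      * exact: (sh' z i).
      * exact: (sh' z i).
      * by apply: ccsmoothD; [exact: (sh' z i)|apply: ccsmoothZ; exact: (sh' z i)].
      * exact: (sh z i).
      * apply: ccsmoothD; last by apply: ccsmoothZ; exact: (sh z i).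
        apply: ccsmoothD; [exact: (sh' z i)|apply: ccsmoothZ; exact: (sh' z i)].
      * exact: (sh z i).
  rewrite V'; apply: (@le_trans _ _ (A i * h ^+ 3)); last first.
    by rewrite ler_wpM2r// exprn_ge0// ltW.
  rewrite /A -[leRHS]mulrA ler_wpM2l//.
    by apply: mulr_ge0 => //; apply: prodr_ge0 => j _; apply: Rintegral_ge0 => x _; exact: cp.
  rewrite (_ : z i + L i + 1 - (z i - L i - 1) = 2 * (L i + 1)); last by ring.
  by rewrite mulrAC.
- move=> z.
  have E j : derive1 (translate z c j) = fun x => derive1 (c j) (x - z j).
    exact: (derive1_shift (z j) (sm j)).
  have E2 j : derive1 (derive1 (translate z c j)) =
      fun x => derive1 (derive1 (c j)) (x - z j).
    by rewrite E; exact: (derive1_shift (z j) (smd j)).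
  have S : \sum_(i | i != o) Lam (upd (translate z c) i
      (derive1 (derive1 (translate z c i)))) = \sum_(i | i != o)
      Lam (upd (translate z c) i (fun x => derive1 (derive1 (c i)) (x - z i))).
    by apply: eq_bigr => i _; rewrite (E2 i).
  have H := Lam_ineq (tr z) (trp z).
  rewrite (V z) (E o) S in H.
  exact: H.
Qed.

End functional.

(** * Tensor products on space-time and pairings with reflection *)

Section spacetime_tensor.
Context {R : realType} {n : nat}.
Local Notation leb := (@lebesgue_measure R).
Local Notation spacetime := ('rV[R]_n.+1 * R)%type.
Local Notation mspacetime := ('rV[R]_n.+1 * measurableTypeR R)%type.
Local Notation mu := (@spacetime_measure R n).
Local Notation index := (option 'I_n.+1).
Implicit Types c : index -> R -> R.

Definition coord (z : spacetime) (j : index) : R :=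
  if j is Some i then z.1 ord0 i else z.2.

Definition tens c (z : spacetime) : R := \prod_j c j (coord z j).

Lemma big_option_index (F : index -> R) : \prod_j F j = F None * \prod_i F (Some i).
Proof.
rewrite (bigD1 None)//=; congr (_ * _).
rewrite (reindex_omap Some id) => [|[i|]]//=.
by apply: eq_bigl => i; rewrite eqxx.
Qed.

Lemma tens_split c z : tens c z = (\prod_i c (Some i) (z.1 ord0 i)) * c None z.2.
Proof. by rewrite /tens big_option_index mulrC. Qed.

Lemma tens_integrable c :
  (forall j, leb.-integrable setT (EFin \o c j)) ->
  mu.-integrable setT (EFin \o tens c) /\
  \int[mu]_z tens c z = \prod_j \int[leb]_t c j t.
Proof.
move=> ci; have [I1 I2] := tensor_rV (fun i => ci (Some i)).
have E : tens c = fun z => (\prod_i c (Some i) (z.1 ord0 i)) * c None z.2.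
  by apply/funext => z; exact: tens_split.
rewrite E; split; first exact: (integrable_prod I1 (ci None)).
rewrite big_option_index mulrC -I2.
exact: (Rintegral_prod I1 (ci None)).
Qed.

Lemma measurable_coord j : measurable_fun [set: mspacetime] (fun z => coord z j).
Proof.
case: j => [i|]; last exact: measurable_snd.
exact: (measurableT_comp (measurable_rV_coord i) measurable_fst).
Qed.

Lemma measurable_tens c : (forall j, measurable_fun setT (c j)) ->
  measurable_fun [set: mspacetime] (tens c).
Proof.
move=> mc; rewrite (_ : tens c = fun z =>
  \prod_(j <- index_enum index) c j (coord z j))//.
elim: (index_enum _) => [|j s IH].
  by under eq_fun do rewrite big_nil; exact: measurable_cst.
under eq_fun do rewrite big_cons; apply: measurable_funM => //.
exact: (measurableT_comp (mc j) (measurable_coord j)).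
Qed.

Lemma tens_bigD1 c j z :
  tens c z = c j (coord z j) * \prod_(i | i != j) c i (coord z i).
Proof. by rewrite /tens (bigD1 j). Qed.

Lemma tens_upd c j f z : tens (upd c j f) z =
  f (coord z j) * \prod_(i | i != j) c i (coord z i).
Proof.
rewrite /tens (bigD1 j)//= upd_same; congr (_ * _).
by apply: eq_bigr => i ij; rewrite upd_other.
Qed.

Lemma tens_ge0 c z : nonneg_factors c -> 0 <= tens c z.
Proof. by move=> cp; apply: prodr_ge0. Qed.

Lemma normr_tens c z : `|tens c z| = tens (fun j x => `|c j x|) z.
Proof. by rewrite /tens normr_prod. Qed.

Lemma mul_tens_integrable (f : spacetime -> R) (M : R) c :
  measurable_fun [set: mspacetime] f ->
  (forall z, `|f z| <= M) -> (forall j, leb.-integrable setT (EFin \o c j)) ->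
  mu.-integrable setT (EFin \o (fun z => f z * tens c z)).
Proof.
move=> mf fM ci; have [I1 _] := tens_integrable ci.
have mt : measurable_fun [set: mspacetime] (tens c).
  by apply/measurable_EFinP; exact: measurable_int I1.
have I2 : mu.-integrable setT (EFin \o (fun z => M * tens c z)).
  rewrite (_ : _ \o _ = (fun z => M%:E * (EFin \o tens c) z)%E)//.
  exact: integrableZl.
apply: (le_integrable _ _ _ I2) => //.
  by apply/measurable_EFinP; exact: measurable_funM.
move=> z _ /=; rewrite lee_fin !normrM ler_wpM2r// (le_trans (fM z))//.
exact: ler_norm.
Qed.

Lemma mul_tens_bound (f : spacetime -> R) (M : R) c :
  measurable_fun [set: mspacetime] f -> 0 <= M ->
  (forall z, `|f z| <= M) -> (forall j, leb.-integrable setT (EFin \o c j)) ->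
  `|\int[mu]_z (f z * tens c z)| <= M * \prod_j \int[leb]_x `|c j x|.
Proof.
move=> mf M0 fM ci; have I1 := mul_tens_integrable mf fM ci.
have ci' j : leb.-integrable setT (EFin \o (fun x => `|c j x|)).
  by have := integrable_norm (ci j).
have [I2 E] := tens_integrable ci'.
apply: (le_trans (le_normr_Rintegral _ I1)) => //.
rewrite -E -RintegralZl//; apply: le_Rintegral => //.
- exact: (integrable_norm I1).
- rewrite (_ : _ \o _ = (fun z => M%:E * (EFin \o tens (fun j x => `|c j x|%R)) z)%E)//.
  exact: integrableZl.
- by move=> z _; rewrite normrM normr_tens ler_wpM2r// tens_ge0// => j x.
Qed.

Definition last_index : index := Some ord_max.

Definition reflect_last c := upd c last_index (fun x => c last_index (- x)).

Lemma admissible_reflect c : admissible c -> admissible (reflect_last c).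
Proof. by move=> ca; apply: admissible_upd => //; exact: ccsmoothN. Qed.

Lemma admissible_integrable c j : admissible c -> leb.-integrable setT (EFin \o c j).
Proof. by move=> ca; apply: ccont_integrable; exact: ccsmooth_ccont. Qed.

Lemma reflect_upd_last c f :
  reflect_last (upd c last_index f) = upd c last_index (fun x => f (- x)).
Proof. by rewrite /reflect_last upd_same upd_upd. Qed.

Lemma reflect_upd c j f : j != last_index ->
  reflect_last (upd c j f) = upd (reflect_last c) j f.
Proof. by move=> jl; rewrite /reflect_last upd_other 1?eq_sym// updC. Qed.

Lemma prod_reflect c : admissible c ->
  \prod_j \int[leb]_x `|reflect_last c j x| = \prod_j \int[leb]_x `|c j x|.
Proof.
move=> ca; rewrite (bigD1 last_index)//= [RHS](bigD1 last_index)//=.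
congr (_ * _).
  rewrite /reflect_last upd_same.
  exact: (ccont_RintegralN (ccont_norm (ccsmooth_ccont (ca last_index)))).
by apply: eq_bigr => j jl; rewrite /reflect_last upd_other.
Qed.

Section pairing.
Variables (f1 f2 : spacetime -> R) (M : R).
Hypotheses (M0 : 0 <= M)
  (mf1 : measurable_fun [set: mspacetime] f1)
  (mf2 : measurable_fun [set: mspacetime] f2)
  (f1M : forall z, `|f1 z| <= M) (f2M : forall z, `|f2 z| <= M).

(** Integration against [f1] plus the mirror image of [f2]. The reflection is put on the last test
    factor, so that it becomes a substitution in one real variable. *)
Definition pairing c :=
  \int[mu]_z (f1 z * tens c z) + \int[mu]_z (f2 z * tens (reflect_last c) z).

Let int_linear (f : spacetime -> R) c j (g h : R -> R) (a b : R) :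
  measurable_fun [set: mspacetime] f ->
  (forall z, `|f z| <= M) -> admissible c -> ccsmooth g -> ccsmooth h ->
  \int[mu]_z (f z * tens (upd c j (fun x => a * g x + b * h x)) z) =
  a * \int[mu]_z (f z * tens (upd c j g) z) + b * \int[mu]_z (f z * tens (upd c j h) z).
Proof.
move=> mf fM ca cg ch.
have Ig : mu.-integrable setT (EFin \o (fun z => f z * tens (upd c j g) z)).
  apply: mul_tens_integrable => // i.
  by apply: admissible_integrable; exact: admissible_upd.
have Ih : mu.-integrable setT (EFin \o (fun z => f z * tens (upd c j h) z)).
  apply: mul_tens_integrable => // i.
  by apply: admissible_integrable; exact: admissible_upd.
rewrite -!RintegralZl// -RintegralD//.
- by apply: eq_Rintegral => z _; rewrite !tens_upd; ring.
- by have := integrableZl measurableT a Ig.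
- by have := integrableZl measurableT b Ih.
Qed.

Lemma pairing_linear c j g h a b : admissible c -> ccsmooth g -> ccsmooth h ->
  pairing (upd c j (fun x => a * g x + b * h x)) =
  a * pairing (upd c j g) + b * pairing (upd c j h).
Proof.
move=> ca cg ch; rewrite /pairing int_linear//.
have [->|jl] := eqVneq j last_index.
  rewrite !reflect_upd_last int_linear//; [ring|exact: ccsmoothN|exact: ccsmoothN].
by rewrite !reflect_upd// int_linear//; [ring|exact: admissible_reflect].
Qed.

Lemma pairing_bounded c : admissible c ->
  `|pairing c| <= (M + M) * \prod_j \int[leb]_x `|c j x|.
Proof.
move=> ca; apply: le_trans (ler_normD _ _) _; rewrite mulrDl lerD//.
  by apply: mul_tens_bound => // j; exact: admissible_integrable.
rewrite -(prod_reflect ca).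
apply: mul_tens_bound => // j; apply: admissible_integrable.
exact: admissible_reflect.
Qed.

Lemma pairing_ge0 c : (forall z, 0 <= f1 z) -> (forall z, 0 <= f2 z) ->
  nonneg_factors c -> 0 <= pairing c.
Proof.
move=> f10 f20 cp; rewrite addr_ge0//; apply: Rintegral_ge0 => z _.
  by rewrite mulr_ge0// tens_ge0.
rewrite mulr_ge0// tens_ge0// => j x; rewrite /reflect_last /upd.
by case: eqP.
Qed.

End pairing.
End spacetime_tensor.

(** Differentiation exchanges odd and even parts, hence the sign of [s]. Two derivatives restore it,
    so antisymmetrization commutes with the second derivative. *)
Lemma derive1_fold (R : realType) (f : R -> R) (s : R) : smooth1 f ->
  derive1 (fun x => f x - s * f (- x)) = fun x => derive1 f x - (- s) * derive1 f (- x).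
Proof.
move=> sf; have sf' : smooth1 (fun x => f (-1 * x + 0)) by exact: smooth1_affine.
rewrite (_ : (fun x => f x - s * f (- x)) = fun x => f x - s * f (-1 * x + 0)); last first.
  by apply/funext => x; rewrite mulN1r addr0.
apply/funext => x; rewrite derive1_smoothB//; last exact: smooth1Z.
rewrite derive1_smoothM//; last exact: smooth1_cst.
by rewrite derive1_cst mulr0 addr0 derive1_affine// !mulN1r addr0 mulrN mulNr.
Qed.

(** * The gap estimate for the supremum minus the solution *)

Section gap.
Context {R : realType} {n : nat}.
Local Notation leb := (@lebesgue_measure R).
Local Notation spacetime := ('rV[R]_n.+1 * R)%type.
Local Notation mspacetime := ('rV[R]_n.+1 * measurableTypeR R)%type.
Local Notation mu := (@spacetime_measure R n).
Local Notation index := (option 'I_n.+1).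
Local Notation last_index := (@last_index n).
Implicit Types c : index -> R -> R.

Definition fold_last (sg : R) c :=
  upd c last_index (fun x => c last_index x - sg * c last_index (- x)).

Lemma fold_upd sg c j f : j != last_index ->
  fold_last sg (upd c j f) = upd (fold_last sg c) j f.
Proof. by move=> jl; rewrite /fold_last upd_other 1?eq_sym// updC. Qed.

Lemma fold_other sg c j : j != last_index -> fold_last sg c j = c j.
Proof. by move=> jl; rewrite /fold_last upd_other. Qed.

(* The very weak form of w_t - Delta w = G. For sg = 0 the test functions are
   arbitrary tensor products; for sg = 1 only their odd parts in the last
   variable are used, which vanish at the boundary of the half-space. *)
Definition weak_heat (sg : R) (w G : spacetime -> R) := forall c, admissible c ->
  \int[mu]_z (w z * tens (upd (fold_last sg c) None (derive1 (fold_last sg c None))) z) +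
  \sum_(j | j != None) \int[mu]_z
    (w z * tens (upd (fold_last sg c) j (derive1 (derive1 (fold_last sg c j)))) z) +
  \int[mu]_z (G z * tens (fold_last sg c) z) = 0.

(* On the whole space p is always true and sg = 0; on the half-space p is
   positivity and sg = 1. *)
Variables (p : R -> bool) (sg : R).
Hypothesis mp : measurable_fun setT p.
Hypothesis p_half : forall f : R -> R, ccsmooth f ->
  \int[leb]_x (if p x then f x else 0) + sg * \int[leb]_x (if p x then f (- x) else 0)
  = \int[leb]_x f x.
Hypothesis sg01 : 0 <= sg <= 1.

Variables (w G : spacetime -> R) (S K C d : R).
Hypotheses (mw : measurable_fun [set: mspacetime] w)
  (mG : measurable_fun [set: mspacetime] G).
Hypotheses (S0 : 0 <= S) (C0 : 0 <= C).
Hypotheses (wS : forall z, `|w z| <= S) (GK : forall z, `|G z| <= K).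
Hypothesis w0 : forall z, ~~ p (coord z last_index) -> w z = 0.
Hypothesis G0 : forall z, ~~ p (coord z last_index) -> G z = 0.
(** Since [w_t - Delta w = G], this is [C f + f_t - Delta f >= d] for [f = S - w]; [Gge] is the same
    for [S + w]. Bounding [w] from one side takes both, because the odd reflection of [w] is [- w]
    beyond the boundary. *)
Hypothesis Gle : forall z, p (coord z last_index) -> G z <= - d + C * (S - w z).
Hypothesis Gge : forall z, p (coord z last_index) -> - G z <= - d + C * (S + w z).
Hypothesis wG : weak_heat sg w G.

Let Q z : R := (p (coord z last_index))%:R.
Let pr (f : spacetime -> R) c := \int[mu]_z (f z * tens c z).

Let mQ : measurable_fun [set: mspacetime] Q.
Proof.
rewrite /Q (_ : (fun _ => _) = fun z => if p (coord z last_index) then 1 else 0 : R).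
  apply: measurable_fun_ifT => //.
  exact: (measurableT_comp mp (measurable_coord last_index)).
by apply/funext => z; case: (p _).
Qed.

Let Q1 z : `|Q z| <= 1.
Proof. by rewrite /Q; case: (p _); rewrite ?normr1 ?normr0. Qed.

Definition bounded_measurable (f : spacetime -> R) :=
  measurable_fun [set: mspacetime] f /\ exists M, forall z, `|f z| <= M.

Let bQ : bounded_measurable Q. Proof. by split => //; exists 1. Qed.
Let bw : bounded_measurable w. Proof. by split => //; exists S. Qed.
Let bG : bounded_measurable G. Proof. by split => //; exists K. Qed.

Lemma bounded_measurableD f g : bounded_measurable f -> bounded_measurable g ->
  bounded_measurable (fun z => f z + g z).
Proof.
move=> [mf [M fM]] [mg [N gN]]; split; first exact: measurable_funD.
by exists (M + N) => z; rewrite (le_trans (ler_normD _ _))// lerD.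
Qed.

Lemma bounded_measurableZ a f : bounded_measurable f ->
  bounded_measurable (fun z => a * f z).
Proof.
move=> [mf [M fM]]; split; first exact: measurable_funM.
by exists (`|a| * M) => z; rewrite normrM ler_wpM2l.
Qed.

Lemma bounded_measurable_tens f c : bounded_measurable f -> admissible c ->
  mu.-integrable setT (EFin \o (fun z => f z * tens c z)).
Proof.
move=> [mf [M fM]] ca; apply: (mul_tens_integrable mf fM) => j.
exact: admissible_integrable.
Qed.

Let prD f g c : bounded_measurable f -> bounded_measurable g -> admissible c ->
  pr (fun z => f z + g z) c = pr f c + pr g c.
Proof.
move=> bf bg ca; rewrite /pr -RintegralD//; try exact: bounded_measurable_tens.
by apply: eq_Rintegral => z _; rewrite mulrDl.
Qed.

Let prZ a f c : bounded_measurable f -> admissible c ->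
  pr (fun z => a * f z) c = a * pr f c.
Proof.
move=> bf ca; rewrite /pr -RintegralZl//; last exact: bounded_measurable_tens.
by apply: eq_Rintegral => z _; rewrite mulrA.
Qed.

Let pr_le f g c : bounded_measurable f -> bounded_measurable g -> admissible c ->
  nonneg_factors c -> (forall z, f z <= g z) -> pr f c <= pr g c.
Proof.
move=> bf bg ca cp fg; apply: le_Rintegral => //; try exact: bounded_measurable_tens.
by move=> z _; rewrite ler_wpM2r// tens_ge0.
Qed.

Let ca_ref c : admissible c -> admissible (reflect_last c).
Proof. exact: admissible_reflect. Qed.

Let cp_ref c : nonneg_factors c -> nonneg_factors (reflect_last c).
Proof. by move=> cp j x; rewrite /reflect_last /upd; case: eqP. Qed.

Let pr_fold f c : bounded_measurable f -> admissible c ->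
  pr f (fold_last sg c) = pr f c - sg * pr f (reflect_last c).
Proof.
move=> bf ca; rewrite /pr -RintegralZl//; last first.
  by apply: bounded_measurable_tens => //; exact: ca_ref.
rewrite -RintegralB//.
- apply: eq_Rintegral => z _; rewrite /fold_last /reflect_last !tens_upd.
  rewrite (tens_bigD1 c last_index); ring.
- exact: bounded_measurable_tens.
- by have := integrableZl measurableT sg (bounded_measurable_tens bf (ca_ref ca)).
Qed.

(** The indicator [Q] depends on the last coordinate only, so the integral factors and [p_half]
    applies to the last factor alone. *)
Let prQ c : admissible c ->
  pr Q c + sg * pr Q (reflect_last c) = \prod_j \int[leb]_x c j x.
Proof.
move=> ca.
have H f : ccsmooth f -> pr Q (upd c last_index f) =
    (\int[leb]_x (if p x then f x else 0)) * \prod_(j | j != last_index) \int[leb]_x c j x.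
  move=> cf; pose f' := fun x => if p x then f x else 0.
  have fi : leb.-integrable setT (EFin \o f').
    have fi := ccont_integrable (ccsmooth_ccont cf).
    apply: (le_integrable _ _ _ fi) => //.
      apply/measurable_EFinP; apply: measurable_fun_ifT => //.
      exact: (ccont_measurable (ccsmooth_ccont cf)).
    by move=> x _ /=; rewrite lee_fin /f'; case: ifP => // _; rewrite normr0.
  have [|_] := @tens_integrable _ _ (upd c last_index f').
    by move=> j; rewrite /upd; case: eqP => // _; exact: admissible_integrable.
  rewrite (bigD1 last_index)//= upd_same => E.
  transitivity (\int[mu]_z tens (upd c last_index f') z).
    apply: eq_Rintegral => z _; rewrite /Q !tens_upd /f'.
    by case: (p _); rewrite ?mul1r ?mul0r.
  rewrite E; congr (_ * _); apply: eq_bigr => j jl.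
  by rewrite upd_other.
have cl := ca last_index.
rewrite -{1}(upd_id c last_index) H// H; last exact: ccsmoothN.
by rewrite mulrA -mulrDl p_half// [RHS](bigD1 last_index).
Qed.

(* On the half-space, pairing f1 f2 is integration over the whole space against
   S minus the odd reflection of w. *)
Let f1 z := S * Q z - w z.
Let f2 z := sg * (S * Q z + w z).

Let bf1 : bounded_measurable f1.
Proof.
rewrite /f1 (_ : (fun _ => _) = fun z => S * Q z + -1 * w z).
  by apply: bounded_measurableD; exact: bounded_measurableZ.
by apply/funext => z; rewrite mulN1r.
Qed.

Let bf2 : bounded_measurable f2.
Proof.
apply: bounded_measurableZ; apply: bounded_measurableD => //.
exact: bounded_measurableZ.
Qed.

Let f1_ge0 z : 0 <= f1 z.
Proof.
rewrite /f1 /Q; have := wS z; case: (boolP (p _)) => [_|h].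
  by rewrite mulr1 ler_norml subr_ge0 => /andP[].
by rewrite w0// mulr0 subr0.
Qed.

Let f2_ge0 z : 0 <= f2 z.
Proof.
have [s0 _] := andP sg01.
rewrite /f2 mulr_ge0// /Q; have := wS z; case: (boolP (p _)) => [_|h].
  by rewrite mulr1 ler_norml => /andP[]; lra.
by rewrite w0// mulr0 addr0.
Qed.

Let f1_le z : `|f1 z| <= S + S.
Proof.
rewrite ger0_norm// /f1; have := wS z; have := Q1 z.
rewrite !ler_norml => /andP[_ q] /andP[a b].
have : S * Q z <= S * 1 by rewrite ler_wpM2l.
lra.
Qed.

Let f2_le z : `|f2 z| <= S + S.
Proof.
have [s0 s1] := andP sg01.
rewrite ger0_norm// /f2; have := wS z; have := Q1 z.
rewrite !ler_norml => /andP[_ q] /andP[a b].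
have qq : S * Q z <= S * 1 by rewrite ler_wpM2l.
have := f2_ge0 z; rewrite /f2 => H.
apply: (@le_trans _ _ (1 * (S + S))); last by rewrite mul1r.
apply: (@le_trans _ _ (sg * (S + S))); first by rewrite ler_wpM2l//; lra.
by rewrite ler_wpM2r// addr_ge0.
Qed.

Let Lam c := pairing f1 f2 c.

(** By [prQ] the constant [S] is integrated over the whole space, and the two terms in [w] combine
    into one integral against the antisymmetrized factors. *)
Let LamE c : admissible c ->
  Lam c = S * \prod_j \int[leb]_x c j x - pr w (fold_last sg c).
Proof.
move=> ca; have ca' := ca_ref ca.
rewrite (_ : Lam c = pr f1 c + pr f2 (reflect_last c))// pr_fold// -(prQ ca).
have -> : pr f1 c = S * pr Q c - pr w c.
  rewrite -prZ// -[in RHS]mulN1r -prZ// -prD//; try exact: bounded_measurableZ.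
  by apply: eq_Rintegral => z _; rewrite /f1 mulN1r.
have -> : pr f2 (reflect_last c) = sg * (S * pr Q (reflect_last c) + pr w (reflect_last c)).
  rewrite -(@prZ S)// -prD//; last exact: bounded_measurableZ.
  rewrite -prZ//; apply: bounded_measurableD => //.
  exact: bounded_measurableZ.
by ring.
Qed.

(** The bound of [functional_lower_bound] for [Lam]. Its differential inequality reduces to the weak
    equation on folded factors, followed by the pointwise bounds on [G] integrated on each side of
    the boundary. *)
Lemma gap_bound c : admissible c -> nonneg_factors c ->
  d * \prod_j \int[leb]_x c j x <=
  (C + 4 + 2 * #|{: index}|%:R) * pairing f1 f2 c.
Proof.
have [s0 s1] := andP sg01.
have [mf1 _] := bf1; have [mf2 _] := bf2.
have SS : 0 <= S + S by rewrite addr_ge0.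
apply: (@functional_lower_bound R index None Lam ((S + S) + (S + S)) C d) => //.
- by rewrite addr_ge0.
- move=> c0 j f g a b ca cf cg.
  exact: (pairing_linear mf1 mf2 f1_le f2_le).
- by move=> c0 ca; exact: (pairing_bounded SS mf1 mf2 f1_le f2_le).
- by move=> c0 ca cp; exact: pairing_ge0.
move=> c0 {}ca {}cp; rename c0 into c0.
(* The constant part [S] is invisible to derivatives, as the derivative of a compactly supported
   factor has integral 0. *)
have LD j f : ccsmooth f -> \int[leb]_x f x = 0 ->
    Lam (upd c0 j f) = - pr w (fold_last sg (upd c0 j f)).
  move=> cf f0; rewrite LamE; last exact: admissible_upd.
  by rewrite (bigD1 j)//= upd_same f0 mul0r mulr0 sub0r.
have cd j : ccsmooth (derive1 (c0 j)) by exact: ccsmooth_derive1.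
have cdd j : ccsmooth (derive1 (derive1 (c0 j))) by exact: ccsmooth_derive1.
rewrite LD//; last exact: ccsmooth_Rintegral_derive1.
rewrite [\sum_(j | _) _](eq_bigr (fun j =>
  - pr w (fold_last sg (upd c0 j (derive1 (derive1 (c0 j))))))); last first.
  by move=> j _; exact: (LD j _ (cdd j) (ccsmooth_Rintegral_derive1 (cd j))).
have FN : fold_last sg (upd c0 None (derive1 (c0 None))) =
    upd (fold_last sg c0) None (derive1 (fold_last sg c0 None)).
  have lN : None != last_index by [].
  by rewrite (fold_upd sg c0 _ lN) (fold_other sg c0 lN).
have FS j : fold_last sg (upd c0 j (derive1 (derive1 (c0 j)))) =
    upd (fold_last sg c0) j (derive1 (derive1 (fold_last sg c0 j))).
  have [->|jl] := eqVneq j last_index.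
    rewrite /fold_last !upd_same !upd_upd; congr upd.
    have sl : smooth1 (c0 last_index) by case: (ca last_index).
    have sd := smooth1_derive1 sl.
    by rewrite derive1_fold// derive1_fold// opprK.
  by rewrite (fold_upd sg c0 _ jl) (fold_other sg c0 jl).
have E : pr w (fold_last sg (upd c0 None (derive1 (c0 None)))) +
    \sum_(j | j != None) pr w (fold_last sg (upd c0 j (derive1 (derive1 (c0 j))))) +
    pr G (fold_last sg c0) = 0.
  have -> : \sum_(j | j != None)
      pr w (fold_last sg (upd c0 j (derive1 (derive1 (c0 j))))) =
    \sum_(j | j != None)
      pr w (upd (fold_last sg c0) j (derive1 (derive1 (fold_last sg c0 j)))).
    by apply: eq_bigr => j _; rewrite (FS j).
  rewrite FN; exact: (wG ca).
rewrite sumrN !opprK.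
have -> : C * Lam c0 + pr w (fold_last sg (upd c0 None (derive1 (c0 None)))) +
    \sum_(i | i != None) pr w (fold_last sg (upd c0 i (derive1 (derive1 (c0 i))))) =
    C * Lam c0 - pr G (fold_last sg c0).
  by rewrite -addrA; congr (_ + _); apply/eqP; rewrite -addr_eq0 E.
rewrite lerBrDr pr_fold// -(prQ ca).
have ca' := ca_ref ca; have cp' := cp_ref cp.
have H1 : pr G c0 <= - d * pr Q c0 + C * pr f1 c0.
  rewrite -!prZ// -prD//; try exact: bounded_measurableZ.
  apply: pr_le => //.
    by apply: bounded_measurableD; exact: bounded_measurableZ.
  move=> z; rewrite /f1 /Q; case: (boolP (p _)) => h.
    by rewrite !mulr1; exact: Gle.
  by rewrite G0// w0// !mulr0 subr0 mulr0 addr0.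
have H2 : - pr G (reflect_last c0) <= - d * pr Q (reflect_last c0) +
    C * (S * pr Q (reflect_last c0) + pr w (reflect_last c0)).
  rewrite -[leLHS]mulN1r -!prZ// -prD//; last exact: bounded_measurableZ.
  rewrite -prZ//; last by apply: bounded_measurableD => //; exact: bounded_measurableZ.
  rewrite -prD//; last 2 first.
  - exact: bounded_measurableZ.
  - by apply: bounded_measurableZ; apply: bounded_measurableD => //; exact: bounded_measurableZ.
  apply: pr_le => //.
  - exact: bounded_measurableZ.
  - apply: bounded_measurableD; first exact: bounded_measurableZ.
    by apply: bounded_measurableZ; apply: bounded_measurableD => //; exact: bounded_measurableZ.
  move=> z; rewrite /Q; case: (boolP (p _)) => h.
    by rewrite !mulr1 mulN1r; exact: Gge.
  by rewrite G0// w0// !mulr0 addr0 mulr0 addr0.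
have H3 := ler_wpM2l s0 H2.
have -> : Lam c0 = pr f1 c0 + sg * (S * pr Q (reflect_last c0) + pr w (reflect_last c0)).
  rewrite (_ : Lam c0 = pr f1 c0 + pr f2 (reflect_last c0))//; congr (_ + _).
  rewrite -(@prZ S)// -prD//; last exact: bounded_measurableZ.
  rewrite -prZ//; apply: bounded_measurableD => //.
  exact: bounded_measurableZ.
by move: H1 H3; lra.
Qed.

End gap.

(** * Functions determined by their integrals over boxes *)

(* A substitute for Lebesgue differentiation that passes to product measures. *)
Definition determining d (T : measurableType d) (R : realType)
    (m : {measure set T -> \bar R}) (J : Type) (B : J -> set T) :=
  [/\ forall j, measurable (B j), forall j, (m (B j) < +oo)%E &
    forall (f : T -> R) (M K : R), measurable_fun setT f ->
      (forall x, 0 <= f x <= M) -> 0 <= K ->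
      (forall j, (\int[m]_(x in B j) (f x)%:E <= K%:E * m (B j))%E) ->
      m [set x | K < f x] = 0%E].

Section determining_prod.
Context {d1 d2} {T1 : measurableType d1} {T2 : measurableType d2} {R : realType}.
Variables (m1 : {sigma_finite_measure set T1 -> \bar R})
  (m2 : {sigma_finite_measure set T2 -> \bar R}).
Variables (J1 : countType) (J2 : Type) (B1 : J1 -> set T1) (B2 : J2 -> set T2).

(** For each [i], the integral [gE i y] of [f] over [B1 i] at height [y] satisfies the hypothesis of
    [H2], so it is at most [K * m1 (B1 i)] for almost every [y]. As [J1] is countable, one null set
    serves all [i]; for the other [y], [H1] applies to the slice of [f], and Tonelli concludes. *)
Lemma determining_prod : determining m1 B1 -> determining m2 B2 ->
  determining (m1 \x m2)%E (fun j : J1 * J2 => B1 j.1 `*` B2 j.2).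
Proof.
move=> [mB1 fB1 H1] [mB2 fB2 H2]; split.
- by move=> j; exact: measurableX.
- move=> j; rewrite /= product_measure1E//; apply: lte_mul_pinfty => //.
    by rewrite ge0_fin_numE//; exact: fB1.
  exact: fB2.
move=> f M K mf f0M K0 HB.
have f0 z : 0 <= f z by case/andP: (f0M z).
have M0 : 0 <= M by have /andP[] := f0M point; exact: le_trans.
have mfy y : measurable_fun setT (fun x => f (x, y)).
  exact: (measurableT_comp mf (measurable_pair2 y)).
pose h i (z : T1 * T2) : R := f z * \1_(B1 i) z.1.
have mh i : measurable_fun setT (EFin \o h i).
  apply/measurable_EFinP; apply: measurable_funM => //.
  by apply: (measurableT_comp _ measurable_fst); exact: measurable_indic.
have h0 i z : (0 <= (EFin \o h i) z)%E by rewrite /= lee_fin mulr_ge0.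
have hE i y : (\int[m1]_x (EFin \o h i) (x, y))%E = (\int[m1]_(x in B1 i) (f (x, y))%:E)%E.
  rewrite [RHS]integral_mkcond; apply: eq_integral => x _.
  by rewrite patchE /h /= indicE; case: ifP; rewrite ?mulr1 ?mulr0.
pose gE i y := (\int[m1]_(x in B1 i) (f (x, y))%:E)%E.
have gE0 i y : (0 <= gE i y)%E by apply: integral_ge0 => x _; rewrite lee_fin.
have gEM i y : (gE i y <= M%:E * m1 (B1 i))%E.
  rewrite /gE -integral_cst//; apply: ge0_le_integral => //.
  - by move=> x _; rewrite lee_fin.
  - by apply/measurable_EFinP; apply: measurable_funTS; exact: mfy.
  - by move=> x _; rewrite lee_fin; case/andP: (f0M (x, y)).
have m1fin i : m1 (B1 i) \is a fin_num by rewrite ge0_fin_numE//; exact: fB1.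
have gEfin i y : gE i y \is a fin_num.
  rewrite ge0_fin_numE//; apply: (le_lt_trans (gEM i y)).
  by apply: lte_mul_pinfty; [rewrite lee_fin|by []|exact: fB1].
have mgE i : measurable_fun setT (gE i).
  rewrite (_ : gE i = fubini_G m1 (EFin \o h i)); last first.
    by apply/funext => y; rewrite /fubini_G hE.
  exact: measurable_fun_fubini_tonelli_G.
have N1 i : m2 [set y | K * fine (m1 (B1 i)) < fine (gE i y)] = 0%E.
  apply: (H2 (fine \o gE i) (M * fine (m1 (B1 i)))).
  - exact: measurableT_comp.
  - move=> y /=; rewrite fine_ge0//= -lee_fin fineK// EFinM fineK//.
  - by rewrite mulr_ge0// fine_ge0.
  move=> j; have := HB (i, j); rewrite /= product_measure1E//=.
  rewrite EFinM fineK// -muleA; apply: le_trans.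
  rewrite [leLHS](_ : _ = \int[m2]_(y in B2 j) gE i y)%E; last first.
    by apply: eq_integral => y _; rewrite /= fineK.
  rewrite le_eqVlt; apply/orP; left; apply/eqP.
  rewrite [RHS]integral_mkcond [LHS]integral_mkcond.
  pose k (z : T1 * T2) : R := h i z * \1_(B2 j) z.2.
  have mk : measurable_fun setT (EFin \o k).
    apply/measurable_EFinP; apply: measurable_funM; first by apply/measurable_EFinP.
    by apply: (measurableT_comp _ measurable_snd); exact: measurable_indic.
  have k0 z : (0 <= (EFin \o k) z)%E by rewrite /= lee_fin !mulr_ge0.
  transitivity (\int[m1 \x m2]_z (EFin \o k) z)%E; last first.
    apply: eq_integral => z _; rewrite patchE /k /h /= !indicE.
    rewrite in_setX; case: (_ \in _); case: (_ \in _);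
      by rewrite /= ?mulr1 ?mulr0 ?mul0r.
  rewrite fubini_tonelli2//; apply: eq_integral => y _.
  rewrite /fubini_G patchE; case: ifPn => yB.
    rewrite /gE -hE; apply: eq_integral => x _.
    by rewrite /k /= indicE yB mulr1.
  rewrite integral0_eq// => x _; by rewrite /k /= indicE (negbTE yB) mulr0.
have mN : measurable [set z | K < f z].
  rewrite -[X in measurable X]setTI.
  have := mf; move=> /(_ measurableT `]K, +oo[%classic (measurable_itv _)).
  rewrite (_ : f @^-1` _ = [set z | K < f z])//.
  by apply/seteqP; split => z /=; rewrite in_itv/= andbT.
rewrite -(setIT [set z | K < f z]) -integral_indic//=.
rewrite fubini_tonelli2//=; last first.
  by apply/measurable_EFinP; exact: measurable_indic.
(* The countable intersection is over natural numbers, so the indices [i] are reached through their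
   codes. *)
have AE : {ae m2, forall y, forall i, (gE i y <= K%:E * m1 (B1 i))%E}.
  have : {ae m2, forall y, forall k : nat,
      if (unpickle k : option J1) is Some i then (gE i y <= K%:E * m1 (B1 i))%E else true}.
    apply: ae_foralln => k; case: (unpickle k) => [i|]; last by apply: aeW.
    exists [set y | K * fine (m1 (B1 i)) < fine (gE i y)]; split; last 2 first.
    - exact: N1.
    - move=> y /= /negP; rewrite -ltNge -lte_fin fineK// EFinM fineK//.
      rewrite -[X in measurable X]setTI.
      have mg : measurable_fun setT (fine \o gE i) by exact: measurableT_comp.
      have := mg; move=> /(_ measurableT `](K * fine (m1 (B1 i))), +oo[%classic (measurable_itv _)).
      rewrite (_ : _ @^-1` _ = [set y | K * fine (m1 (B1 i)) < fine (gE i y)])//.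
      by apply/seteqP; split => y /=; rewrite in_itv/= andbT.
  apply: filterS => y Hy i; have := Hy (pickle i).
  by rewrite pickleK.
rewrite (ae_eq_integral (cst 0%E))//; first by rewrite integral0.
  apply: measurable_fun_fubini_tonelli_G => //.
  by apply/measurable_EFinP; exact: measurable_indic.
apply: filterS AE => y Hy _ /=; rewrite /fubini_G.
have := H1 (fun x => f (x, y)) M K (mfy y) (fun x => f0M (x, y)) K0 Hy.
move=> Z; rewrite -[RHS]Z.
rewrite -[in RHS](setIT [set x | K < f (x, y)]) -integral_indic//.
rewrite -[X in measurable X]setTI.
have := mfy y; move=> /(_ measurableT `]K, +oo[%classic (measurable_itv _)).
rewrite (_ : _ @^-1` _ = [set x | K < f (x, y)])//.
by apply/seteqP; split => z /=; rewrite in_itv/= andbT.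
Qed.

End determining_prod.

Section determining_line.
Context {R : realType}.
Local Notation leb := (@lebesgue_measure R).

Definition rat_itv (q : rat * rat) : set R := `]ratr q.1, ratr q.2[%classic.

(** Lebesgue's differentiation theorem along intervals with rational endpoints; rationality keeps
    the family countable, as products require. *)
Lemma determining_line :
  @determining _ (measurableTypeR R) R leb _ rat_itv.
Proof.
split.
- by move=> q; exact: measurable_itv.
- by move=> q; rewrite /rat_itv /= lebesgue_measure_itv/=; case: ifP; rewrite ?ltry// -EFinB ltry.
move=> f M K mf f0M K0 HB.
have f0 z : 0 <= f z by case/andP: (f0M z).
have lf : locally_integrable setT f.
  split => //; first exact: openT.
  move=> A _ cA; apply: (@le_lt_trans _ _ (\int[leb]_(x in A) M%:E)%E).
    apply: ge0_le_integral => //.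
    - exact: compact_measurable.
    - by apply/measurable_EFinP; apply: measurableT_comp => //; exact: measurable_funTS.
    - by move=> x _; rewrite lee_fin ger0_norm//; case/andP: (f0M x).
  rewrite integral_cst//; last exact: compact_measurable.
  have M0 : 0 <= M by have /andP[] := f0M 0; exact: le_trans.
  by rewrite lte_mul_pinfty ?lee_fin//; exact: compact_finite_measure.
pose r (n : nat) : R := n.+1%:R^-1.
have r0 n : 0 < r n by rewrite invr_gt0.
(* Both endpoints lie at distance between [r / 2] and [r] from [x], so the interval is inside the
   ball of radius [r] and has at least half its length: hence the constant 2 of
   [nicely_shrinking]. *)
have /boolp.choice[q qP] : forall xn : R * nat, exists q : rat * rat,
    [/\ xn.1 - r xn.2 < ratr q.1, ratr q.1 < xn.1 - r xn.2 / 2,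
        xn.1 + r xn.2 / 2 < ratr q.2 & ratr q.2 < xn.1 + r xn.2].
  move=> [x n] /=; have r0' := r0 n.
  have [|a] := @rat_in_itvoo R (x - r n) (x - r n / 2); first by lra.
  have [|b] := @rat_in_itvoo R (x + r n / 2) (x + r n); first by lra.
  rewrite !in_itv/= => /andP[b1 b2] /andP[a1 a2].
  by exists (a, b).
pose E (x : R) (n : nat) : set R := rat_itv (q (x, n)).
have mE x n : leb (E x n) = (ratr (q (x, n)).2 - ratr (q (x, n)).1)%:E.
  have [q1 q2 q3 q4] := qP (x, n); have := r0 n.
  rewrite /E /rat_itv lebesgue_measure_itv/= lte_fin; move: q1 q2 q3 q4 => /= *.
  by rewrite ifT//; lra.
have hE x : nicely_shrinking x (E x).
  split; first by move=> n; exact: measurable_itv.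
  exists (2, fun n => PosNum (r0 n)); split => //=.
  - exact: cvg_harmonic.
  - move=> n y; have [q1 q2 q3 q4] := qP (x, n).
    rewrite /E /rat_itv /= in_itv/= ball_itv/= in_itv/= => /andP[y1 y2].
    move: q1 q2 q3 q4 => /= *; apply/andP; split; lra.
  - move=> n; rewrite mE lebesgue_measure_ball ?(ltW (r0 n))// -EFinM lee_fin.
    have [q1 q2 q3 q4] := qP (x, n); move: q1 q2 q3 q4 => /= *.
    by rewrite -mulr_natl; lra.
apply/negligibleP.
  rewrite -[X in measurable X]setTI.
  have := mf; move=> /(_ measurableT `]K, +oo[%classic (measurable_itv _)).
  rewrite (_ : f @^-1` _ = [set z | K < f z])//.
  by apply/seteqP; split => z /=; rewrite in_itv/= andbT.
apply: negligibleS (lebesgue_differentiation lf) => x /= Kfx lp; move: Kfx.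
apply/negP; rewrite -leNgt.
have := nice_lebesgue_differentiation hE lf lp.
have H n : ((leb (E x n))^-1 * \int[leb]_(y in E x n) (f y)%:E <= K%:E)%E.
  have pos : 0 < ratr (q (x, n)).2 - ratr (q (x, n)).1 :> R.
    by have [q1 q2 q3 q4] := qP (x, n); have := r0 n; move: q1 q2 q3 q4 => /= *; lra.
  rewrite mE inver gt_eqF// lee_pdivrMl// muleC -mE.
  exact: (HB (q (x, n))).
move=> cv; rewrite -lee_fin -(cvg_lim _ cv)//.
apply: lime_le; first by apply: cvgP cv.
exact: nearW.
Qed.

End determining_line.

Section determining_box.
Context {R : realType}.
Local Notation leb := (@lebesgue_measure R).

Definition rat_box_rV n (q : {ffun 'I_n -> rat * rat}) : set 'rV[R]_n :=
  [set x | forall i, rat_itv (q i) (x ord0 i)].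

Lemma measurable_rat_box_rV n q : measurable (@rat_box_rV n q).
Proof.
have -> : rat_box_rV q =
  \bigcap_(i in [set: 'I_n]) ((fun x : 'rV[R]_n => x ord0 i) @^-1` rat_itv (q i)).
  by apply/seteqP; split => [x h i _|x h i]; [exact: h|exact: (h i)].
apply: fin_bigcap_measurable => // i _.
rewrite -[X in measurable X]setTI; apply: measurable_rV_coord => //.
exact: measurable_itv.
Qed.

(** Induction along the recursive definition of [lebesgue_rV]. In dimension 0 the only box is the
    whole one-point space; [cons] identifies a box one dimension up with an interval times a box. *)
Lemma determining_rV n : determining (@lebesgue_rV R n) (@rat_box_rV n).
Proof.
elim: n => [|n [mB fB IH]].
  split.
  - by move=> q; exact: measurable_rat_box_rV.
  - by move=> q; rewrite /= diracE ltry.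
  move=> f M K mf f0M K0 H.
  have q0 : {ffun 'I_0 -> rat * rat} := [ffun=> (0, 0)].
  have E : rat_box_rV q0 = setT by apply/seteqP; split => // x _ [].
  have := H q0; rewrite E /= integral_dirac//; last exact/measurable_EFinP.
  rewrite diracT mul1e mule1 lee_fin => H0.
  by rewrite diracE memNset//= ltNge H0.
have [mP fP HP] := determining_prod (@determining_line R) (And3 mB fB IH).
pose cons (j : (rat * rat) * {ffun 'I_n -> rat * rat}) : {ffun 'I_n.+1 -> rat * rat} :=
  [ffun k => if unlift ord0 k is Some l then j.2 l else j.1].
have consE j : @rVcons R n @^-1` rat_box_rV (cons j) =
    rat_itv j.1 `*` rat_box_rV j.2.
  apply/seteqP; split => [z h|z [h1 h2] k].
    split=> [|i] /=.
      by have := h ord0; rewrite /cons ffunE unlift_none rVcons0.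
    by have := h (lift ord0 i); rewrite /cons ffunE liftK rVconsS.
  rewrite /cons ffunE; case: unliftP => [l|] ->; last by rewrite rVcons0.
  by rewrite rVconsS; exact: h2.
have consK (q : {ffun 'I_n.+1 -> rat * rat}) : exists j, q = cons j.
  exists (q ord0, [ffun l => q (lift ord0 l)]); apply/ffunP => k.
  rewrite /cons ffunE; case: unliftP => [l|] -> //.
  by rewrite ffunE.
have mE j : lebesgue_rV n.+1 (rat_box_rV (cons j)) =
    (leb \x lebesgue_rV n)%E (rat_itv j.1 `*` rat_box_rV j.2).
  by rewrite -consE.
split.
- by move=> q; exact: measurable_rat_box_rV.
- move=> q; have [j ->] := consK q.
  by rewrite [X in (X < _)%E](mE j); exact: (fP j).
move=> f M K mf f0M K0 H.
have f0 x : 0 <= f x by case/andP: (f0M x).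
have mfr : measurable_fun setT (f \o @rVcons R n).
  exact: (measurableT_comp mf (@measurable_rVcons R n)).
apply: (HP (f \o @rVcons R n) M K mfr (fun x => f0M _) K0) => j.
have := H (cons j); rewrite [X in (_ <= _ * X)%E -> _](mE j).
rewrite [in X in (X <= _)%E -> _](ge0_integral_pushforward (@measurable_rVcons R n)).
- by rewrite consE.
- exact: measurable_rat_box_rV.
- by apply/measurable_EFinP; exact: measurable_funTS.
- by move=> x _; rewrite lee_fin.
Qed.

End determining_box.

Section boxes.
Context {R : realType} {n : nat}.
Local Notation leb := (@lebesgue_measure R).
Local Notation spacetime := ('rV[R]_n.+1 * R)%type.
Local Notation mspacetime := ('rV[R]_n.+1 * measurableTypeR R)%type.
Local Notation mu := (@spacetime_measure R n).
Local Notation index := (option 'I_n.+1).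

Definition box (a b : index -> R) : set mspacetime :=
  [set z | forall j, a j < coord z j < b j].

Lemma measurable_box a b : measurable (box a b).
Proof.
have -> : box a b = \bigcap_(j in [set: index])
  ((fun z : mspacetime => coord z j) @^-1` `]a j, b j[%classic).
  apply/seteqP; split => [z h j _|z h j]; first by rewrite /= in_itv/=; exact: h.
  by have := h j I; rewrite /= in_itv.
apply: fin_bigcap_measurable => // j _.
by rewrite -[X in measurable X]setTI; apply: measurable_coord => //; exact: measurable_itv.
Qed.

Lemma determining_spacetime (f : spacetime -> R) (M : R) :
  measurable_fun [set: mspacetime] f -> (forall z, `|f z| <= M) ->
  (forall a b, \int[mu]_(z in box a b) f z <= 0) ->
  mu [set z | 0 < f z] = 0%E.
Proof.
move=> mf fM H.
have [mP fP HP] := determining_prod (@determining_rV R n.+1) (@determining_line R).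
have M0 : 0 <= M by exact: le_trans (fM 0).
(* [determining] speaks of nonnegative functions, so [f] is raised by its bound [M], and the level 0
   becomes the level [M]. *)
have -> : [set z | 0 < f z] = [set z | M < f z + M].
  by apply/seteqP; split => z /=; rewrite ltrDr.
apply: (HP (fun z => f z + M) (M + M)) => //.
- exact: measurable_funD.
- move=> z; have := fM z; rewrite ler_norml => /andP[z1 z2].
  by apply/andP; split; lra.
move=> j.
have fin := fP j; have mj := mP j.
have fin' : (mu (rat_box_rV j.1 `*` rat_itv j.2)) \is a fin_num by rewrite ge0_fin_numE.
pose a (k : index) : R := if k is Some i then ratr (j.1 i).1 else ratr j.2.1.
pose b (k : index) : R := if k is Some i then ratr (j.1 i).2 else ratr j.2.2.
have boxE : rat_box_rV j.1 `*` rat_itv j.2 = box a b.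
  apply/seteqP; split => [z [h1 h2] [i|]|z h] /=.
  - by have := h1 i; rewrite /rat_itv /= in_itv.
  - by move: h2; rewrite /rat_itv /= in_itv.
  - split=> [i|]; first by rewrite /rat_itv /= in_itv/=; exact: (h (Some i)).
    by rewrite /rat_itv /= in_itv/=; exact: (h None).
have fi : mu.-integrable (rat_box_rV j.1 `*` rat_itv j.2) (EFin \o f).
  have ci : mu.-integrable (rat_box_rV j.1 `*` rat_itv j.2) (EFin \o cst M).
    apply/integrableP; split; first by apply/measurable_EFinP; exact: measurable_cst.
    by rewrite /= integral_cst// -ge0_fin_numE ?fin_numM//; rewrite mule_ge0.
  apply: (le_integrable _ _ _ ci) => //.
    by apply/measurable_EFinP; exact: measurable_funTS.
  by move=> z _ /=; rewrite lee_fin (le_trans (fM z))// ler_norm.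
have ci : mu.-integrable (rat_box_rV j.1 `*` rat_itv j.2) (EFin \o cst M).
  apply/integrableP; split; first by apply/measurable_EFinP; exact: measurable_cst.
  by rewrite /= integral_cst// -ge0_fin_numE ?fin_numM//; rewrite mule_ge0.
rewrite -(integral_cst mu mj) -[leRHS]add0e.
have -> : (\int[(lebesgue_rV n.+1 \x leb)%E]_(z in rat_box_rV j.1 `*` rat_itv j.2)
    (f z + M)%:E = \int[mu]_(z in rat_box_rV j.1 `*` rat_itv j.2) (EFin \o f) z +
    \int[mu]_(z in rat_box_rV j.1 `*` rat_itv j.2) (EFin \o cst M) z)%E.
  by rewrite -integralD.
rewrite leeD2r//.
rewrite -[leLHS]fineK; last exact: integrable_fin_num fi.
by rewrite lee_fin boxE; exact: H.
Qed.

End boxes.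

(** * Smooth approximation of box indicators *)

Section plateau.
Context {R : realType}.

(** For positive [k] it vanishes up to distance [1 / k] inside the endpoints and equals 1 from
    distance [2 / k] on, so that it converges to the indicator of the open interval. *)
Definition plateau (a b : R) (k : nat) (x : R) : R :=
  step (k%:R * (x - a) - 1) * step (k%:R * (b - x) - 1).

Lemma plateau_ge0 a b k x : 0 <= plateau a b k x.
Proof. by rewrite mulr_ge0// step_ge0. Qed.

Lemma plateau_le1 a b k x : plateau a b k x <= 1.
Proof. by rewrite mulr_ile1// ?step_ge0// step_le1. Qed.

Lemma plateau_out a b k x : ~~ (a < x < b) -> plateau a b k x = 0.
Proof.
rewrite negb_and -!leNgt => /orP[xa|bx]; rewrite /plateau.
  rewrite step_le0 ?mul0r// subr_le0 (le_trans (_ : _ <= 0))//.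
  by rewrite mulr_ge0_le0// subr_le0.
rewrite [X in _ * X]step_le0 ?mulr0// subr_le0 (le_trans (_ : _ <= 0))//.
by rewrite mulr_ge0_le0// subr_le0.
Qed.

Lemma ccsmooth_plateau a b k : ccsmooth (plateau a b k).
Proof.
split.
  apply: smooth1M.
    rewrite (_ : (fun _ => _) = fun x => step (k%:R * x + (- (k%:R * a) - 1))).
      exact/smooth1_affine/smooth1_step.
    by apply/funext => x; congr step; ring.
  rewrite (_ : (fun _ => _) = fun x => step (- k%:R * x + (k%:R * b - 1))).
    exact/smooth1_affine/smooth1_step.
  by apply/funext => x; congr step; ring.
exists (`|a| + `|b|) => x xab; apply: plateau_out; apply/negP => /andP[ax xb].
move: xab; apply/negP; rewrite -leNgt ler_norml.
have := ler_norm b; have := ler_norm (- a); rewrite normrN.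
have := normr_ge0 a; have := normr_ge0 b; move=> *.
by apply/andP; split; lra.
Qed.

Lemma cvg_plateau a b x :
  plateau a b k x @[k --> \oo] --> ((a < x < b)%R%:R : R).
Proof.
case: (boolP (a < x < b)) => [/andP[ax xb]|xab]; last first.
  by under eq_fun do rewrite plateau_out//; exact: cvg_cst.
apply: cvg_near_cst.
near=> k.
have k0 : 0 < k%:R :> R by rewrite ltr0n; near: k; exists 1%N.
have k1 : 2 / (x - a) <= k%:R by near: k; exact: nbhs_infty_ger.
have k2 : 2 / (b - x) <= k%:R by near: k; exact: nbhs_infty_ger.
rewrite ler_pdivrMr ?subr_gt0// in k1; rewrite ler_pdivrMr ?subr_gt0// in k2.
by rewrite /plateau !step_ge1 ?mulr1//; lra.
Unshelve. all: by end_near. Qed.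

End plateau.

Section tensor_null.
Context {R : realType} {n : nat}.
Local Notation leb := (@lebesgue_measure R).
Local Notation spacetime := ('rV[R]_n.+1 * R)%type.
Local Notation mspacetime := ('rV[R]_n.+1 * measurableTypeR R)%type.
Local Notation mu := (@spacetime_measure R n).
Local Notation index := (option 'I_n.+1).
Local Notation last_index := (@last_index n).
Variables (f : spacetime -> R) (M : R).
Hypotheses (mf : measurable_fun [set: mspacetime] f) (fM : forall z, `|f z| <= M).

(** Dominated convergence: the tensor products of plateaus tend to the indicator of the open box and
    are bounded by that of the closed box. *)
Lemma box_limit (a b : index -> R) :
  (forall k, \int[mu]_z (f z * tens (fun j => plateau (a j) (b j) k) z) <= 0) ->
  \int[mu]_(z in box a b) f z <= 0.
Proof.
move=> H; pose cl j : R -> R := \1_`[a j, b j].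
have ci j : leb.-integrable setT (EFin \o cl j) by exact: integrable_indic_itv.
pose F k (z : spacetime) := f z * tens (fun j => plateau (a j) (b j) k) z.
have pa k : admissible (fun j => plateau (a j) (b j) k).
  by move=> j; exact: ccsmooth_plateau.
have Fi k : mu.-integrable setT (EFin \o F k).
  by apply: (mul_tens_integrable mf fM) => j; exact: admissible_integrable (pa k).
have gi := integrable_norm (mul_tens_integrable mf fM ci).
have Fg k z : `|F k z| <= `|f z * tens cl z|.
  rewrite !normrM ler_wpM2l// !normr_tens; apply: ler_prod => j _.
  rewrite normr_ge0/= ger0_norm ?plateau_ge0// /cl indicE.
  case: (boolP (_ \in _)) => [_|/negP h]; first by rewrite normr1 plateau_le1.
  rewrite plateau_out ?normr0//; apply/negP => /andP[h1 h2]; apply: h.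
  by rewrite inE /= in_itv/= !ltW.
have lim z : F k z @[k --> \oo] --> (f \_ (box a b)) z.
  have -> : (f \_ (box a b)) z = f z * \prod_j ((a j < coord z j < b j)%R%:R : R).
    rewrite patchE; case: ifPn => [/set_mem h|/negP h].
      by rewrite big1 ?mulr1// => j _; rewrite h.
    have [j jh] : exists j, ~~ (a j < coord z j < b j).
      apply/not_existsP => h'; apply: h; rewrite inE => j.
      by have /negP := h' j; rewrite negbK.
    by rewrite (bigD1 j)//= (negbTE jh) mul0r mulr0.
  apply: cvgM; first exact: cvg_cst.
  by apply: (cvg_big (@mul_continuous R)) => j _; exact: cvg_plateau.
have [] := @dominated_convergence _ _ _ mu setT measurableT (fun k => EFin \o F k)
  (EFin \o (f \_ (box a b))) (abse \o (EFin \o (fun z => f z * tens cl z))).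
- by move=> k; exact: measurable_int (Fi k).
- apply/measurable_EFinP; apply/(measurable_restrictT f (measurable_box a b)).
  exact: measurable_funTS.
- by apply: aeW => z _; apply: cvg_EFin; [exact: nearW|exact: lim].
- exact: gi.
- by apply: aeW => z k _; rewrite /= lee_fin.
move=> _ _ cv; rewrite Rintegral_mkcond.
have E : (\int[mu]_z (EFin \o f \_ (box a b)) z <= 0)%E.
  apply: (cvge_le _ cv); apply: nearW => k.
  rewrite -[leLHS]fineK; last exact: integrable_fin_num (Fi k).
  by rewrite lee_fin; exact: H.
by rewrite /Rintegral fine_le0.
Qed.

Lemma tens_le0_null (half : bool) :
  (half -> forall z, coord z last_index <= 0 -> f z = 0) ->
  (forall c, admissible c -> nonneg_factors c ->
    (half -> forall x, x <= 0 -> c last_index x = 0) ->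
    \int[mu]_z (f z * tens c z) <= 0) ->
  mu [set z | 0 < f z] = 0%E.
Proof.
move=> f0 H; apply: determining_spacetime mf fM _ => a b.
(* The box is cut at the boundary, which loses nothing since [f] vanishes beyond it; the last
   plateau then vanishes on the negative side. *)
pose a' := if half then upd a last_index (Num.max (a last_index) 0) else a.
have -> : \int[mu]_(z in box a b) f z = \int[mu]_(z in box a' b) f z.
  rewrite [LHS]Rintegral_mkcond [RHS]Rintegral_mkcond; apply: eq_Rintegral => z _.
  rewrite !patchE /a'; case: half f0 {H a'} => // /(_ isT) f0.
  have [z0|z0] := leP (coord z last_index) 0; first by rewrite f0//; do 2!case: ifP.
  rewrite (_ : (z \in box a b) = (z \in box (upd a last_index (Num.max (a last_index) 0)) b))//.
  apply/idP/idP => /set_mem h; rewrite inE => j; have := h j; rewrite /upd;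
    by case: eqP => // ->; rewrite gt_max z0 andbT.
apply: box_limit => k; apply: H.
- by move=> j; exact: ccsmooth_plateau.
- by move=> j x; exact: plateau_ge0.
- move=> h x x0; apply: plateau_out; rewrite /a' h upd_same gt_max.
  by rewrite [0 < x]ltNge x0 andbF.
Qed.

End tensor_null.

(** * The Liouville theorem *)

Section liouville.
Context {R : realType} {n : nat}.
Local Notation leb := (@lebesgue_measure R).
Local Notation spacetime := ('rV[R]_n.+1 * R)%type.
Local Notation mspacetime := ('rV[R]_n.+1 * measurableTypeR R)%type.
Local Notation mu := (@spacetime_measure R n).
Local Notation index := (option 'I_n.+1).
Local Notation last_index := (@last_index n).
Variable half : bool.

Definition in_domain (z : spacetime) := half ==> (0 < coord z last_index).

Let p (x : R) := half ==> (0 < x).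
Let sg : R := half%:R.

Let mp : measurable_fun setT p.
Proof.
rewrite /p; case: half => /=; last exact: measurable_cst.
exact: measurable_fun_ltr.
Qed.

Let p_half (f : R -> R) : ccsmooth f ->
  \int[leb]_x (if p x then f x else 0) + sg * \int[leb]_x (if p x then f (- x) else 0)
  = \int[leb]_x f x.
Proof.
move=> cf; rewrite /p /sg; case: half => /=; last by rewrite mul0r addr0.
by rewrite mul1r; exact: (ccont_Rintegral_half (ccsmooth_ccont cf)).
Qed.

Let sg01 : 0 <= sg <= 1.
Proof. by rewrite /sg; case: half; rewrite ?lexx ?ler01. Qed.

(** For test factors supported on the domain the reflected half of [gap_bound] disappears. What is
    left says that [w - s] has nonpositive integral against each such product, where [s] is
    [S - d / K'], and [tens_le0_null] applies. *)
Lemma one_sided_gap (w G : spacetime -> R) (S K C d : R) :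
  measurable_fun [set: mspacetime] w -> measurable_fun [set: mspacetime] G ->
  0 <= S -> 0 <= C -> (forall z, `|w z| <= S) -> (forall z, `|G z| <= K) ->
  (forall z, ~~ in_domain z -> w z = 0) -> (forall z, ~~ in_domain z -> G z = 0) ->
  (forall z, in_domain z -> G z <= - d + C * (S - w z)) ->
  (forall z, in_domain z -> - G z <= - d + C * (S + w z)) ->
  weak_heat half%:R w G ->
  mu [set z | in_domain z /\ S - d / (C + 4 + 2 * #|{: index}|%:R) < w z] = 0%E.
Proof.
move=> mw mG S0 C0 wS GK w0 G0 Gle Gge wG.
have gap := gap_bound mp p_half sg01 mw mG S0 C0 wS GK w0 G0 Gle Gge wG.
set K' := C + 4 + 2 * _ in gap *.
have K'0 : 0 < K' by rewrite /K' ltr_wpDr ?mulr_ge0 ?ler0n// ltr_wpDl.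
set s := S - d / K'.
pose f z := w z - s * (in_domain z)%:R.
have -> : [set z | in_domain z /\ s < w z] = [set z | 0 < f z].
  apply/seteqP; split => z /=; rewrite /f.
    by move=> [-> sw]; rewrite mulr1 subr_gt0.
  case: (boolP (in_domain z)) => h; first by rewrite mulr1 subr_gt0.
  by rewrite w0// mulr0 subr0 ltxx.
have mQ : measurable_fun [set: mspacetime] (fun z => (in_domain z)%:R : R).
  rewrite (_ : (fun _ => _) = fun z => if in_domain z then 1 else 0 : R).
    apply: measurable_fun_ifT => //.
    exact: (measurableT_comp mp (measurable_coord last_index)).
  by apply/funext => z; case: (in_domain _).
have mf : measurable_fun [set: mspacetime] f.
  by apply: measurable_funB => //; exact: measurable_funM.
have fM z : `|f z| <= S + `|s|.
  rewrite (le_trans (ler_normB _ _))// lerD// normrM ler_piMr//.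
  by case: (in_domain z); rewrite ?normr1 ?normr0.
apply: (@tens_le0_null _ _ f _ mf fM half).
  move=> h z z0; rewrite /f w0 /in_domain ?h/= -?leNgt//.
  by rewrite ltNge z0 mulr0 subr0.
move=> c ca cp cs.
have Q1 z : (in_domain z)%:R * tens c z = tens c z.
  case: (boolP (in_domain z)) => h; first by rewrite mul1r.
  rewrite mul0r (tens_bigD1 c last_index).
  move: h; rewrite /in_domain negb_imply -leNgt => /andP[hf z0].
  by rewrite cs// mul0r.
have ci j : leb.-integrable setT (EFin \o c j) by exact: admissible_integrable.
have [It Et] := tens_integrable ci.
have Iw := mul_tens_integrable mw wS ci.
have gapc := gap c ca cp; rewrite -Et in gapc.
(* Off the domain the integrand vanishes with [w] and the indicator; on the half-space the reflected
   last factor is evaluated at negative arguments, where [c] is 0; on the whole space [sg] is 0. *)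
have E2 : \int[mu]_z (sg * (S * (p (coord z last_index))%:R + w z) *
    tens (reflect_last c) z) = 0.
  transitivity (\int[mu]_(z in [set: mspacetime]) (0 : R)); last first.
    by rewrite /Rintegral integral0.
  apply: eq_Rintegral => z _.
  case: (boolP (in_domain z)) => h; last first.
    by rewrite w0// /p -/(in_domain z) (negbTE h) mulr0 addr0 mulr0 mul0r.
  move: h; rewrite /in_domain /sg; case: half cs => /= cs; last by rewrite !mul0r.
  move=> z0; rewrite (tens_bigD1 _ last_index) /reflect_last upd_same cs ?mul0r ?mulr0//.
  by rewrite oppr_le0 ltW.
have E1 : \int[mu]_z ((S * (p (coord z last_index))%:R - w z) * tens c z) =
    S * \int[mu]_z tens c z - \int[mu]_z (w z * tens c z).
  rewrite -RintegralZl// -RintegralB//; last by have := integrableZl measurableT S It.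
  by apply: eq_Rintegral => z _; rewrite mulrBl -mulrA; congr (_ * _ - _); exact: Q1.
rewrite /pairing E2 addr0 E1 in gapc.
rewrite (_ : \int[mu]_z (f z * tens c z) = \int[mu]_z (w z * tens c z) - s * \int[mu]_z tens c z).
  move: gapc; set T := \int[mu]_z tens c z; set W := \int[mu]_z _ => gapc.
  have : d / K' * T <= S * T - W by rewrite mulrAC ler_pdivrMr// [leRHS]mulrC.
  by rewrite /s mulrBl; lra.
rewrite -RintegralZl// -RintegralB//; last by have := integrableZl measurableT s It.
by apply: eq_Rintegral => z _; rewrite /f mulrBl -mulrA Q1.
Qed.

(** The infimum of the almost everywhere bounds is again one, as a countable union of the null sets
    for [inf A + 1 / (k + 1)]. *)
Lemma ae_le_sup (w : spacetime -> R) (M : R) :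
  measurable_fun [set: mspacetime] w -> (forall z, `|w z| <= M) ->
  exists S, [/\ 0 <= S, mu [set z | S < `|w z|] = 0%E &
    forall s, 0 <= s -> mu [set z | s < `|w z|] = 0%E -> S <= s].
Proof.
move=> mw wM; pose A := [set s : R | 0 <= s /\ mu [set z | s < `|w z|] = 0%E].
have mA s : measurable [set z : mspacetime | s < `|w z|].
  have mnw : measurable_fun [set: mspacetime] (fun z => `|w z|) by exact: measurableT_comp.
  rewrite -[X in measurable X]setTI.
  have := mnw; move=> /(_ measurableT `]s, +oo[%classic (measurable_itv _)).
  rewrite (_ : _ @^-1` _ = [set z | s < `|w z|])//.
  by apply/seteqP; split => z /=; rewrite in_itv/= andbT.
have M0 : 0 <= M by exact: le_trans (wM 0).
have AM : A M.
  split => //; rewrite (_ : [set z | _] = set0) ?measure0//.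
  by apply/seteqP; split => z //=; rewrite ltNge wM.
have hA : has_inf A by split; [exists M|exists 0 => s []].
have S0 : 0 <= inf A by apply: lb_le_inf; [exists M|move=> s []].
exists (inf A); split => //; last first.
  by move=> s s0 ms; apply: ge_inf; [exact: hA.2|split].
have Ak (k : nat) : mu [set z | inf A + k.+1%:R^-1 < `|w z|] = 0%E.
  have k0 : 0 < k.+1%:R^-1 :> R by rewrite invr_gt0.
  have [s [s0 ms] sk] := inf_adherent k0 hA.
  apply/eqP; rewrite eq_le measure_ge0 andbT -ms.
  by apply: le_measure; rewrite ?inE// => z /=; apply: lt_trans.
apply/(negligibleP _ (mA _)).
rewrite (_ : [set z | inf A < `|w z|] =
  \bigcup_k [set z | inf A + k.+1%:R^-1 < `|w z|]); last first.
  apply/seteqP; split => z /=.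
    by move=> Aw; have [k kP] := ltr_add_invr Aw; exists k.
  by move=> [k _ /=]; apply: lt_trans; rewrite ltrDl.
by apply: negligible_bigcup => k; apply/(negligibleP _ (mA _)); exact: Ak.
Qed.

Lemma admissible_fold (s : R) (c : index -> R -> R) : admissible c -> admissible (fold_last s c).
Proof.
move=> ca; apply: admissible_upd => //; apply: ccsmoothB => //.
exact/ccsmoothZ/ccsmoothN.
Qed.

Theorem liouville_heat (w G : spacetime -> R) (M K : R) :
  measurable_fun [set: mspacetime] w -> measurable_fun [set: mspacetime] G ->
  (forall z, `|w z| <= M) -> (forall z, `|G z| <= K) ->
  (forall z, ~~ in_domain z -> w z = 0) -> (forall z, ~~ in_domain z -> G z = 0) ->
  (forall s, 0 < s -> exists2 d, 0 < d &
    forall z, in_domain z -> (s <= w z -> G z <= - d) /\ (w z <= - s -> d <= G z)) ->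
  weak_heat half%:R w G ->
  mu [set z | w z != 0] = 0%E.
Proof.
move=> mw mG wM GK w0 G0 sgn wG.
have [S [S0 mS minS]] := ae_le_sup mw wM.
have [S_gt0|] := ltP 0 S; last first.
  move=> S_le0; have {}S0 : S = 0 by apply/eqP; rewrite eq_le S_le0.
  by rewrite -mS S0; congr (mu _); apply/seteqP; split => z /=; rewrite normr_gt0.
exfalso.
have mgt (f : spacetime -> R) s : measurable_fun [set: mspacetime] f ->
    measurable [set z : mspacetime | s < f z].
  move=> mf; rewrite -[X in measurable X]setTI.
  have := mf; move=> /(_ measurableT `]s, +oo[%classic (measurable_itv _)).
  rewrite (_ : _ @^-1` _ = [set z | s < f z])//.
  by apply/seteqP; split => z /=; rewrite in_itv/= andbT.
have mnw : measurable_fun [set: mspacetime] (fun z => `|w z|) by exact: measurableT_comp.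
(* The gap estimate asks for [|w| <= S] at every point, so [w] and [G] are set to 0 on the null set
   where this fails; no integral changes. *)
pose good z := `|w z| <= S.
have mgood : measurable_fun [set: mspacetime] (good : mspacetime -> bool).
  exact: measurable_fun_ler.
pose w1 z := if good z then w z else 0.
pose G1 z := if good z then G z else 0.
have mw1 : measurable_fun [set: mspacetime] w1 by exact: measurable_fun_ifT.
have mG1 : measurable_fun [set: mspacetime] G1 by exact: measurable_fun_ifT.
have K0 : 0 <= K by exact: le_trans (GK 0).
have wS1 z : `|w1 z| <= S by rewrite /w1; case: ifP => //; rewrite normr0.
have GK1 z : `|G1 z| <= K by rewrite /G1; case: ifP => //; rewrite normr0.
have w01 z : ~~ in_domain z -> w1 z = 0 by move=> /w0; rewrite /w1; case: ifP.
have G01 z : ~~ in_domain z -> G1 z = 0 by move=> /G0; rewrite /G1; case: ifP.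
(* Where w < S / 2 the bound |G| <= K is absorbed by C (S - w), as C S / 2 = K + d. *)
have [d d0 dP] := sgn (S / 2) (divr_gt0 S_gt0 (ltr0Sn R 1)).
pose C := 2 * (K + d) / S.
have C0 : 0 <= C by rewrite divr_ge0// mulr_ge0// addr_ge0// ltW.
have CS : C * (S / 2) = K + d by rewrite /C; field; rewrite gt_eqF.
have aeint (f f1 : spacetime -> R) (c : index -> R -> R) : measurable_fun [set: mspacetime] f ->
    measurable_fun [set: mspacetime] f1 -> (forall z, good z -> f1 z = f z) ->
    admissible c -> \int[mu]_z (f1 z * tens c z) = \int[mu]_z (f z * tens c z).
  move=> mf mf1 f1f ca.
  have mt : measurable_fun [set: mspacetime] (tens c).
    by apply: measurable_tens => j; exact: ccont_measurable (ccsmooth_ccont (ca j)).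
  rewrite /Rintegral; congr fine; apply: ae_eq_integral => //.
  - by apply/measurable_EFinP; exact: measurable_funM.
  - by apply/measurable_EFinP; exact: measurable_funM.
  exists [set z | S < `|w z|]; split => //; first exact: mgt.
  move=> z /= H; rewrite ltNge; apply/negP => h; apply: H => _.
  by rewrite f1f.
have wG1 : weak_heat half%:R w1 G1.
  move=> c ca; have ca' := admissible_fold half%:R ca; apply: etrans (wG c ca).
  congr (_ + _ + _).
  - apply: aeint => //; first by move=> z h; rewrite /w1 h.
    by apply: admissible_upd => //; exact: ccsmooth_derive1.
  - apply: eq_bigr => j _; apply: aeint => //; first by move=> z h; rewrite /w1 h.
    by apply: admissible_upd => //; do 2! apply: ccsmooth_derive1.
  - by apply: aeint => // z h; rewrite /G1 h.
have Gle1 z : in_domain z -> G1 z <= - d + C * (S - w1 z).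
  move=> zQ; have [H1 _] := dP z zQ; rewrite /G1 /w1.
  case: (boolP (good z)) => [gz|_]; last by rewrite subr0; move: CS d0 K0; nra.
  have wS : w z <= S by rewrite (le_trans (ler_norm _)).
  have [h|h] := leP (S / 2) (w z).
    by rewrite (le_trans (H1 h))// lerDl mulr_ge0// subr_ge0.
  have GK' : G z <= K by rewrite (le_trans (ler_norm _)).
  have : C * (S / 2) <= C * (S - w z) by rewrite ler_wpM2l//; lra.
  by rewrite CS; lra.
have Gge1 z : in_domain z -> - G1 z <= - d + C * (S + w1 z).
  move=> zQ; have [_ H1] := dP z zQ; rewrite /G1 /w1.
  case: (boolP (good z)) => [gz|_]; last by rewrite addr0; move: CS d0 K0; nra.
  have wS : - w z <= S by rewrite (le_trans (ler_norm _))// normrN.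
  have [h|h] := leP (w z) (- (S / 2)).
    have : 0 <= C * (S + w z) by rewrite mulr_ge0//; lra.
    by have := H1 h; lra.
  have GK' : - G z <= K by rewrite (le_trans (ler_norm _))// normrN.
  have : C * (S / 2) <= C * (S + w z) by rewrite ler_wpM2l//; lra.
  by rewrite CS; lra.
set K' := C + 4 + 2 * #|{: index}|%:R.
have K'0 : 0 < K' by rewrite /K' ltr_wpDr ?mulr_ge0 ?ler0n// ltr_wpDl.
have H1 := one_sided_gap mw1 mG1 S0 C0 wS1 GK1 w01 G01 Gle1 Gge1 wG1.
have intN (f : spacetime -> R) (c : index -> R -> R) (B : R) : measurable_fun [set: mspacetime] f ->
    (forall z, `|f z| <= B) -> admissible c ->
    \int[mu]_z (- f z * tens c z) = - \int[mu]_z (f z * tens c z).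
  move=> mf fB ca; rewrite -mulN1r -RintegralZl//; last first.
    by apply: (mul_tens_integrable mf fB) => j; exact: admissible_integrable.
  by apply: eq_Rintegral => z _; rewrite mulN1r mulNr.
have H2 : mu [set z | in_domain z /\ S - d / K' < - w1 z] = 0%E.
  apply: (@one_sided_gap (fun z => - w1 z) (fun z => - G1 z) S K C d) => //.
  - exact: measurableT_comp.
  - exact: measurableT_comp.
  - by move=> z; rewrite normrN.
  - by move=> z; rewrite normrN.
  - by move=> z /w01 ->; rewrite oppr0.
  - by move=> z /G01 ->; rewrite oppr0.
  - by move=> z /Gge1; rewrite opprK.
  - by move=> z /Gle1; rewrite opprK.
  move=> c ca; have ca' := admissible_fold half%:R ca.
  rewrite (intN _ _ _ mw1 wS1); last first.
    by apply: admissible_upd => //; exact: ccsmooth_derive1.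
  rewrite (intN _ _ _ mG1 GK1)//.
  rewrite (eq_bigr (fun j => - \int[mu]_z (w1 z *
    tens (upd (fold_last half%:R c) j (derive1 (derive1 (fold_last half%:R c j)))) z))).
    by rewrite sumrN -!opprD (wG1 c ca) oppr0.
  move=> j _; apply: (intN _ _ _ mw1 wS1); apply: admissible_upd => //.
  by do 2! apply: ccsmooth_derive1.
(* Minimality of [S] is available only against nonnegative bounds, hence the maximum with 0; [S > 0]
   keeps [s] below [S]. *)
pose s := Num.max 0 (S - d / K').
have sS : s < S by rewrite /s gt_max S_gt0/= gtrBl divr_gt0.
move: sS; apply/negP; rewrite -leNgt; apply: minS; first by rewrite le_max lexx.
apply/negligibleP; first exact: mgt.
have mD : measurable [set z : mspacetime | in_domain z].
  rewrite -[X in measurable X]setTI.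
  have mdom : measurable_fun [set: mspacetime] (in_domain : mspacetime -> bool).
    exact: (measurableT_comp mp (measurable_coord last_index)).
  have := mdom; move=> /(_ measurableT [set true] _).
  rewrite (_ : _ @^-1` _ = [set z | in_domain z])//; apply.
  by [].
have N1 : mu.-negligible [set z | in_domain z /\ S - d / K' < w1 z].
  by apply/negligibleP => //; apply: measurableI => //; exact: mgt.
have N2 : mu.-negligible [set z | in_domain z /\ S - d / K' < - w1 z].
  apply/negligibleP => //; apply: measurableI => //; apply: (mgt (fun z => - w1 z)).
  exact: measurableT_comp.
have N3 : mu.-negligible [set z | S < `|w z|] by apply/negligibleP => //; exact: mgt.
apply: negligibleS (negligibleU N3 (negligibleU N1 N2)) => z /=.
rewrite gt_max => /andP[w0z sw].
have [h|h] := ltP S `|w z|; [by left|right].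
have gz : good z by [].
have zQ : in_domain z by apply: contraTT w0z => /w0 ->; rewrite normr0 ltxx.
rewrite /w1 gz; move: sw.
have [w_0|w_0] := leP 0 (w z); first by rewrite ger0_norm// => ?; left.
by rewrite ltr0_norm// => ?; right.
Qed.

End liouville.

(** * Tensor products as test functions *)

Section tensor_calculus.
Context {R : realType} {n : nat}.
Local Notation spacetime := ('rV[R]_n.+1 * R)%type.
Local Notation index := (option 'I_n.+1).
Implicit Types c : index -> R -> R.

Definition basis (j : index) : spacetime := if j is Some i then dx i else dt.

Lemma coordD (j : index) (h : R) (v z : spacetime) :
  coord (h *: v + z) j = h * coord v j + coord z j.
Proof. by case: j => [i|] /=; rewrite ?mxE. Qed.

Lemma coord_basis (i j : index) : coord (basis i) j = (i == j)%:R.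
Proof.
case: i j => [i|] [j|] //=.
- by rewrite mxE eqxx (inj_eq Some_inj) eq_sym.
- by rewrite mxE.
Qed.

Lemma differentiable_coord_spacetime j (z : spacetime) :
  differentiable (fun z => coord z j) z.
Proof.
case: j => [i|] /=; last exact: (linear_differentiable (f := snd) _ (fun z => cvg_snd)).
have d1 : differentiable (fst : spacetime -> _) z.
  exact: (linear_differentiable (f := fst) _ (fun z => cvg_fst)).
exact: (differentiable_comp d1 (differentiable_coord z.1 ord0 i)).
Qed.

Lemma coord_continuous_spacetime j : continuous (fun z : spacetime => coord z j).
Proof.
by move=> z; apply: differentiable_continuous; exact: differentiable_coord_spacetime.
Qed.

Lemma derive_coord j (v z : spacetime) : 'D_v (fun z => coord z j) z = coord v j.
Proof.
apply: cvg_lim => //; apply: cvg_near_cst; near=> h.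
have h0 : h != 0 by near: h; exact: nbhs_dnbhs_neq.
rewrite /= coordD addrK /GRing.scale/= mulKf//.
Unshelve. all: by end_near. Qed.

(* Closed under directional derivatives, which gives the differentiability of
   all iterated derivatives. *)
Inductive smooth_expr : (spacetime -> R) -> Prop :=
| SE_cst a : smooth_expr (fun=> a)
| SE_coord j f : smooth1 f -> smooth_expr (fun z => f (coord z j))
| SE_add f g : smooth_expr f -> smooth_expr g -> smooth_expr (fun z => f z + g z)
| SE_mul f g : smooth_expr f -> smooth_expr g -> smooth_expr (fun z => f z * g z).

Lemma smooth_expr_differentiable f z : smooth_expr f -> differentiable f z.
Proof.
elim=> [a|j g sg|{}f g _ df _ dg|{}f g _ df _ dg].
- exact: differentiable_cst.
- apply: (@differentiable_comp _ _ _ _ (fun z => coord z j) g).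
    exact: differentiable_coord_spacetime.
  by apply/derivable1_diffP; case: (smooth1_is_derive (coord z j) sg).
- exact: differentiableD.
- exact: differentiableM.
Qed.

Lemma smooth_expr_derive f v : smooth_expr f -> smooth_expr (fun z => 'D_v f z).
Proof.
elim=> [a|j g sg|{}f g sf df sg dg|{}f g sf df sg dg].
- have -> : (fun z => 'D_v (fun=> a) z) = fun=> 0 :> R.
    by apply/funext => z; exact: derive_cst.
  exact: SE_cst.
- rewrite [X in smooth_expr X](_ : _ = fun z => coord v j * derive1 g (coord z j)).
    by apply: SE_mul; [exact: SE_cst|apply: SE_coord; exact: smooth1_derive1].
  apply/funext => z.
  have dc := differentiable_coord_spacetime j z.
  have dg : differentiable g (coord z j).
    by apply/derivable1_diffP; case: (smooth1_is_derive (coord z j) sg).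
  rewrite deriveE; last exact: (differentiable_comp dc dg).
  rewrite (diff_comp dc dg) /= diff1E// -deriveE// derive_coord.
  by [].
- rewrite [X in smooth_expr X](_ : _ = fun z => 'D_v f z + 'D_v g z); first exact: SE_add.
  apply/funext => z; apply: deriveD; apply: diff_derivable;
    exact: smooth_expr_differentiable.
- rewrite [X in smooth_expr X](_ : _ = fun z => f z * 'D_v g z + g z * 'D_v f z).
    by apply: SE_add; exact: SE_mul.
  apply/funext => z; apply: deriveM; apply: diff_derivable;
    exact: smooth_expr_differentiable.
Qed.

Lemma smooth_expr_smooth f : smooth_expr f -> smooth f.
Proof.
move=> sf vs z; apply: smooth_expr_differentiable.
by elim: vs => [//|v vs IH] /=; exact: smooth_expr_derive.
Qed.

Lemma smooth_tens c : (forall j, smooth1 (c j)) -> smooth (tens c).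
Proof.
move=> sc; apply: smooth_expr_smooth.
rewrite (_ : tens c = fun z => \prod_(j <- index_enum index) c j (coord z j))//.
elim: (index_enum _) => [|j s IH].
  by under eq_fun do rewrite big_nil; exact: SE_cst.
by under eq_fun do rewrite big_cons; apply: SE_mul => //; exact: SE_coord.
Qed.

(** Along [basis j] only the factor [j] moves, so the difference quotient of the product is that of
    one factor times the constant [P]. *)
Lemma derive_tens c j : smooth1 (c j) ->
  (fun z => 'D_(basis j) (tens c) z) = tens (upd c j (derive1 (c j))).
Proof.
move=> sc; apply/funext => z; apply: cvg_lim => //.
rewrite tens_upd mulrC; set P := \prod_(i | i != j) _.
rewrite [X in X @ _ --> _](_ : _ = fun h : R => P *
    (h^-1 *: ((c j \o shift (coord z j)) (h *: (1 : R)) - c j (coord z j)))).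
  apply: cvgM; first exact: cvg_cst.
  by have [d _] := smooth1_is_derive (coord z j) sc; rewrite derive1E; exact: d.
apply/funext => h /=.
rewrite (tens_bigD1 _ j) coordD coord_basis eqxx mulr1 (tens_bigD1 c j z).
rewrite (_ : \prod_(i | i != j) c i (coord (h *: basis j + z) i) = P).
  by rewrite /GRing.scale/= mulr1 -mulrBl -/P; ring.
apply: eq_bigr => i ij; rewrite coordD coord_basis eq_sym (negbTE ij).
by rewrite mulr0 add0r.
Qed.

Lemma iter_derive_tens1 c j : smooth1 (c j) ->
  iter_derive [:: basis j] (tens c) = tens (upd c j (derive1 (c j))).
Proof. exact: derive_tens. Qed.

Lemma iter_derive_tens2 c j : smooth1 (c j) ->
  iter_derive [:: basis j; basis j] (tens c) =
  tens (upd c j (derive1 (derive1 (c j)))).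
Proof.
move=> sc; rewrite /= derive_tens// derive_tens ?upd_same ?upd_upd//.
exact: smooth1_derive1.
Qed.

Definition closed_box (a b : index -> R) : set spacetime :=
  [set z | forall j, a j <= coord z j <= b j].

Lemma compact_closed_box a b : compact (closed_box a b).
Proof.
rewrite (_ : closed_box a b =
  [set x : 'rV[R]_n.+1 | forall i, `[a (Some i), b (Some i)]%classic (x ord0 i)] `*`
  `[a None, b None]%classic).
  apply: compact_setX; last exact: segment_compact.
  by apply: (rV_compact (A := fun i => `[a (Some i), b (Some i)]%classic)) => i;
    exact: segment_compact.
apply/seteqP; split => [z h|z [h1 h2] [i|]].
- by split=> [i|]; rewrite /= in_itv/=; [exact: (h (Some i))|exact: (h None)].
- by have := h1 i; rewrite /= in_itv.
- by move: h2; rewrite /= in_itv.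
Qed.

End tensor_calculus.

(** * The equation tested with tensor products *)

Section weak_form.
Context {R : realType} {n : nat}.
Local Notation leb := (@lebesgue_measure R).
Local Notation spacetime := ('rV[R]_n.+1 * R)%type.
Local Notation mspacetime := ('rV[R]_n.+1 * measurableTypeR R)%type.
Local Notation mu := (@spacetime_measure R n).
Local Notation index := (option 'I_n.+1).
Local Notation last_index := (@last_index n).
Implicit Types c : index -> R -> R.

Definition dom (half : bool) : set spacetime := [set z | in_domain half z].

(** The margin [e] keeps the support at positive distance from the boundary, which makes it a
    compact subset of the open half-space. *)
Definition test_factors (half : bool) c := admissible c /\
  (half -> exists2 e : R, 0 < e & forall x, x <= e -> c last_index x = 0).

Lemma measurable_closed_box (a b : index -> R) :
  measurable (closed_box a b : set mspacetime).
Proof.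
have -> : closed_box a b = \bigcap_(j in [set: index])
  ((fun z : mspacetime => coord z j) @^-1` `[a j, b j]%classic).
  apply/seteqP; split => [z h j _|z h j]; first by rewrite /= in_itv/=; exact: h.
  by have := h j I; rewrite /= in_itv.
apply: fin_bigcap_measurable => // j _.
by rewrite -[X in measurable X]setTI; apply: measurable_coord => //; exact: measurable_itv.
Qed.

Lemma measurable_dom half : measurable (dom half : set mspacetime).
Proof.
rewrite /dom /in_domain; case: half => /=.
  rewrite -[X in measurable X]setTI.
  have := @measurable_coord R _ last_index.
  move=> /(_ measurableT `]0, +oo[%classic (measurable_itv _)).
  rewrite (_ : _ @^-1` _ = [set z : spacetime | 0 < coord z last_index])//.
  by apply/seteqP; split => z /=; rewrite in_itv/= andbT.
rewrite (_ : [set z | _] = setT)//.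
by apply/seteqP.
Qed.

Lemma derive1_eq0_lt (f : R -> R) (e x : R) : (forall y, y <= e -> f y = 0) -> x < e ->
  derive1 f x = 0.
Proof.
move=> fe xe; apply: is_derive_derive1.
apply: near_eq_is_derive (is_derive_cst (0 : R) x (1 : R)).
near=> y; apply/esym/fe; apply: ltW; near: y; exact: lt_nbhsl.
Unshelve. all: by end_near. Qed.

Lemma test_factors_derive half c j : test_factors half c ->
  test_factors half (upd c j (derive1 (c j))).
Proof.
move=> [ca ce]; split; first by apply: admissible_upd => //; exact: ccsmooth_derive1.
(* The derivative is known to vanish only strictly below [e], hence a smaller margin. *)
move=> h; have [e e0 ec] := ce h; exists (e / 2); first by rewrite divr_gt0.
move=> x xe; have xe' : x < e by lra.
rewrite /upd; case: eqP => [<-|_]; last by rewrite ec// ltW.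
exact: (derive1_eq0_lt ec).
Qed.

Lemma test_factors_box half c : test_factors half c -> exists a b,
  closed_box a b `<=` dom half /\ forall z, ~ closed_box a b z -> tens c z = 0.
Proof.
move=> [ca ce].
have /boolp.choice[L LP] : forall j, exists L : R, 0 < L /\
    forall x, ~ (- L <= x <= L) -> c j x = 0.
  by move=> j; have [L ? ?] := ccont_supp (ccsmooth_ccont (ca j)); exists L.
have out (a b : index -> R) : (forall j x, ~ (a j <= x <= b j) -> c j x = 0) ->
    forall z, ~ closed_box a b z -> tens c z = 0.
  move=> H z zK; have [j jz] : exists j, ~ (a j <= coord z j <= b j).
    by apply/not_existsP => H'; apply: zK => j; apply: contrapT; exact: H'.
  by rewrite (tens_bigD1 c j) H// mul0r.
case: half ce => ce; last first.
  exists (fun j => - L j), L; split; first by move=> z _.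
  by apply: out => j; have [] := LP j.
have [e e0 ec] := ce isT.
exists (upd (fun j => - L j) last_index e), L; split.
  move=> z /(_ last_index); rewrite upd_same => /andP[ez _].
  by rewrite /dom /in_domain /=; exact: lt_le_trans ez.
apply: out => j x; rewrite /upd; case: eqP => [->|_]; last by have [_] := LP j; exact.
move=> ex; have [xe|xe] := leP x e; first exact: ec.
have [L0] := LP last_index; apply; move=> /andP[h1 h2]; apply: ex.
by rewrite ltW.
Qed.

Lemma test_function_tens half c : test_factors half c ->
  test_function (dom half) (tens c).
Proof.
move=> tc; split; first by apply: smooth_tens => j; case: (tc.1 j).
have [a [b [abQ ab0]]] := test_factors_box tc.
by exists (closed_box a b); split => //; exact: compact_closed_box.
Qed.

Lemma Lloc_integrable half c (f : spacetime -> R) :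
  test_factors half c -> Lloc 1 (dom half) f ->
  mu.-integrable setT (EFin \o (fun z => (f \_ (dom half)) z * tens c z)).
Proof.
move=> tc [mf If]; have [a [b [abQ ab0]]] := test_factors_box tc.
have mK := measurable_closed_box a b.
have mfK : measurable_fun (closed_box a b : set mspacetime) f.
  by apply: measurable_funS mf => //; exact: measurable_dom.
have IK : mu.-integrable (closed_box a b) (EFin \o f).
  have := If _ (@compact_closed_box _ _ a b) abQ.
  apply: le_integrable => //; first exact/measurable_EFinP.
  by move=> z _ /=; rewrite lee_fin powRr1// normr_id.
have mt : measurable_fun [set: mspacetime] (tens c).
  by apply: measurable_tens => j; exact: ccont_measurable (ccsmooth_ccont (tc.1 j)).
have /boolp.choice[B BP] : forall j, exists B : R, 0 <= B /\ forall x, `|c j x| <= B.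
  by move=> j; have [B ? ?] := ccont_bounded (ccsmooth_ccont (tc.1 j)); exists B.
have tB z : `|tens c z| <= \prod_j B j.
  by rewrite normr_tens; apply: ler_prod => j _; rewrite normr_ge0; have [_] := BP j; exact.
have IKt : mu.-integrable (closed_box a b) ((EFin \o f) \* (EFin \o tens c))%E.
  apply: integrableMl => //; first exact: measurable_funTS.
  exists (\prod_j B j); split; first exact: num_real.
  by move=> x Bx z _; apply: (le_trans (tB z)); exact: ltW.
rewrite (_ : EFin \o _ = ((EFin \o f) \* (EFin \o tens c))%E \_ (closed_box a b)).
  exact: (integrable_mkcond _ mK).1.
apply/funext => z; rewrite /= !patchE.
case: ifPn => [/set_mem zQ|zQ]; case: ifPn => [/set_mem zK|/negP zK] //.
- by rewrite ab0 ?mulr0// => /mem_set.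
- by move: zQ; rewrite mem_set//; exact: abQ.
- by rewrite mul0r.
Qed.

Lemma sum_option_index (F : index -> R) :
  \sum_(j | j != None) F j = \sum_i F (Some i).
Proof.
rewrite (reindex_omap Some id) => [|[i|]]//=.
by apply: eq_bigl => i; rewrite eqxx.
Qed.

Lemma Rintegral_sum (I : Type) (s : seq I) (f : I -> spacetime -> R) :
  (forall i, mu.-integrable setT (EFin \o f i)) ->
  mu.-integrable setT (EFin \o (fun z => \sum_(i <- s) f i z)) /\
  \int[mu]_z (\sum_(i <- s) f i z) = \sum_(i <- s) \int[mu]_z f i z.
Proof.
move=> fi; elim: s => [|i s [IH1 IH2]].
  have -> : (fun z : spacetime => \sum_(i <- [::]) f i z) = cst 0.
    by apply/funext => z; rewrite big_nil.
  rewrite big_nil; split; first exact: integrable0.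
  by rewrite /Rintegral integral0.
have -> : (fun z : spacetime => \sum_(j <- i :: s) f j z) =
    fun z => f i z + \sum_(j <- s) f j z.
  by apply/funext => z; rewrite big_cons.
split; first by have := integrableD measurableT (fi i) IH1.
by rewrite big_cons RintegralD// IH2.
Qed.

(** [H] is [ft - \sum_i fxx i] itself and not [F]: the weak derivatives come with measurability and
    local integrability, whereas [F] is only known to agree with their combination almost
    everywhere. *)
Lemma heat_eq_weak half (u F : spacetime -> R) : heat_eq (dom half) u F ->
  exists H : spacetime -> R, [/\ measurable_fun (dom half : set mspacetime) H,
    {ae mu, forall z, dom half z -> H z = F z},
    (forall c, test_factors half c ->
      mu.-integrable setT (EFin \o (fun z => (H \_ (dom half)) z * tens c z))) &
    forall c, test_factors half c ->
    \int[mu]_z ((u \_ (dom half)) z * tens (upd c None (derive1 (c None))) z) +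
    \sum_(j | j != None) \int[mu]_z
      ((u \_ (dom half)) z * tens (upd c j (derive1 (derive1 (c j)))) z) +
    \int[mu]_z ((H \_ (dom half)) z * tens c z) = 0].
Proof.
move=> [ft [fxx [ut uxx FE]]].
have It c : test_factors half c ->
    mu.-integrable setT (EFin \o (fun z => (ft \_ (dom half)) z * tens c z)).
  by move=> tc; apply: Lloc_integrable => //; case: ut.
have Ix c i : test_factors half c ->
    mu.-integrable setT (EFin \o (fun z => (fxx i \_ (dom half)) z * tens c z)).
  by move=> tc; apply: Lloc_integrable => //; case: (uxx i).
have HE c z : ((fun z => ft z - \sum_i fxx i z) \_ (dom half)) z * tens c z =
    (ft \_ (dom half)) z * tens c z - \sum_i ((fxx i \_ (dom half)) z * tens c z).
  rewrite patchE; case: ifPn => zQ.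
    rewrite patchE zQ mulrBl mulr_suml; congr (_ - _).
    by apply: eq_bigr => i _; rewrite patchE zQ.
  rewrite patchE (negbTE zQ) mul0r big1 ?subr0// => i _.
  by rewrite patchE (negbTE zQ) mul0r.
exists (fun z => ft z - \sum_i fxx i z); split => //.
- apply: measurable_funB; first by case: ut => _ [].
  by apply: measurable_sum => i; case: (uxx i) => _ [].
- move=> c tc; rewrite (funext (HE c)).
  have [Is _] := Rintegral_sum (index_enum 'I_n.+1) (fun i => Ix c i tc).
  by have := integrableB measurableT (It c tc) Is.
move=> c tc; have tf := test_function_tens tc.
have sc j : smooth1 (c j) by case: (tc.1 j).
have dI (f g : spacetime -> R) : \int[mu]_(z in dom half) (f z * g z) =
    \int[mu]_z ((f \_ (dom half)) z * g z).
  rewrite Rintegral_mkcond; apply: eq_Rintegral => z _.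
  by rewrite !patchE; case: ifP; rewrite ?mul0r.
have Et : \int[mu]_z ((u \_ (dom half)) z * tens (upd c None (derive1 (c None))) z) =
    - \int[mu]_z ((ft \_ (dom half)) z * tens c z).
  rewrite -!dI -iter_derive_tens1//; have [_ _ H] := ut.
  by rewrite (H _ tf) expr1 mulN1r.
have Ex i : \int[mu]_z ((u \_ (dom half)) z *
      tens (upd c (Some i) (derive1 (derive1 (c (Some i))))) z) =
    \int[mu]_z ((fxx i \_ (dom half)) z * tens c z).
  rewrite -!dI -iter_derive_tens2//; have [_ _ H] := uxx i.
  by rewrite (H _ tf) sqrrN expr1n mul1r.
have [Is Es] := Rintegral_sum (index_enum 'I_n.+1) (fun i => Ix c i tc).
rewrite Et sum_option_index (eq_bigr _ (fun i _ => Ex i)).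
rewrite (_ : \int[mu]_z (((fun z => ft z - \sum_i fxx i z) \_ (dom half)) z * tens c z) =
    \int[mu]_z ((ft \_ (dom half)) z * tens c z) -
    \sum_i \int[mu]_z ((fxx i \_ (dom half)) z * tens c z)); first by ring.
rewrite -Es -RintegralB//; last exact: It.
by apply: eq_Rintegral => z _; exact: HE.
Qed.

End weak_form.

(** * The Dirichlet boundary *)

Section cutoff.
Context {R : realType}.

(** For positive [k] it vanishes for [x <= 1 / k] and equals 1 for [x >= 2 / k]. *)
Definition cutoff (k : nat) (x : R) : R := step (k%:R * x + -1).

Lemma smooth1_cutoff k : smooth1 (cutoff k).
Proof. exact/smooth1_affine/smooth1_step. Qed.

Lemma ccsmooth_derive1_step : ccsmooth (derive1 (@step R)).
Proof.
split; first exact/smooth1_derive1/smooth1_step.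
exists 1 => x x1; apply: is_derive_derive1.
have [x0|x0] := ltP x 0.
  apply: near_eq_is_derive (is_derive_cst (0 : R) x (1 : R)).
  near=> y; rewrite step_le0//; apply: ltW; near: y; exact: lt_nbhsl.
move: x1; rewrite ger0_norm// => x1.
apply: near_eq_is_derive (is_derive_cst (1 : R) x (1 : R)).
near=> y; rewrite step_ge1//; apply: ltW; near: y; exact: lt_nbhsr.
Unshelve. all: by end_near. Qed.

Lemma derive1_step_out (x : R) : ~~ (0 <= x <= 1) -> derive1 (@step R) x = 0.
Proof.
rewrite negb_and -!ltNge => /orP[x0|x1].
  by apply: (@derive1_eq0_lt _ _ 0) => // y; exact: step_le0.
apply: is_derive_derive1.
apply: near_eq_is_derive (is_derive_cst (1 : R) x (1 : R)).
near=> y; rewrite step_ge1//; apply: ltW; near: y; exact: lt_nbhsr.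
Unshelve. all: by end_near. Qed.

Lemma derive1_derive1_step_out (x : R) : ~~ (0 <= x <= 1) ->
  derive1 (derive1 (@step R)) x = 0.
Proof.
rewrite negb_and -!ltNge => h; apply: is_derive_derive1.
apply: near_eq_is_derive (is_derive_cst (0 : R) x (1 : R)).
case/orP: h => h.
- near=> y; rewrite derive1_step_out// negb_and -ltNge; apply/orP; left.
  by near: y; exact: lt_nbhsl.
- near=> y; rewrite derive1_step_out// negb_and -!ltNge; apply/orP; right.
  by near: y; exact: lt_nbhsr.
Unshelve. all: by end_near. Qed.

Lemma derive1_cutoff k x : derive1 (cutoff k) x = k%:R * derive1 step (k%:R * x + -1).
Proof. by rewrite derive1_affine//; exact: smooth1_step. Qed.

Lemma derive1_derive1_cutoff k x :
  derive1 (derive1 (cutoff k)) x =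
  k%:R * (k%:R * derive1 (derive1 step) (k%:R * x + -1)).
Proof.
have ss : smooth1 (derive1 (@step R)) by exact/smooth1_derive1/smooth1_step.
have sa : smooth1 (fun y => derive1 (@step R) (k%:R * y + -1)) by exact: smooth1_affine.
rewrite (_ : derive1 (cutoff k) = fun y => k%:R * derive1 step (k%:R * y + -1)); last first.
  by apply/funext => y; exact: derive1_cutoff.
rewrite derive1_smoothM//; last exact: smooth1_cst.
by rewrite derive1_cst mulr0 addr0 derive1_affine.
Qed.

(** The terms of Leibniz's rule for the second derivative of [f * cutoff k] in which the cutoff is
    differentiated. *)
Definition cutoff_rem (f : R -> R) k x :=
  2 * (derive1 f x * derive1 (cutoff k) x) + f x * derive1 (derive1 (cutoff k)) x.

Lemma derive1_derive1_mul_cutoff (f : R -> R) k : smooth1 f ->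
  derive1 (derive1 (fun x => f x * cutoff k x)) =
  fun x => 1 * (derive1 (derive1 f) x * cutoff k x) + 1 * cutoff_rem f k x.
Proof.
move=> sf; have sc := smooth1_cutoff k.
have sdf := smooth1_derive1 sf; have sdc := smooth1_derive1 sc.
rewrite (_ : derive1 (fun x => f x * cutoff k x) =
  fun x => f x * derive1 (cutoff k) x - (-1 * (cutoff k x * derive1 f x))); last first.
  by apply/funext => x; rewrite derive1_smoothM// mulN1r opprK.
apply/funext => x; rewrite derive1_smoothB//; last 2 first.
- exact: smooth1M.
- by apply: smooth1Z; exact: smooth1M.
rewrite derive1_smoothM// (@derive1_smoothM _ (cst (-1)))//; last 2 first.
- exact: smooth1_cst.
- exact: smooth1M.
rewrite derive1_cst mulr0 addr0 derive1_smoothM// /cutoff_rem /cst; ring.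
Qed.

Lemma ccsmooth_cutoff_rem (f : R -> R) k : ccsmooth f -> ccsmooth (cutoff_rem f k).
Proof.
move=> cf; have sc := smooth1_cutoff k; have sdc := smooth1_derive1 sc.
apply: ccsmoothD; last by apply: ccsmoothM => //; exact: smooth1_derive1.
by apply: ccsmoothZ; apply: ccsmoothM => //; exact: ccsmooth_derive1.
Qed.

(* Because f vanishes at 0, the remainder is of order k, and not k ^ 2, on an
   interval of length 1 / k: its integral against w tends to 0 with w. *)
Lemma cutoff_rem_bound (f : R -> R) : ccsmooth f -> f 0 = 0 ->
  exists2 C, 0 <= C & forall k, (0 < k)%N ->
    (forall x, ~ (k%:R^-1 <= x <= 2 / k%:R) -> cutoff_rem f k x = 0) /\
    (forall x, `|cutoff_rem f k x| <= C * k%:R).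
Proof.
move=> cf f0; have sf : smooth1 f by case: cf.
have [B1 B10 H1] := ccont_bounded (ccsmooth_ccont (ccsmooth_derive1 cf)).
have [B2 B20 H2] := ccont_bounded (ccsmooth_ccont (ccsmooth_derive1 (ccsmooth_derive1 cf))).
have [S1 S10 K1] := ccont_bounded (ccsmooth_ccont ccsmooth_derive1_step).
have [S2 S20 K2] := ccont_bounded (ccsmooth_ccont (ccsmooth_derive1 ccsmooth_derive1_step)).
(* A Taylor expansion at 0, where [f] vanishes. The range up to 2 contains every transition
   interval, since [2 / k <= 2]. *)
have lip x : 0 <= x <= 2 -> `|f x| <= (2 * B2 + B1) * x.
  move=> /andP[x0 x2]; have := smooth1_taylor1 0 x sf H2.
  rewrite add0r f0 subr0 => H.
  have -> : f x = (f x - x * derive1 f 0) + x * derive1 f 0 by ring.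
  apply: le_trans (ler_normD _ _) _; rewrite [leRHS]mulrDl lerD//.
    apply: (le_trans H); rewrite expr2 mulrA ler_wpM2r// mulrC.
    by rewrite ler_wpM2r.
  by rewrite normrM ger0_norm// mulrC ler_wpM2r.
(* The first term bounds [2 f' cutoff'], with one factor [k]. In the second, [k ^ 2] comes from the
   second derivative of the cutoff, [x] from [lip], and [k * x <= 2] leaves one factor [k]. *)
exists (2 * (B1 * S1) + 2 * (2 * B2 + B1) * S2).
  by rewrite addr_ge0// !mulr_ge0// addr_ge0// mulr_ge0.
move=> k k0; have k0' : 0 < k%:R :> R by rewrite ltr0n.
have out x : ~ (k%:R^-1 <= x <= 2 / k%:R) -> cutoff_rem f k x = 0.
  move=> xk; have h : ~~ (0 <= k%:R * x + -1 <= 1).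
    apply/negP => /andP[h1 h2]; apply: xk; apply/andP; split.
      by rewrite -[leLHS]mul1r ler_pdivrMr// mulrC; lra.
    by rewrite ler_pdivlMr// mulrC; lra.
  rewrite /cutoff_rem derive1_cutoff derive1_derive1_cutoff.
  by rewrite derive1_step_out// derive1_derive1_step_out// !mulr0 addr0.
split=> // x.
have [/andP[x1 x2]|/negP/out ->] := boolP (k%:R^-1 <= x <= 2 / k%:R); last first.
  by rewrite normr0 mulr_ge0// addr_ge0// !mulr_ge0// addr_ge0// mulr_ge0.
have x0 : 0 <= x by apply: le_trans x1; rewrite invr_ge0 ltW.
have kx : k%:R * x <= 2 by rewrite mulrC -ler_pdivlMr.
have x2' : x <= 2.
  apply: (le_trans x2); rewrite ler_pdivrMr// ler_peMr// ler1n.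
  by [].
rewrite /cutoff_rem derive1_cutoff derive1_derive1_cutoff.
apply: le_trans (ler_normD _ _) _; rewrite [leRHS]mulrDl lerD//.
  rewrite !normrM (ger0_norm (ltW k0')) (ger0_norm (ler0n R 2)) -!mulrA ler_wpM2l//.
  rewrite ler_pM ?mulr_ge0 ?(ltW k0')//.
  by rewrite mulrC ler_wpM2r// ltW.
rewrite !normrM (ger0_norm (ltW k0')).
apply: (@le_trans _ _ ((2 * B2 + B1) * x * (k%:R * (k%:R * S2)))).
  apply: ler_pM => //.
    by apply: lip; rewrite x0.
  by rewrite !ler_wpM2l// ltW.
have -> : (2 * B2 + B1) * x * (k%:R * (k%:R * S2)) =
  (2 * B2 + B1) * S2 * k%:R * (k%:R * x) by ring.
have -> : 2 * (2 * B2 + B1) * S2 * k%:R = (2 * B2 + B1) * S2 * k%:R * 2 by ring.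
by rewrite ler_wpM2l// !mulr_ge0 ?addr_ge0 ?mulr_ge0// ltW.
Qed.

Lemma cutoff_le0 k x : x <= k.+1%:R^-1 -> cutoff k.+1 x = 0.
Proof.
move=> xk; rewrite /cutoff step_le0// subr_le0 -ler_pdivlMl ?ltr0n// mulr1.
exact: xk.
Qed.

Lemma cvg_cutoff x : 0 < x -> \forall k \near \oo, cutoff k x = 1.
Proof.
move=> x0; near=> k; apply: step_ge1.
have : 2 / x <= k%:R by near: k; exact: nbhs_infty_ger.
by rewrite ler_pdivrMr//; lra.
Unshelve. all: by end_near. Qed.

Lemma normr_cutoff_le1 k x : `|cutoff k x| <= 1.
Proof. by rewrite ger0_norm ?step_ge0// step_le1. Qed.

End cutoff.

Section boundary.
Context {R : realType} {n : nat}.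
Local Notation leb := (@lebesgue_measure R).
Local Notation spacetime := ('rV[R]_n.+1 * R)%type.
Local Notation mspacetime := ('rV[R]_n.+1 * measurableTypeR R)%type.
Local Notation mu := (@spacetime_measure R n).
Local Notation index := (option 'I_n.+1).
Local Notation last_index := (@last_index n).
Implicit Types (c : index -> R -> R) (w G : spacetime -> R).

Definition tested w G c :=
  \int[mu]_z (w z * tens (upd c None (derive1 (c None))) z) +
  \sum_(j | j != None) \int[mu]_z (w z * tens (upd c j (derive1 (derive1 (c j)))) z) +
  \int[mu]_z (G z * tens c z).

Definition cut_last k c := upd c last_index (fun x => c last_index x * cutoff k x).

Lemma admissible_cut k c : admissible c -> admissible (cut_last k c).
Proof.
by move=> ca; apply: admissible_upd => //; apply: ccsmoothM => //; exact: smooth1_cutoff.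
Qed.

(** Dominated convergence: the cutoffs tend to 1 on the positive side, and on the other side [f]
    vanishes. *)
Lemma cut_last_cvg (f : spacetime -> R) (M : R) c :
  measurable_fun [set: mspacetime] f -> (forall z, `|f z| <= M) ->
  (forall z, coord z last_index <= 0 -> f z = 0) -> admissible c ->
  \int[mu]_z (f z * tens (cut_last k c) z) @[k --> \oo] --> \int[mu]_z (f z * tens c z).
Proof.
move=> mf fM f0 ca.
have ci c' : admissible c' -> mu.-integrable setT (EFin \o (fun z => f z * tens c' z)).
  by move=> ca'; apply: (mul_tens_integrable mf fM) => j; exact: admissible_integrable.
have ck k := ci _ (admissible_cut k ca).
have E k z : f z * tens (cut_last k c) z = f z * tens c z * cutoff k (coord z last_index).
  by rewrite /cut_last tens_upd (tens_bigD1 c last_index); ring.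
have [] := @dominated_convergence _ _ _ mu setT measurableT
  (fun k => EFin \o (fun z => f z * tens (cut_last k c) z))
  (EFin \o (fun z => f z * tens c z)) (abse \o (EFin \o (fun z => f z * tens c z))).
- by move=> k; exact: measurable_int (ck k).
- exact: measurable_int (ci _ ca).
- apply: aeW => z _; apply: cvg_EFin; first exact: nearW.
  apply: cvg_near_cst; have [z0|z0] := leP (coord z last_index) 0.
    by apply: nearW => k /=; rewrite f0// !mul0r.
  near=> k; rewrite /= E.
  have -> : cutoff k (coord z last_index) = 1 by near: k; exact: cvg_cutoff.
  by rewrite mulr1.
- exact: (integrable_norm (ci _ ca)).
- apply: aeW => z k _; rewrite /= lee_fin E normrM ler_piMr//.
  exact: normr_cutoff_le1.
move=> _ _ cv; rewrite -(fineK (integrable_fin_num measurableT (ci _ ca))) in cv.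
by have /fine_cvgP[_] := cv; exact.
Unshelve. all: by end_near. Qed.

Lemma weak_heat_whole w G : (forall c, test_factors false c -> tested w G c = 0) ->
  weak_heat 0 w G.
Proof.
move=> H c ca; have -> : fold_last 0 c = c.
  rewrite /fold_last -[RHS](upd_id c last_index); congr upd.
  by apply/funext => x; rewrite mul0r subr0.
exact: H.
Qed.

Lemma sum_defect (F1 F2 : index -> R) (r : R) :
  (forall j, j != None -> j != last_index -> F1 j = F2 j) ->
  F2 last_index = F1 last_index + r ->
  \sum_(j | j != None) F1 j + r = \sum_(j | j != None) F2 j.
Proof.
move=> H Hl; rewrite (bigD1 last_index)//= [RHS](bigD1 last_index)//= Hl addrAC.
by congr (_ + _ + _); apply: eq_bigr => j /andP[jN jl]; exact: H.
Qed.

(** Only the second derivative in the last variable meets the cutoff, so the equation tested with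
    the cut factors reads [T k + rm k = 0]. [T k] tends to the uncut expression. The remainder has
    size [O(k)] on a strip of width [1 / k], hence bounded total mass, and is multiplied by values
    of [w] that tend to 0. *)
Lemma weak_heat_half w G (M K : R) :
  measurable_fun [set: mspacetime] w -> measurable_fun [set: mspacetime] G ->
  (forall z, `|w z| <= M) -> (forall z, `|G z| <= K) ->
  (forall z, coord z last_index <= 0 -> w z = 0) ->
  (forall z, coord z last_index <= 0 -> G z = 0) ->
  (forall L e : R, 0 < e -> exists2 r : R, 0 < r & forall z,
    (forall j, j != last_index -> `|coord z j| <= L) ->
    0 < coord z last_index < r -> `|w z| <= e) ->
  (forall c, test_factors true c -> tested w G c = 0) ->
  weak_heat 1 w G.
Proof.
move=> mw mG wM GK w0 G0 wcont H c ca; rewrite -/(tested w G (fold_last 1 c)).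
set d := fold_last 1 c; have da : admissible d by exact: admissible_fold.
have od0 : d last_index 0 = 0.
  by rewrite /d /fold_last upd_same oppr0 mul1r subrr.
pose a j := if j == None then upd d j (derive1 (d j)) else upd d j (derive1 (derive1 (d j))).
have aa j : admissible (a j).
  by rewrite /a; case: ifP => _; apply: admissible_upd => //; do ?apply: ccsmooth_derive1.
pose T k := \int[mu]_z (w z * tens (cut_last k (a None)) z) +
  \sum_(j | j != None) \int[mu]_z (w z * tens (cut_last k (a j)) z) +
  \int[mu]_z (G z * tens (cut_last k d) z).
have cvgT : T k @[k --> \oo] --> tested w G d.
  rewrite /tested (eq_bigr (fun j => \int[mu]_z (w z * tens (a j) z))); last first.
    by move=> j jN; rewrite /a (negbTE jN).
  apply: cvgD; last exact: (cut_last_cvg mG GK G0 da).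
  apply: cvgD; first exact: (cut_last_cvg mw wM w0 (aa None)).
  apply: (cvg_big (@add_continuous R)) => j _.
  exact: (cut_last_cvg mw wM w0 (aa j)).
pose rm k := \int[mu]_z (w z * tens (upd d last_index (cutoff_rem (d last_index) k)) z).
(* The successor makes [1 / k] available as the margin of the test factors. *)
have TE k : T k.+1 + rm k.+1 = 0.
  have tk : test_factors true (cut_last k.+1 d).
    split; first exact: admissible_cut.
    move=> _; exists (k.+1%:R^-1); first by rewrite invr_gt0.
    by move=> x xk; rewrite /cut_last upd_same cutoff_le0// mulr0.
  rewrite -(H _ tk) /tested /T /rm.
  have lN : None != last_index by [].
  have E1 : cut_last k.+1 (a None) =
      upd (cut_last k.+1 d) None (derive1 (cut_last k.+1 d None)).
    by rewrite /cut_last /a /= !upd_other// updC.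
  have E2 j : j != None -> j != last_index -> cut_last k.+1 (a j) =
      upd (cut_last k.+1 d) j (derive1 (derive1 (cut_last k.+1 d j))).
    move=> jN jl; rewrite /cut_last /a (negbTE jN).
    by rewrite (upd_other _ _ jl) (upd_other _ _ (_ : last_index != j)) 1?eq_sym// updC.
  have E3 : \int[mu]_z (w z * tens (upd (cut_last k.+1 d) last_index
      (derive1 (derive1 (cut_last k.+1 d last_index)))) z) =
    \int[mu]_z (w z * tens (cut_last k.+1 (a last_index)) z) +
    \int[mu]_z (w z * tens (upd d last_index (cutoff_rem (d last_index) k.+1)) z).
    rewrite -RintegralD//; last 2 first.
    - apply: (mul_tens_integrable mw wM) => j; apply: admissible_integrable.
      exact: admissible_cut.
    - apply: (mul_tens_integrable mw wM) => j; apply: admissible_integrable.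
      by apply: admissible_upd => //; exact: ccsmooth_cutoff_rem.
    apply: eq_Rintegral => z _.
    have -> : a last_index = upd d last_index (derive1 (derive1 (d last_index))) by [].
    rewrite /cut_last !upd_same !upd_upd.
    rewrite (derive1_derive1_mul_cutoff k.+1 (da last_index).1) !tens_upd.
    by rewrite !mul1r; ring.
  rewrite -E1 addrAC; congr (_ + _); rewrite -addrA; congr (_ + _).
  apply: (sum_defect _ E3) => j jN jl.
  by rewrite (E2 j jN jl).
have cvgr : rm k @[k --> \oo] --> (0 : R).
  have [C C0 HC] := cutoff_rem_bound (da last_index) od0.
  have /boolp.choice[L0 LP] : forall j, exists L : R, 0 < L /\
      forall x, ~ (- L <= x <= L) -> d j x = 0.
    by move=> j; have [L ? ?] := ccont_supp (ccsmooth_ccont (da j)); exists L.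
  pose L := \sum_j L0 j.
  have LL j : L0 j <= L.
    rewrite /L (bigD1 j)//= lerDl sumr_ge0// => i _.
    by have [/ltW] := LP i.
  pose V := \prod_(j | j != last_index) \int[leb]_x `|d j x|.
  have V0 : 0 <= V by apply: prodr_ge0 => j _; exact: Rintegral_ge0.
  apply/cvgr0Pnorm_le => e e0.
  pose e' := e / (C * V + 1).
  have CV : 0 < C * V + 1 by rewrite ltr_wpDl// mulr_ge0.
  have e'0 : 0 < e' by rewrite divr_gt0.
  have [r r0 wr] := wcont L e' e'0.
  near=> k.
  have k0 : (0 < k)%N by near: k; exists 1%N.
  have k0' : 0 < k%:R :> R by rewrite ltr0n.
  have kr : 2 / k%:R < r.
    have : 2 / r < k%:R by near: k; exact: nbhs_infty_gtr.
    by rewrite ltr_pdivrMr// => h; rewrite ltr_pdivrMr// mulrC.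
  have [rout rb] := HC k k0.
  (* Truncating [w] at height [e'] does not change [rm k], because [|w| <= e'] wherever its test
     factors are nonzero; it provides the global bound that [mul_tens_bound] asks for. *)
  pose w' z := Num.max (- e') (Num.min e' (w z)).
  have mw' : measurable_fun [set: mspacetime] w'.
    by apply: measurable_maxr => //; exact: measurable_minr.
  have w'e z : `|w' z| <= e'.
    rewrite ler_norml /w' le_max lexx/= ge_max ge_min lexx/= andbT.
    by rewrite (le_trans (_ : _ <= 0)) ?oppr_le0// ltW.
  have E : rm k = \int[mu]_z (w' z * tens (upd d last_index (cutoff_rem (d last_index) k)) z).
    apply: eq_Rintegral => z _.
    have [zs|zs] := pselect ((forall j, j != last_index -> - L0 j <= coord z j <= L0 j) /\
        k%:R^-1 <= coord z last_index <= 2 / k%:R).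
      have : `|w z| <= e'.
        have [z1 /andP[z2 z3]] := zs; apply: wr.
          move=> j /z1; rewrite -ler_norml => h; exact: le_trans h (LL j).
        by rewrite (le_lt_trans z3)// andbT (lt_le_trans _ z2)// invr_gt0.
      rewrite ler_norml => /andP[h1 h2]; congr (_ * _); rewrite /w'.
      by rewrite (min_idPr h2) (max_idPr h1).
    rewrite !tens_upd.
    have [z2|z2] := pselect (k%:R^-1 <= coord z last_index <= 2 / k%:R); last first.
      by rewrite rout// mul0r !mulr0.
    have [j [jl jz]] : exists j, j != last_index /\ ~ (- L0 j <= coord z j <= L0 j).
      apply/not_existsP => h; apply: zs; split=> // j jl; apply: contrapT => jz.
      by apply: (h j).
    rewrite (bigD1 j)//= (_ : d j (coord z j) = 0) ?mul0r ?mulr0//.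
    by have [_] := LP j; apply.
  have rc := ccsmooth_cutoff_rem k (da last_index).
  rewrite E; apply: le_trans (mul_tens_bound mw' (ltW e'0) w'e _) _.
    move=> j; apply: admissible_integrable.
    by apply: admissible_upd => //.
  rewrite (bigD1 last_index)//= upd_same.
  rewrite (eq_bigr (fun j => \int[leb]_x `|d j x|)); last first.
    by move=> j jl; rewrite upd_other.
  rewrite -/V.
  have k12 : k%:R^-1 <= 2 / k%:R :> R.
    by rewrite -[leLHS]mul1r ler_wpM2r ?invr_ge0 ?(ltW k0')// ler1n.
  have [_ h] := integrable_supp (ccont_measurable (ccsmooth_ccont rc)) k12
    (mulr_ge0 C0 (ltW k0')) rb rout.
  have {}h : \int[leb]_x `|cutoff_rem (d last_index) k x| <= C.
    apply: (le_trans h); rewrite (_ : 2 / k%:R - k%:R^-1 = k%:R^-1); last by field; rewrite gt_eqF.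
    by rewrite mulfK ?gt_eqF.
  apply: (@le_trans _ _ (e' * (C * V + 1))); last by rewrite /e' divfK ?gt_eqF.
  rewrite ler_wpM2l ?(ltW e'0)//; apply: (@le_trans _ _ (C * V)); last by rewrite lerDl.
  by rewrite ler_wpM2r.
have c1 : T k.+1 @[k --> \oo] --> tested w G d by rewrite (cvg_shiftS T).
have c2 : T k.+1 @[k --> \oo] --> (0 : R).
  rewrite (_ : (fun k => T k.+1) = fun k => - rm k.+1).
    by rewrite -[0]oppr0; apply: cvgN; rewrite (cvg_shiftS rm).
  by apply/funext => k; apply/eqP; rewrite -addr_eq0 (TE k).
exact: (cvg_unique _ c1 c2).
Unshelve. all: by end_near. Qed.

End boundary.

(** * The nonlinearity *)

Section nonlinearity.
Context {R : realType}.

Lemma within_compact_bounded (T : topologicalType) (A : set T) (f : T -> R) :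
  compact A -> {within A, continuous f} -> exists2 B, 0 <= B & forall x, A x -> `|f x| <= B.
Proof.
move=> cA cf; have /compact_bounded[B [_ HB]] := continuous_compact cf cA.
exists (`|B| + 1); first by rewrite addr_ge0.
move=> x Ax; apply: (HB (`|B| + 1)); last by exists x.
by rewrite (le_lt_trans (ler_norm B))// ltrDl.
Qed.

Variables (m eps : R) (Phi : R * R -> R) (k g : R -> R).
Let varphi := if 0 < m then (fun t => k t * g t) else g.
Let ktilde := fun t => k t - eps.
Hypotheses (m0 : 0 <= m)
  (cPhi : {within [set p : R * R | 0 <= p.1 /\ 0 <= p.2], continuous Phi})
  (ck : {within `[0, +oo[, continuous k}) (cg : {within `[0, +oo[, continuous g})
  (g0 : g 0 = 0) (gpos : forall t, 0 < t -> 0 < g t)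
  (Phipos : forall M : R, 0 < M -> exists2 c : R, 0 < c &
     forall a b, 0 <= a <= M -> 0 <= b <= M -> c <= Phi (a, b))
  (dphi : forall t, 0 < t -> derivable varphi t 1)
  (phipos : forall t, 0 < t -> 0 < derive1 varphi t)
  (epsm : 0 < m -> eps = 0) (eps0 : m = 0 -> 0 < eps)
  (kt0 : 0 <= ktilde 0)
  (ktg : forall s t, 0 < s -> s <= t -> ktilde t / g t <= ktilde s / g s).

Definition reaction a b :=
  Phi (a, b) * k a * (g b - m * g a) - Phi (a, b) * k b * (g a - m * g b).

Let itv_sub (M : R) : `[0, M]%classic `<=` `[0, +oo[%classic.
Proof. by move=> x /=; rewrite !in_itv/= => /andP[-> _]. Qed.

Let cphi : {within `[0, +oo[, continuous varphi}.
Proof.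
rewrite /varphi; case: ifP => // _ x.
by apply: cvgM; [exact: ck|exact: cg].
Qed.

Let phi_incr x y : 0 <= x -> x < y -> varphi x < varphi y.
Proof.
move=> x0 xy; have sub : `[x, y]%classic `<=` `[0, +oo[%classic.
  by move=> z /=; rewrite !in_itv/= => /andP[xz _]; rewrite (le_trans x0).
have [||c /[!in_itv]/= /andP[xc _] E] := @MVT R varphi (derive1 varphi) x y xy.
- move=> z /[!in_itv]/= /andP[xz _]; rewrite derive1E; split => //.
  by apply: dphi; exact: le_lt_trans xz.
- exact: continuous_subspaceW cphi.
- by rewrite -subr_gt0 E mulr_gt0 ?subr_gt0// phipos// (le_lt_trans x0).
Qed.

(** The increment [varphi (t + s) - varphi t] is positive and continuous on a compact interval,
    hence has a positive minimum; monotonicity passes from [a = b + s] to larger [a]. *)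
Let phi_gap M s : 0 < s -> exists2 d, 0 < d & forall a b,
  0 <= b -> a <= M -> b + s <= a -> d <= varphi a - varphi b.
Proof.
move=> s0; pose F t := varphi (t + s) - varphi t.
have [M0|M0] := leP 0 M; last first.
  by exists 1 => // a b b0 aM bsa; exfalso; lra.
have [||c /[!in_itv]/= /andP[c0 _] cmin] := @EVT_min R F 0 M.
- exact: M0.
- have c1 : {within `[0, M], continuous (fun t => varphi (t + s))}.
    apply: continuous_in_subspaceT => t; rewrite inE/= in_itv/= => /andP[t0 _].
    apply: (@continuous_comp _ _ _ (fun t => t + s) varphi).
      by apply: cvgD; [exact: cvg_id|exact: cvg_cst].
    apply/differentiable_continuous/derivable1_diffP; apply: dphi.
    by rewrite ltr_wpDl.
  have c2 : {within `[0, M], continuous varphi} by exact: continuous_subspaceW cphi.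
  by move=> t; apply: cvgB; [exact: c1|exact: c2].
exists (F c); first by rewrite subr_gt0 phi_incr// ltrDl.
move=> a b b0 aM bsa; have bM : b <= M by lra.
apply: (le_trans (cmin b _)); first by rewrite in_itv/= b0.
rewrite lerD2r le_eqVlt; move: bsa; rewrite le_eqVlt => /predU1P[->|h].
  by rewrite eqxx.
by rewrite phi_incr ?orbT// addr_ge0// ltW.
Qed.

(* The monotonicity of ktilde / g handles the terms of E in ktilde a g b; what
   remains is a multiple of varphi b - varphi a, by m when m > 0 and by eps
   when m = 0. *)
Let E a b := k a * (g b - m * g a) - k b * (g a - m * g b).

(** For positive [b] this is the monotonicity of [ktilde / g] with denominators cleared. At [b = 0],
    where the quotient carries no information, [g 0 = 0] and [ktilde 0 >= 0] take over. *)
Let kt_cross a b : 0 <= b -> b < a -> ktilde a * g b <= ktilde b * g a.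
Proof.
rewrite le_eqVlt => /predU1P[<-|b0] ba.
  by rewrite g0 mulr0 mulr_ge0// ltW// gpos.
have := ktg b0 (ltW ba).
have ga := gpos (lt_trans b0 ba); have gb := gpos b0.
by rewrite ler_pdivrMr// mulrAC ler_pdivlMr.
Qed.

Let lam := if 0 < m then m else eps.

Let lam0 : 0 < lam.
Proof.
rewrite /lam; case: (ltP 0 m) => // m_le0; apply: eps0.
by apply/eqP; rewrite eq_le m_le0.
Qed.

Let E_le a b : 0 <= b -> b < a -> E a b <= - (lam * (varphi a - varphi b)).
Proof.
move=> b0 ba; have := kt_cross b0 ba; rewrite /ktilde /E /lam /varphi.
case: (ltP 0 m) => mp; first by rewrite epsm// !subr0; nra.
have -> : m = 0 by apply/eqP; rewrite eq_le mp.
nra.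
Qed.

Lemma reaction_sign M s : 0 < M -> 0 < s -> exists2 d, 0 < d & forall a b,
  0 <= a <= M -> 0 <= b <= M ->
  (s <= a - b -> reaction a b <= - d) /\ (a - b <= - s -> d <= reaction a b).
Proof.
move=> M0 s0; have [c c0 cP] := Phipos M0.
have [d d0 dP] := phi_gap M s0.
have rE a b : reaction a b = Phi (a, b) * E a b by rewrite /reaction /E; ring.
have EN a b : E b a = - E a b by rewrite /E; ring.
(* The second sign follows from the first by exchanging [a] and [b], under which [E] is odd. [Phi]
   has no such symmetry, so its value is replaced by an arbitrary [P >= c]. *)
have key a b P : 0 <= a <= M -> 0 <= b <= M -> c <= P -> s <= a - b ->
    P * E a b <= - (c * (lam * d)).
  move=> /andP[a0 aM] /andP[b0 bM] cp sab.
  have ba : b < a by lra.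
  have h1 := E_le b0 ba.
  have h2 : lam * d <= lam * (varphi a - varphi b).
    by rewrite ler_pM2l// dP//; lra.
  have h3 : 0 < lam * d by rewrite mulr_gt0.
  have h4 : c * (lam * d) <= P * (- E a b).
    by apply: ler_pM => //; [exact: ltW|exact: ltW|lra].
  lra.
exists (c * (lam * d)); first by rewrite !mulr_gt0.
move=> a b aM bM; rewrite rE; split=> h.
  by apply: key => //; exact: cP.
have := key b a (Phi (a, b)) bM aM (cP a b aM bM); rewrite EN mulrN lerNl opprK.
by apply; lra.
Qed.

Lemma reaction_bounded M : exists C, forall a b,
  0 <= a <= M -> 0 <= b <= M -> `|reaction a b| <= C.
Proof.
have cK : {within `[0, M], continuous k} by exact: continuous_subspaceW ck.
have cG : {within `[0, M], continuous g} by exact: continuous_subspaceW cg.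
have [Bk Bk0 HBk] := within_compact_bounded (@segment_compact _ 0 M) cK.
have [Bg Bg0 HBg] := within_compact_bounded (@segment_compact _ 0 M) cG.
have cP : {within `[0, M]%classic `*` `[0, M]%classic, continuous Phi}.
  apply: continuous_subspaceW cPhi => -[x y] /= [].
  by rewrite !in_itv/= => /andP[x0 _] /andP[y0 _].
have [BP BP0 HBP] := within_compact_bounded
  (compact_setX (@segment_compact _ 0 M) (@segment_compact _ 0 M)) cP.
exists (BP * Bk * (Bg + m * Bg) + BP * Bk * (Bg + m * Bg)) => a b aM bM.
have Ka : `|k a| <= Bk by apply: HBk; rewrite /= in_itv.
have Kb : `|k b| <= Bk by apply: HBk; rewrite /= in_itv.
have Ga : `|g a| <= Bg by apply: HBg; rewrite /= in_itv.
have Gb : `|g b| <= Bg by apply: HBg; rewrite /= in_itv.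
have P : `|Phi (a, b)| <= BP by apply: HBP; split; rewrite /= in_itv.
have H x y : `|x| <= Bg -> `|y| <= Bg -> `|x - m * y| <= Bg + m * Bg.
  move=> hx hy; apply: le_trans (ler_normB _ _) _; rewrite lerD//.
  by rewrite normrM ger0_norm// ler_wpM2l.
rewrite /reaction; apply: le_trans (ler_normB _ _) _; rewrite !normrM.
by apply: lerD; apply: ler_pM => //; rewrite ?mulr_ge0//;
  [apply: ler_pM|apply: H|apply: ler_pM|apply: H].
Qed.

End nonlinearity.

(** * The two domains, boundary values and boxes *)

Section domains.
Context {R : realType} {n : nat}.
Local Notation leb := (@lebesgue_measure R).
Local Notation spacetime := ('rV[R]_n.+1 * R)%type.
Local Notation mspacetime := ('rV[R]_n.+1 * measurableTypeR R)%type.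
Local Notation mu := (@spacetime_measure R n).
Local Notation index := (option 'I_n.+1).
Local Notation last_index := (@last_index n).

Lemma cylinder_setT : cylinder [set: 'rV[R]_n.+1] = dom false.
Proof. by apply/seteqP; split => z. Qed.

Lemma cylinder_half_space : cylinder (@half_space R n) = dom true.
Proof.
apply/seteqP; split => z; rewrite /dom /in_domain /=; first by case.
by move=> z0; split.
Qed.

Lemma open_dom half : open (dom half : set spacetime).
Proof.
rewrite /dom /in_domain; case: half => /=.
  apply: (@open_comp _ _ (fun z : spacetime => coord z last_index) [set t | 0 < t]).
    by move=> z _; exact: coord_continuous_spacetime.
  exact: open_gt.
by rewrite (_ : [set z | _] = setT); [exact: openT|apply/seteqP].
Qed.

Lemma closure_half_space (x : 'rV[R]_n.+1) : 0 <= x ord0 ord_max -> closure half_space x.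
Proof.
move=> x0 B Bx.
pose f (t : R) : 'rV[R]_n.+1 := x + t *: delta_mx ord0 ord_max.
have cf : f t @[t --> (0 : R)^'+] --> x.
  rewrite -[X in _ --> X]addr0 -(scale0r (delta_mx ord0 ord_max)).
  apply: cvgD; first exact: cvg_cst.
  by apply: cvgZr_tmp; apply: cvg_within_filter; exact: cvg_id.
have NB : \forall t \near (0 : R)^'+, B (f t) /\ 0 < t.
  near=> t; split; first by near: t; exact: cf.
  by near: t; exact: nbhs_right_gt.
have [|t [Bft t0]] := filter_ex NB; first exact: at_right_proper_filter.
exists (f t); split => //.
by rewrite /half_space /= /f !mxE !eqxx mulr1 ltr_wpDl.
Unshelve. all: by end_near. Qed.

Lemma dirichlet0_boundary (f : spacetime -> R) z :
  dirichlet0 half_space f -> coord z last_index = 0 -> f z = 0.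
Proof.
move=> [_ H] z0; have z0' : z.1 ord0 ord_max = 0 := z0.
apply: H; split => //; split; first by apply: closure_half_space; rewrite z0'.
by move=> /interior_subset; rewrite /half_space /= z0' ltxx.
Qed.

(** Compactness in the other coordinates makes [r] uniform: a point of the box with [|f| > e] has
    its last coordinate equal to [h], hence not below the positive minimum of [h]. *)
Lemma boundary_small (f : spacetime -> R) :
  {within cylinder (closure half_space), continuous f} ->
  (forall z, coord z last_index = 0 -> f z = 0) ->
  forall L e : R, 0 < e -> exists2 r : R, 0 < r & forall z,
    (forall j, j != last_index -> `|coord z j| <= L) ->
    0 < coord z last_index < r -> `|f z| <= e.
Proof.
move=> cf f0 L e e0.
have [L0|L0] := ltP L 0.
  exists 1 => // z zL _.
  by have := le_trans (normr_ge0 _) (zL None isT); rewrite leNgt L0.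
pose a (j : index) := if j == last_index then 0 else - L.
pose b (j : index) := if j == last_index then 1 else L.
have Ksub : closed_box a b `<=` cylinder (closure half_space).
  move=> z /(_ last_index); rewrite /a /b eqxx => /andP[z0 _].
  by split => //; exact: closure_half_space.
pose F z := `|f z|.
(* [h] is positive on the compact box, and is the last coordinate where F >= e. *)
pose h z := coord z last_index + ((e - F z) + `|e - F z|).
have cF : {within closed_box a b, continuous F}.
  by move=> z; apply: cvg_norm; exact: (continuous_subspaceW Ksub cf).
have ch : {within closed_box a b, continuous h}.
  have c1 : {within closed_box a b, continuous (fun z => e - F z)}.
    by move=> z; apply: cvgB; [exact: cvg_cst|exact: cF].
  move=> z; apply: cvgD.
    exact: (continuous_subspaceT (@coord_continuous_spacetime _ _ last_index)).
  apply: cvgD; first exact: c1.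
  by apply: cvg_norm; exact: c1.
have K0 : closed_box a b !=set0.
  exists (0 : spacetime) => j; have -> : coord 0 j = 0 :> R.
    by case: j => [i|] //=; rewrite mxE.
  by rewrite /a /b; case: eqP => _; rewrite ?lexx ?ler01// oppr_le0 L0.
have [z1 /set_mem z1K z1min] := compact_EVT_min K0 (@compact_closed_box _ _ a b) ch.
have h0 : 0 < h z1.
  have /andP[t0 _] := z1K last_index; move: t0; rewrite /a eqxx => t0.
  have p0 : 0 <= (e - F z1) + `|e - F z1|.
    by have := ler_norm (- (e - F z1)); rewrite normrN; lra.
  move: t0; rewrite le_eqVlt => /predU1P[t0|t0]; last by rewrite /h ltr_pwDl.
  rewrite /h -t0 add0r /F f0// normr0 subr0 ger0_norm ?(ltW e0)// addr_gt0//.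
exists (Num.min 1 (h z1)); first by rewrite lt_min ltr01.
move=> z zL /andP[t0]; rewrite lt_min => /andP[t1 th].
have zK : closed_box a b z.
  move=> j; rewrite /a /b; case: (eqVneq j last_index) => [->|jl].
    by rewrite !ltW.
  by rewrite -ler_norml zL.
have := z1min z; rewrite inE => /(_ zK) hz.
rewrite leNgt; apply/negP => eF.
have : h z = coord z last_index.
  by rewrite /h ltr0_norm ?subr_lt0// subrr addr0.
lra.
Qed.

Lemma nbhs_box (U : set spacetime) z : nbhs z U ->
  exists a b, (forall j, a j < coord z j < b j) /\ box a b `<=` U.
Proof.
move=> /nbhs_ballP[e /= e0 eU].
exists (fun j => coord z j - e), (fun j => coord z j + e); split.
  by move=> j; rewrite gtrBl e0 /= ltrDl e0.
have inball (s t : R) : s - e < t < s + e -> ball s e t.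
  by move=> /andP[h1 h2]; rewrite /ball /= ltr_norml; apply/andP; split; lra.
move=> y yb; apply: eU; split; last exact: inball (yb None).
by split=> // i j; rewrite ord1; exact: inball (yb (Some j)).
Qed.

(** The indicator of a box is a tensor product, so its measure is the product of the side
    lengths. *)
Lemma box_not_negligible (a b : index -> R) : (forall j, a j < b j) ->
  ~ mu.-negligible (box a b).
Proof.
move=> ab /(negligibleP _ (measurable_box a b)) m0.
pose c j : R -> R := \1_`]a j, b j[.
have ci j : leb.-integrable setT (EFin \o c j) by exact: integrable_indic_itv.
have [_ E] := tens_integrable ci.
have cE z : tens c z = \1_(box a b) z.
  rewrite [RHS]indicE; case: (boolP (z \in _)) => [/set_mem h|/negP h].
    by rewrite /tens big1// => j _; rewrite /c indicE mem_set//= in_itv/=; exact: h.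
  have [j jh] : exists j, ~ (a j < coord z j < b j).
    by apply/not_existsP => h'; apply: h; rewrite inE => j; apply: contrapT; exact: h'.
  by rewrite (tens_bigD1 c j) /c indicE memNset ?mul0r//= in_itv/=.
have : \int[mu]_z tens c z = 0.
  rewrite (_ : tens c = \1_(box a b)); last exact/funext.
  by rewrite /Rintegral integral_indic// ?setIT ?m0//; exact: measurable_box.
rewrite E; apply/eqP; rewrite gt_eqF// prodr_gt0// => j _.
rewrite /c /Rintegral integral_indic//= setIT lebesgue_measure_itv/= lte_fin ab/=.
by rewrite subr_gt0.
Qed.

End domains.

(** * From almost everywhere statements to uniqueness *)

Section uniqueness.
Context {R : realType} {n : nat}.
Local Notation spacetime := ('rV[R]_n.+1 * R)%type.
Local Notation mspacetime := ('rV[R]_n.+1 * measurableTypeR R)%type.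
Local Notation mu := (@spacetime_measure R n).
Local Notation index := (option 'I_n.+1).
Local Notation last_index := (@last_index n).

Lemma Rintegral_ae_sub (f1 f2 f : spacetime -> R) (N : set mspacetime) :
  mu.-integrable setT (EFin \o f1) -> mu.-integrable setT (EFin \o f2) ->
  measurable_fun [set: mspacetime] f -> measurable N -> mu N = 0%E ->
  (forall z, ~ N z -> f z = f1 z - f2 z) ->
  \int[mu]_z f z = \int[mu]_z f1 z - \int[mu]_z f2 z.
Proof.
move=> i1 i2 mf mN N0 ff; rewrite -RintegralB// /Rintegral; congr fine.
apply: ae_eq_integral => //.
- exact/measurable_EFinP.
- by have := measurable_int mu (integrableB measurableT i1 i2).
exists N; split => // z /= h; apply: contrapT => zN; apply: h => _.
by rewrite ff.
Qed.

(** [u - v] and [Hu - Hv] are set to 0 off the domain and on the exceptional null set [N], so that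
    the pointwise hypotheses of [liouville_heat] hold everywhere. Bounds are at hand for the
    difference [Hu - Hv] only; integrability of each term against test factors is what allows the
    two equations to be subtracted. *)
Lemma ae_uniqueness (half : bool) (N : set mspacetime) (u v Hu Hv : spacetime -> R) (M K : R) :
  measurable_fun (dom half : set mspacetime) u ->
  measurable_fun (dom half : set mspacetime) v ->
  measurable_fun (dom half : set mspacetime) Hu ->
  measurable_fun (dom half : set mspacetime) Hv ->
  Lloc 1 (dom half) u -> Lloc 1 (dom half) v ->
  (forall c, test_factors half c ->
    mu.-integrable setT (EFin \o (fun z => (Hu \_ (dom half)) z * tens c z))) ->
  (forall c, test_factors half c ->
    mu.-integrable setT (EFin \o (fun z => (Hv \_ (dom half)) z * tens c z))) ->
  (forall c, test_factors half c -> tested (u \_ (dom half)) (Hu \_ (dom half)) c = 0) ->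
  (forall c, test_factors half c -> tested (v \_ (dom half)) (Hv \_ (dom half)) c = 0) ->
  measurable N -> mu N = 0%E ->
  (forall z, dom half z -> ~ N z -> `|u z - v z| <= M /\ `|Hu z - Hv z| <= K) ->
  (forall s, 0 < s -> exists2 d, 0 < d & forall z, dom half z -> ~ N z ->
    (s <= u z - v z -> Hu z - Hv z <= - d) /\
    (u z - v z <= - s -> d <= Hu z - Hv z)) ->
  (half -> forall L e : R, 0 < e -> exists2 r : R, 0 < r & forall z,
    (forall j, j != last_index -> `|coord z j| <= L) ->
    0 < coord z last_index < r -> `|u z - v z| <= e) ->
  mu.-negligible [set z | dom half z /\ u z <> v z].
Proof.
move=> mu_ mv mHu mHv Lu Lv iHu iHv tu tv mN N0 bd sgn bdry.
have mD := @measurable_dom R n half.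
have mDN : measurable (dom half `\` N) by exact: measurableD.
have DN : dom half `\` N `<=` dom half by exact: subIsetl.
pose w := (fun z => u z - v z) \_ (dom half `\` N).
pose G := (fun z => Hu z - Hv z) \_ (dom half `\` N).
have mw : measurable_fun [set: mspacetime] w.
  apply/(measurable_restrictT _ mDN); apply: measurable_funB.
    exact: measurable_funS mD DN mu_.
  exact: measurable_funS mD DN mv.
have mG : measurable_fun [set: mspacetime] G.
  apply/(measurable_restrictT _ mDN); apply: measurable_funB.
    exact: measurable_funS mD DN mHu.
  exact: measurable_funS mD DN mHv.
have wE z : w z = 0 \/ [/\ dom half z, ~ N z & w z = u z - v z].
  by rewrite /w patchE; case: ifPn => [/set_mem[]|_]; [right|left].
have GE z : G z = 0 \/ [/\ dom half z, ~ N z & G z = Hu z - Hv z].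
  by rewrite /G patchE; case: ifPn => [/set_mem[]|_]; [right|left].
have wM z : `|w z| <= `|M|.
  have [->|[zD zN ->]] := wE z; first by rewrite normr0.
  by rewrite (le_trans (bd z zD zN).1)// ler_norm.
have GK z : `|G z| <= `|K|.
  have [->|[zD zN ->]] := GE z; first by rewrite normr0.
  by rewrite (le_trans (bd z zD zN).2)// ler_norm.
have diff (f1 f2 : spacetime -> R) z : ~ N z ->
    ((fun z => f1 z - f2 z) \_ (dom half `\` N)) z =
    (f1 \_ (dom half)) z - (f2 \_ (dom half)) z.
  move=> zN; rewrite !patchE.
  have -> : (z \in dom half `\` N) = (z \in dom half).
    by apply/idP/idP => /set_mem h; apply/mem_set; [case: h|split].
  by case: ifP; rewrite ?subrr.
have mt c : test_factors half c -> measurable_fun [set: mspacetime] (tens c).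
  by move=> [ca _]; apply: measurable_tens => j; exact: ccont_measurable (ccsmooth_ccont (ca j)).
have sub (f1 f2 : spacetime -> R) c : test_factors half c ->
    measurable_fun [set: mspacetime] ((fun z => f1 z - f2 z) \_ (dom half `\` N)) ->
    mu.-integrable setT (EFin \o (fun z => (f1 \_ (dom half)) z * tens c z)) ->
    mu.-integrable setT (EFin \o (fun z => (f2 \_ (dom half)) z * tens c z)) ->
    \int[mu]_z (((fun z => f1 z - f2 z) \_ (dom half `\` N)) z * tens c z) =
    \int[mu]_z ((f1 \_ (dom half)) z * tens c z) -
    \int[mu]_z ((f2 \_ (dom half)) z * tens c z).
  move=> tc mf i1 i2; apply: (Rintegral_ae_sub i1 i2 _ mN N0).
    by apply: measurable_funM => //; exact: mt.
  by move=> z zN; rewrite diff// mulrBl.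
have test c : test_factors half c -> tested w G c = 0.
  move=> tc; rewrite -[RHS](subrr 0) -{1}(tu c tc) -(tv c tc) /tested.
  have swE c' : test_factors half c' -> \int[mu]_z (w z * tens c' z) =
      \int[mu]_z ((u \_ (dom half)) z * tens c' z) -
      \int[mu]_z ((v \_ (dom half)) z * tens c' z).
    by move=> tc'; apply: sub => //; exact: Lloc_integrable.
  have sGE : \int[mu]_z (G z * tens c z) =
      \int[mu]_z ((Hu \_ (dom half)) z * tens c z) -
      \int[mu]_z ((Hv \_ (dom half)) z * tens c z).
    by apply: sub => //; [exact: iHu|exact: iHv].
  have tc2 j : test_factors half (upd c j (derive1 (derive1 (c j)))).
    by have := test_factors_derive j (test_factors_derive j tc); rewrite upd_same upd_upd.
  rewrite sGE swE; last exact: test_factors_derive.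
  rewrite (eq_bigr _ (fun j _ => swE _ (tc2 j))) sumrB.
  ring.
have wG : weak_heat half%:R w G.
  have le0 (f : spacetime -> R) z : half -> coord z last_index <= 0 ->
      (f \_ (dom half `\` N)) z = 0.
    move=> h z0; rewrite patchE ifF//; apply/negP => /set_mem[+ _].
    by rewrite /dom /in_domain h /= ltNge z0.
  have [h|h] := boolP half; last first.
    apply: weak_heat_whole => c [ca _]; apply: test; split => // h'.
    by rewrite h' in h.
  apply: (@weak_heat_half _ _ w G `|M| `|K|) => //.
  - by move=> z; exact: le0.
  - by move=> z; exact: le0.
  - move=> L e e0; have [r r0 rP] := bdry h L e e0; exists r => // z zL zr.
    have [->|[zD zN ->]] := wE z; first by rewrite normr0 ltW.
    exact: rP.
  by move=> c [ca cs]; apply: test; split => // _; exact: cs.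
have out z : ~~ in_domain half z -> ~ dom half z by move/negP.
have w0 : mu [set z | w z != 0] = 0%E.
  apply: (liouville_heat mw mG wM GK _ _ _ wG).
  - by move=> z /out zD; have [//|[]] := wE z.
  - by move=> z /out zD; have [//|[]] := GE z.
  move=> s s0; have [d d0 dP] := sgn s s0; exists d => // z zD.
  (* Where [w] was set to 0, both premises fail because [s > 0]. *)
  have [w0|[_ zN ->]] := wE z.
    by rewrite w0 oppr_ge0 leNgt s0.
  have -> : G z = Hu z - Hv z by rewrite /G patchE mem_set.
  exact: dP.
have mw0 : measurable [set z : mspacetime | w z != 0].
  rewrite (_ : [set z | _] = ~` (w @^-1` [set (0 : R)])).
    apply: measurableC; rewrite -[X in measurable X]setTI; apply: mw => //.
  by apply/seteqP; split => z /=; [move=> /eqP|move=> h; apply/eqP].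
have N1 : mu.-negligible [set z | w z != 0] by apply/negligibleP.
have N2 : mu.-negligible N by apply/negligibleP.
apply: negligibleS (negligibleU N1 N2) => z [zD uv].
have [zN|zN] := pselect (N z); [by right|left].
rewrite /= /w patchE mem_set; last by split.
by rewrite subr_eq0; apply/eqP.
Qed.

End uniqueness.

(** A Sobolev function is determined only up to null sets, hence an almost everywhere conclusion.
    For continuous representatives it improves to every point: the set where they differ is open in
    the domain, and a nonempty one would contain a box of positive measure. *)
Theorem theorem2p5 (R : realType) (n : nat) (X : set 'rV[R]_n.+1) (mu : R)
  (Phi : R * R -> R) (k g : R -> R) (eps : R) (u v : 'rV[R]_n.+1 * R -> R) :
  let varphi := if 0 < mu then (fun t => k t * g t) else g in
  let ktilde := fun t => k t - eps in
  X = setT \/ X = half_space ->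
  0 <= mu ->
  {within [set p : R * R | 0 <= p.1 /\ 0 <= p.2], continuous Phi} ->
  {within `[0, +oo[, continuous k} ->
  {within `[0, +oo[, continuous g} ->
  g 0 = 0 ->
  (forall t, 0 < t -> 0 < g t) ->
  (forall M : R, 0 < M -> exists2 c : R, 0 < c &
     forall a b, 0 <= a <= M -> 0 <= b <= M -> c <= Phi (a, b)) ->
  (forall t, 0 < t -> derivable varphi t 1) ->
  (forall t, 0 < t -> {for t, continuous (derive1 varphi)}) ->
  (forall t, 0 < t -> 0 < derive1 varphi t) ->
  (0 < mu -> eps = 0) ->
  (mu = 0 -> 0 < eps) ->
  0 <= ktilde 0 ->
  (forall s t, 0 < s -> s <= t -> ktilde t / g t <= ktilde s / g s) ->
  strong_solution X mu Phi k g u v ->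
  nonneg_bounded X u ->
  nonneg_bounded X v ->
  (X = half_space -> dirichlet0 X u /\ dirichlet0 X v) ->
  {ae spacetime_measure, forall z, cylinder X z -> u z = v z} /\
  ({within cylinder X, continuous u} -> {within cylinder X, continuous v} ->
     forall z, cylinder X z -> u z = v z).
Proof.
move=> varphi ktilde XE m0 cPhi ck cg g0 gpos Phipos dphi _ phipos epsm eps0 kt0 ktg.
move=> [reg hu hv] [u0 [Mu uM]] [v0 [Mv vM]] dir.
have [half [QE hX]] : exists half : bool, cylinder X = dom half /\
    (half -> X = half_space).
  case: XE => ->; first by exists false; rewrite cylinder_setT.
  by exists true; rewrite cylinder_half_space.
rewrite QE in reg hu hv u0 uM v0 vM *.
have ae_uv : (@spacetime_measure R n).-negligible [set z | dom half z /\ u z <> v z].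
  have [[[mu_ _] _ _ _] [[mv _] _ _ _]] := reg 2 (ltr1n R 2).
  have Lu : Lloc 1 (dom half) u by have [ft [_ [[? _ _] _ _]]] := hu.
  have Lv : Lloc 1 (dom half) v by have [ft [_ [[? _ _] _ _]]] := hv.
  have [Hu [mHu Hu_ae iHu tu]] := heat_eq_weak hu.
  have [Hv [mHv Hv_ae iHv tv]] := heat_eq_weak hv.
  (* The 1 makes the common bound positive, as [reaction_sign] requires. *)
  pose M := Num.max 1 (Num.max Mu Mv).
  have M0 : 0 < M by rewrite lt_max ltr01.
  have good : {ae spacetime_measure, forall z, dom half z ->
      [/\ 0 <= u z <= M, 0 <= v z <= M & Hu z - Hv z = reaction mu Phi k g (u z) (v z)]}.
    apply: negligibleS (negligibleU (negligibleU u0 v0) (negligibleU (negligibleU uM vM)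
      (negligibleU Hu_ae Hv_ae))) => z /= bad.
    apply: contrapT => ok; apply: bad => zQ.
    have h1 : 0 <= u z by apply: contrapT => c; apply: ok; do 2 left; move=> /(_ zQ).
    have h2 : 0 <= v z by apply: contrapT => c; apply: ok; left; right; move=> /(_ zQ).
    have h3 : `|u z| <= Mu.
      by apply: contrapT => c; apply: ok; right; do 2 left; move=> /(_ zQ).
    have h4 : `|v z| <= Mv.
      by apply: contrapT => c; apply: ok; right; left; right; move=> /(_ zQ).
    have h5 : Hu z = Phi (u z, v z) * k (u z) * (g (v z) - mu * g (u z)).
      by apply: contrapT => c; apply: ok; do 2 right; left; move=> /(_ zQ).
    have h6 : Hv z = Phi (u z, v z) * k (v z) * (g (u z) - mu * g (v z)).
      by apply: contrapT => c; apply: ok; do 3 right; move=> /(_ zQ).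
    split.
    - by rewrite h1 /M !le_max (le_trans (ler_norm _) h3) ?orbT.
    - by rewrite h2 /M !le_max (le_trans (ler_norm _) h4) ?orbT.
    - by rewrite h5 h6.
  have [N [mN N0 goodN]] := good.
  have {}good z : dom half z -> ~ N z ->
      [/\ 0 <= u z <= M, 0 <= v z <= M & Hu z - Hv z = reaction mu Phi k g (u z) (v z)].
    by move=> zQ zN; apply: contrapT => h; apply: zN; apply: goodN => /(_ zQ).
  have [K KP] := reaction_bounded m0 cPhi ck cg M.
  apply: (@ae_uniqueness _ _ half N u v Hu Hv (M + M) K) => //.
  - move=> z zQ zN; have [uz vz ->] := good z zQ zN; split; last exact: KP.
    move: uz vz => /andP[u_0 u_M] /andP[v_0 v_M].
    by rewrite ler_norml; apply/andP; split; lra.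
  - move=> s s0.
    have [d d0 dP] := reaction_sign m0 ck cg g0 gpos Phipos dphi phipos epsm eps0 kt0 ktg M0 s0.
    exists d => // z zQ zN; have [uz vz ->] := good z zQ zN.
    exact: dP.
  move=> h; have XH := hX h; have [[cu du] [cv dv]] := dir XH.
  rewrite XH in cu du cv dv.
  apply: (@boundary_small _ _ (fun z => u z - v z)).
    by move=> z; apply: cvgB; [exact: cu|exact: cv].
  move=> z z0; rewrite (@dirichlet0_boundary _ _ u)// (@dirichlet0_boundary _ _ v)//.
  by rewrite subrr.
split.
  apply: negligibleS ae_uv => z /= h; split.
    by apply: contrapT => zQ; apply: h.
  by move=> uv; apply: h.
move=> cu cv z zQ; apply: contrapT => uv.
have oQ := @open_dom R n half.
have cw : u y - v y @[y --> z] --> u z - v z.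
  rewrite (continuous_open_subspace _ oQ) in cu.
  rewrite (continuous_open_subspace _ oQ) in cv.
  by apply: cvgB; [apply: cu|apply: cv]; rewrite inE.
have uv0 : u z - v z != 0 by rewrite subr_eq0; apply/eqP.
have : nbhs z [set y | dom half y /\ u y <> v y].
  near=> y; split; first by near: y; exact: open_nbhs_nbhs.
  have : u y - v y != 0 by near: y; exact: cvgr_neq0 cw uv0.
  by move=> + E; rewrite E subrr eqxx.
move=> /nbhs_box[a [b [ab sub]]].
apply: (@box_not_negligible _ _ a b).
  by move=> j; have /andP[h1 h2] := ab j; exact: lt_trans h2.
exact: negligibleS ae_uv.
Unshelve. all: by end_near. Qed.
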